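(* Let $S$ be a locally compact subcartesian space. Then $\mathrm{Vect}(S)$ is a Lie subalgebra of $\mathrm{Der}\,C^\infty(S)$ (with the commutator bracket) and is a $C^\infty(S)$-module.
   Context: Differential spaces. A differential structure on a nonempty set $X$ is a nonempty family $\mathcal{F}$ of functions $X\to\mathbb{R}$, with the weakest topology making them continuous, closed under $F(f_1,\dots,f_k)$ for $F\in C^\infty(\mathbb{R}^k)$, and such that any function locally (near each point) agreeing with elements of $\mathcal{F}$ is in $\mathcal{F}$. A map is smooth if it pulls back functions of the differential structure to functions of the differential structure. A subset $Y\subseteq X$ is a differential subspace with the functions that locally agree with restrictions of elements of $\mathcal{F}$. A subcartesian space is a paracompact, second-countable, Hausdorff differential space $(S,C^\infty(S))$ in which every point has an open neighbourhood diffeomorphic to a differential subspace of some $\mathbb{R}^n$. Vector fields. $\mathrm{Der}\,C^\infty(S)$ is the set of linear maps $X:C^\infty(S)\to C^\infty(S)$ with $X(fg)=fX(g)+gX(f)$. For $X\in\mathrm{Der}\,C^\infty(S)$ and $x\in S$, there is a unique maximal integral curve $t\mapsto\exp(tX)(x)$ through $x$: a smooth map from a connected subset $I^X_x\subseteq\mathbb{R}$ containing $0$ to $S$ with $\exp(0X)(x)=x$ and $\frac{d}{dt}f(\exp(tX)(x))=(Xf)(\exp(tX)(x))$ for all $f\in C^\infty(S)$, $t\in I_x^X$, with maximal domain among such curves (a map with domain $\{0\}$ counts as an integral curve of every derivation). $X$ is a vector field if $A^X=\{(t,x)\mid x\in S, t\in I^X_x\}$ is open in $\mathbb{R}\times S$.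 $\mathrm{Vect}(S)$ is the set of vector fields. *)

(* Defs.v *)
From HB Require Import structures.
From mathcomp Require Import all_boot all_order all_algebra.
From mathcomp Require Import all_classical all_reals all_analysis.
From mathcomp Require Import ring.
Set Implicit Arguments.
Unset Strict Implicit.
Unset Printing Implicit Defensive.
Import Order.TTheory GRing.Theory Num.Theory.
Import numFieldNormedType.Exports.
Local Open Scope classical_set_scope.
Local Open Scope ring_scope.

(* [iter_partial F [:: i1; ...; ik]] is d/dx_i1 (... (d/dx_ik F)). *)
Definition iter_partial (R : realType) (n : nat) (F : 'rV[R]_n -> R)
    (s : seq 'I_n) : 'rV[R]_n -> R :=
  foldr (fun i G => 'D_(delta_mx ord0 i : 'rV[R]_n) G) F s.

Definition Cinf_rV (R : realType) (n : nat) : set ('rV[R]_n -> R) :=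
  [set F | forall s : seq 'I_n,
     continuous (iter_partial F s) /\
     forall (i : 'I_n) (x : 'rV[R]_n),
       derivable (iter_partial F s) x (delta_mx ord0 i : 'rV[R]_n)].

Definition Cinf_R (R : realType) : set (R -> R) :=
  [set f | forall (n : nat) (t : R), derivable (derive1n n f) t 1].

(* The weakest topology for which the elements of [F] are continuous. *)
Definition initial_open (R : realType) (T : topologicalType)
    (F : set (T -> R)) : set (set T) :=
  @open (sup_topology (fun f : {f : T -> R | F f} =>
           Topological.class (initial_topology (sval f)))).

HB.mixin Record isDifferentialSpace (R : realType) S of Topological S := {
  Cinf : set (S -> R) ;
  diffspace_nonempty : [set: S] !=set0 ;
  Cinf_nonempty : Cinf !=set0 ;
  Cinf_topology : @open S = initial_open Cinf ;
  Cinf_comp : forall (k : nat) (F : 'rV[R]_k -> R) (f : 'I_k -> S -> R),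
    Cinf_rV F -> (forall i, Cinf (f i)) ->
    Cinf (fun x => F (\row_(i < k) f i x)) ;
  Cinf_local : forall f : S -> R,
    (forall x, exists U : set S, exists g : S -> R,
       [/\ open_nbhs x U, Cinf g & forall y, U y -> f y = g y]) ->
    Cinf f }.

#[short(type="diffSpaceType")]
HB.structure Definition DifferentialSpace (R : realType) :=
  {S of Topological S & isDifferentialSpace R S}.

Arguments Cinf {R} s.

(* Given the smooth functions [F] of a space [T], the smooth functions of its
   differential subspace [Y].  A function on [Y] is represented by any of its
   extensions to [T]; its values outside [Y] are irrelevant. *)
Definition sub_Cinf (R : realType) (T : topologicalType) (F : set (T -> R))
    (Y : set T) : set (T -> R) :=
  [set g | forall y, Y y -> exists U : set T, exists f : T -> R,
     [/\ open_nbhs y U, F f & forall z, U z -> Y z -> g z = f z]].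

Definition smooth_map (R : realType) (T U : topologicalType)
    (F : set (T -> R)) (A : set T) (G : set (U -> R)) (B : set U)
    (phi : T -> U) : Prop :=
  (forall x, A x -> B (phi x)) /\
  (forall g, sub_Cinf G B g -> sub_Cinf F A (g \o phi)).

Definition diffeomorphic (R : realType) (T U : topologicalType)
    (F : set (T -> R)) (A : set T) (G : set (U -> R)) (B : set U) : Prop :=
  exists (phi : T -> U) (psi : U -> T),
    [/\ smooth_map F A G B phi, smooth_map G B F A psi,
        forall x, A x -> psi (phi x) = x & forall y, B y -> phi (psi y) = y].

Definition paracompact (T : topologicalType) : Prop :=
  forall C : set (set T), C `<=` open -> \bigcup_(U in C) U = setT ->
  exists D : set (set T),
    [/\ D `<=` open, \bigcup_(V in D) V = setT,
        forall V, D V -> exists2 U, C U & V `<=` U &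
        forall x : T, exists2 W, nbhs x W &
          finite_set [set V | D V /\ V `&` W !=set0]].

Definition subcartesian (R : realType) (S : diffSpaceType R) : Prop :=
  [/\ paracompact S, @second_countable S, hausdorff_space S &
      forall x : S, exists (U : set S) (n : nat) (Y : set 'rV[R]_n),
        open_nbhs x U /\ diffeomorphic (Cinf S) U (@Cinf_rV R n) Y].

Section Cinf_closed.
Variables (R : realType) (S : diffSpaceType R).
Implicit Types f g : S -> R.

Let coord (n : nat) (j : 'I_n) : 'rV[R]_n -> R := fun x => x ord0 j.

Let is_derive_coord n (j : 'I_n) (x v : 'rV[R]_n) :
  is_derive x v (coord j) (v ord0 j).
Proof.
have H : \forall h \near (0 : R)^',
    h^-1 *: ((coord j \o shift x) (h *: v) - coord j x) = v ord0 j.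
  near=> h; rewrite /coord /= !mxE addrK /GRing.scale /= mulrA mulVf ?mul1r//.
  by near: h; exact: nbhs_dnbhs_neq.
split; first exact: (is_cvg_near_cst (v ord0 j)).
exact: lim_near_cst.
Unshelve. all: by end_near. Qed.

Let quad (a b c d : R) : 'rV[R]_2 -> R :=
  cst a + b \*: coord ord0 + c \*: coord ord_max
    + d \*: (coord ord0 * coord ord_max).

Let is_derive_quad a b c d x (v : 'rV[R]_2) :
  is_derive x v (quad a b c d)
    (quad (b * v ord0 ord0 + c * v ord0 ord_max)
       (d * v ord0 ord_max) (d * v ord0 ord0) 0 x).
Proof.
have D0 := @is_derive_coord 2 ord0 x v.
have D1 := @is_derive_coord 2 ord_max x v.
have D := is_deriveD (is_deriveD (is_deriveD (is_derive_cst a x v)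
  (is_deriveZ b D0)) (is_deriveZ c D1)) (is_deriveZ d (is_deriveM D0 D1)).
apply: (is_derive_eq D).
rewrite /quad /coord /GRing.scale !addrfctE /= /GRing.scale /=; ring.
Qed.

Let quad_continuous a b c d : continuous (quad a b c d).
Proof.
have cc n (j : 'I_n) : continuous (coord j) by exact: coord_continuous.
move=> x; rewrite /quad.
apply: continuousD; last by apply: continuousZl_tmp; apply: continuousM; exact: cc.
apply: continuousD; last by apply: continuousZl_tmp; exact: cc.
by apply: continuousD; [exact: cst_continuous|apply: continuousZl_tmp; exact: cc].
Qed.

Let quad_iter a b c d s :
  exists a' b' c' d', iter_partial (quad a b c d) s = quad a' b' c' d'.
Proof.
elim: s => [|i s [a' [b' [c' [d' /= ->]]]]]; first by exists a, b, c, d.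
do 4 eexists; apply/funext => x.
have [_ ->] := is_derive_quad a' b' c' d' x (delta_mx ord0 i); reflexivity.
Qed.

Let Cinf_quad a b c d : Cinf_rV (quad a b c d).
Proof.
move=> s; have [a' [b' [c' [d' ->]]]] := quad_iter a b c d s.
split=> [|i x]; first exact: quad_continuous.
by have [] := is_derive_quad a' b' c' d' x (delta_mx ord0 i).
Qed.

Let Cinf_quad_comp a b c d f g : Cinf S f -> Cinf S g ->
  Cinf S (fun x => a + b * f x + c * g x + d * (f x * g x)).
Proof.
move=> Sf Sg.
have := @Cinf_comp R S 2 (quad a b c d)
  (fun i => if i == ord0 then f else g) (Cinf_quad a b c d).
rewrite (_ : (fun x : S => _) =
    (fun x => a + b * f x + c * g x + d * (f x * g x))).
  by apply=> i; case: ifP.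
by apply/funext => x; rewrite /quad /coord !addrfctE /= !mulrfctE /= !mxE.
Qed.

Lemma Cinf_cst (a : R) : Cinf S (cst a).
Proof.
have [f Sf] := @Cinf_nonempty R S.
have := Cinf_quad_comp a 0 0 0 Sf Sf.
by congr (Cinf S _); apply/funext => x; rewrite !mul0r !addr0.
Qed.

Lemma Cinf_lin (a : R) f g : Cinf S f -> Cinf S g -> Cinf S (a *: f + g).
Proof.
move=> Sf Sg; have := Cinf_quad_comp 0 a 1 0 Sf Sg.
by congr (Cinf S _); apply/funext => x; rewrite mul0r addr0 add0r mul1r.
Qed.

Lemma Cinf_mul f g : Cinf S f -> Cinf S g -> Cinf S (f * g).
Proof.
move=> Sf Sg; have := Cinf_quad_comp 0 0 0 1 Sf Sg.
by congr (Cinf S _); apply/funext => x; rewrite !mul0r !add0r mul1r.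
Qed.

End Cinf_closed.

Definition smooth_pred (R : realType) (S : diffSpaceType R) : {pred S -> R} :=
  mem (Cinf S).

Record smooth_fun (R : realType) (S : diffSpaceType R) := SmoothFun {
  smooth_val :> S -> R ;
  smooth_valP : smooth_val \in @smooth_pred R S }.

Section smooth_fun_instances.
Variables (R : realType) (S : diffSpaceType R).

Let subring : subring_closed (@smooth_pred R S).
Proof.
split=> [|f g|f g]; rewrite !inE; first exact: Cinf_cst.
  move=> Sf Sg; rewrite -scaleN1r addrC; exact: Cinf_lin.
exact: Cinf_mul.
Qed.

Let submod : submod_closed (@smooth_pred R S).
Proof.
split=> [|a f g]; rewrite !inE; first exact: Cinf_cst.
exact: Cinf_lin.
Qed.

HB.instance Definition _ :=
  GRing.isSubringClosed.Build _ (@smooth_pred R S) subring.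
HB.instance Definition _ :=
  GRing.isSubmodClosed.Build _ _ (@smooth_pred R S) submod.
HB.instance Definition _ := [isSub for @smooth_val R S].
HB.instance Definition _ := [Choice of smooth_fun S by <:].
HB.instance Definition _ := 
  GRing.SubChoice_isSubComPzRing.Build _ _ (smooth_fun S) (GRing.subringClosedP _).
HB.instance Definition _ := [SubZmodule_isSubLmodule of smooth_fun S by <:].
End smooth_fun_instances.

Notation "'C^oo(' S )" := (smooth_fun S) (format "'C^oo(' S )").

Definition derivation (R : realType) (S : diffSpaceType R) :
    set (C^oo(S) -> C^oo(S)) :=
  [set X : C^oo(S) -> C^oo(S) |
     linear X /\ forall f g : C^oo(S), X (f * g) = f * X g + g * X f].

(* For [I = [set 0]] the filter [within I 0^'] is improper, so the derivative
   condition holds vacuously and the constant curve is an integral curve of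
   every derivation.  If [I] is a nondegenerate interval containing one of its
   endpoints, the derivative there is one-sided. *)
Definition integral_curve (R : realType) (S : diffSpaceType R)
    (X : C^oo(S) -> C^oo(S)) (x : S) (I : set R) (c : R -> S) : Prop :=
  [/\ connected I, I 0, smooth_map (@Cinf_R R) I (Cinf S) setT c, c 0 = x &
      forall (f : C^oo(S)) (t : R), I t ->
        (fun s => (f (c s) - f (c t)) / (s - t)) @ within I t^'
          --> X f (c t)].

Definition maximal_integral_curve (R : realType) (S : diffSpaceType R)
    (X : C^oo(S) -> C^oo(S)) (x : S) (I : set R) (c : R -> S) : Prop :=
  integral_curve X x I c /\
  forall J d, integral_curve X x J d -> I `<=` J -> J = I.

Definition flow_domain (R : realType) (S : diffSpaceType R)
    (X : C^oo(S) -> C^oo(S)) : set (R * S) :=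
  [set p | exists I c, maximal_integral_curve X p.2 I c /\ I p.1].

Definition Vect (R : realType) (S : diffSpaceType R) :
    set (C^oo(S) -> C^oo(S)) :=
  [set X | derivation X /\ open (flow_domain X)].

Definition commutator (R : realType) (S : diffSpaceType R)
    (X Y : C^oo(S) -> C^oo(S)) : C^oo(S) -> C^oo(S) :=
  fun f => X (Y f) - Y (X f).

Definition lie_subalgebra (R : realType) (S : diffSpaceType R)
    (V L : set (C^oo(S) -> C^oo(S))) : Prop :=
  [/\ V `<=` L, @GRing.submod_closed R (C^oo(S) -> C^oo(S)) (mem V) &
      forall X Y, V X -> V Y -> V (commutator X Y)].

(* [C^oo(S)] acts on maps by [(f *: X) g = f * X g]. *)
Definition Cinf_submodule (R : realType) (S : diffSpaceType R)
    (V : set (C^oo(S) -> C^oo(S))) : Prop :=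
  @GRing.submod_closed C^oo(S) (C^oo(S) -> C^oo(S)^o) (mem V).

Lemma derivation_lie_subalgebra (R : realType) (S : diffSpaceType R) :
  lie_subalgebra (@derivation R S) (@derivation R S).
Proof.
split=> //; first split=> [|a X Y]; rewrite ?inE.
- by split=> [a f g|f g]; rewrite ?mulr0 ?scaler0 ?addr0.
- move=> [lX dX] [lY dY]; split=> [b f g|f g]; rewrite !addrfctE !scalrfctE.
    by rewrite lX lY !scalerDr !scalerA (mulrC a b) addrACA.
  apply/val_inj/funext => x; rewrite dX dY /= !addrfctE !scalrfctE !mulrfctE.
  by rewrite /= /GRing.scale /=; ring.
- move=> X Y [lX dX] [lY dY]; split=> [b f g|f g]; rewrite /commutator.
    rewrite lX lY lX lY scalerBr.
    by rewrite opprD addrACA.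
  have addX (u v : C^oo(S)) : X (u + v) = X u + X v.
    by have := lX 1 u v; rewrite !scale1r.
  have addY (u v : C^oo(S)) : Y (u + v) = Y u + Y v.
    by have := lY 1 u v; rewrite !scale1r.
  rewrite dX dY addX addY !dX !dY; ring.
Qed.

Lemma derivation_Cinf_submodule (R : realType) (S : diffSpaceType R) :
  Cinf_submodule (@derivation R S).
Proof.
split=> [|h X Y]; rewrite ?inE.
  by split=> [a f g|f g]; rewrite ?mulr0 ?scaler0 ?addr0.
move=> [lX dX] [lY dY]; split=> [b f g|f g];
  rewrite !addrfctE !scalrfctE /GRing.scale /=.
  apply/val_inj/funext => x; rewrite lX lY /= !addrfctE !scalrfctE !mulrfctE.
  by rewrite /= ?addrfctE ?scalrfctE /= /GRing.scale /=; ring.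
by rewrite dX dY; ring.
Qed.

(* Main.v *)
Require Import Defs.
From mathcomp Require Import all_boot all_order all_algebra.
From mathcomp Require Import all_classical all_reals all_analysis.
From mathcomp Require Import ring lra.

(** Say that a derivation [Z] annihilates minima if [Z rho] vanishes at every local
    minimum of every smooth function [rho].  On a locally compact subcartesian space
    the vector fields are exactly the derivations with this property ([VectP]).  The
    property is visibly preserved by sums and by multiplication with smooth functions,
    so both module structures follow at once and only the bracket needs an argument.

    A vector field annihilates minima because its flow domain is open: through a local
    minimum [k] of [rho] there are integral curves for some positive and for some
    negative times, along which [rho] cannot decrease ([Vect_annihilates_minima]).

    Conversely, let [Z] annihilate minima.  In a chart [f] the functions [Z (f i)] are
    smooth functions [G i] of the coordinates, and the equation [u' = G u] has solutions
    in Euclidean space ([picard]).  Such a solution cannot leave the image [f K] of a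
    compact neighbourhood [K] ([viability], an argument of Bony and Brezis): for small [t]
    the point [k] of [K] whose image is nearest to [u t] is interior to [K], hence a local
    minimum of the squared distance to [u t], so the property says that [G (f k)] is orthogonal to [u t - f k], and
    Gronwall's inequality keeps the distance equal to zero.  The solution therefore
    lifts to [S].  The lift is an integral curve of [Z] because the chain rule for [Z] is
    again a statement on minima: a smooth function minus its first order Taylor
    polynomial in [f], plus a large multiple of the squared distance, has a local minimum
    ([annihilates_minima_chain]).  So integral curves exist for a time that is locally
    uniform ([local_flow]); since they depend continuously on the initial point, the
    flow domain is open ([flow_domain_open]).

    For the bracket, move a minimum [k] of [rho] along the flows of [X], [Y] and [X] for
    the times [-s], [l * s] and [s].  The value of [rho] does not decrease, and its
    change is [s ^+ 2] times [l ^+ 2 / 2 * Y (Y rho) k - l * [X, Y] rho k] up to third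
    order; letting [l] tend to [0] from both sides gives [[X, Y] rho k = 0]
    ([annihilates_minima_commutator]).

    All of this rests on the uniqueness of integral curves ([along_unique]), again by
    Gronwall's inequality in charts, which with Zorn's lemma yields the maximal integral
    curves in the definition of the flow domain ([maximal_extension]). *)

Set Implicit Arguments.
Unset Strict Implicit.
Unset Printing Implicit Defensive.
Import Order.TTheory GRing.Theory Num.Theory.
Import numFieldNormedType.Exports.
Local Open Scope classical_set_scope.
Local Open Scope ring_scope.

(** * Induction along an interval, slopes and Gronwall's inequality *)

Section RealInduction.
Variable R : realType.

Lemma near_left (a s r : R) : a < s -> 0 < r ->
  exists v, [/\ a <= v, v < s & `|v - s| < r].
Proof.
move=> as_ r0; exists (Num.max a (s - r / 2)).
have vs : Num.max a (s - r / 2) < s by rewrite gt_max as_ ltrBlDr ltrDl divr_gt0.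
split=> //; first by rewrite le_max lexx.
rewrite distrC gtr0_norm ?subr_gt0// ltrBlDl -ltrBlDr lt_max; apply/orP; right.
by rewrite ltrD2l ltrN2 ltr_pdivrMr// ltr_pMr// ltr1n.
Qed.

Lemma norm_lt_near (s t T : R) : `|s - t| < T - `|t| -> `|s| < T.
Proof.
move=> st; rewrite -(subrK t s).
by apply: (le_lt_trans (ler_normD _ _)); rewrite -ltrBrDr.
Qed.

(** Every argument below that follows a curve until a first exit time, or up to the
    supremum of the good times, goes through this principle. *)
Lemma real_induction (P : R -> Prop) (a b : R) :
  P a ->
  (forall s, a <= s < b -> (forall t, a <= t <= s -> P t) ->
     exists2 r, 0 < r & forall t, s < t < s + r -> t <= b -> P t) ->
  (forall s, a < s <= b -> (forall t, a <= t < s -> P t) -> P s) ->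
  forall t, a <= t <= b -> P t.
Proof.
move=> Pa right left t0 /andP[at0 t0b].
have ab : a <= b by exact: le_trans t0b.
pose E := [set s | a <= s <= b /\ forall t, a <= t <= s -> P t].
have Ea : E a.
  split=> [|t /andP[at1 ta]]; first by rewrite lexx.
  by rewrite (@le_anti _ _ t a) // ta at1.
have supE : has_sup E by split; [exists a|exists b => s [/andP[]]].
set m := sup E.
have am : a <= m by apply: ub_le_sup => //; case: supE.
have mb : m <= b by apply: ge_sup; [exists a|move=> s [/andP[]]].
have below t : a <= t < m -> P t.
  move=> /andP[a_t tm].
  have [s [sab Ps] ts] : exists2 s, E s & t < s.
    by apply: sup_gt => //; exists a.
  by apply: Ps; rewrite a_t ltW.
have Pm : P m.
  have [->//|am'] := eqVneq m a.
  by apply: left => //; rewrite mb lt_neqAle eq_sym am' am.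
have upto t : a <= t <= m -> P t.
  move=> /andP[a_t]; rewrite le_eqVlt => /predU1P[->//|tm].
  by apply: below; rewrite a_t.
have [mb'|bm] := ltP m b; last by apply: upto; rewrite at0 (le_trans t0b).
have [|r r0 Pr] := right m _ upto; first by rewrite am.
pose s := Num.min (m + r / 2) b.
have ms : m < s by rewrite lt_min mb' andbT ltrDl divr_gt0.
suff : E s by move/(ub_le_sup supE.2); rewrite leNgt -/m ms.
have sb : s <= b by rewrite ge_min lexx orbT.
split=> [|t /andP[a_t ts]]; first by rewrite sb (le_trans am) // ltW.
have [tm|mt] := leP t m; first by apply: upto; rewrite a_t.
apply: Pr; last exact: le_trans sb.
rewrite mt (le_lt_trans ts) // (@le_lt_trans _ _ (m + r / 2)) //.
  by rewrite ge_min lexx.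
by rewrite ltrD2l ltr_pdivrMr // ltr_pMr // ltr1n.
Qed.

End RealInduction.

(** The derivative of [h] at [t] within [I]: one-sided at an end point of an
    interval, vacuous at an isolated point.  Written as an inequality rather than
    as the limit of a quotient, so that [s = t] needs no separate treatment. *)
Definition has_slope (R : realType) (I : set R) (h : R -> R) (t d : R) :=
  forall e, 0 < e -> exists2 r, 0 < r & forall s, I s -> `|s - t| < r ->
    `|h s - h t - d * (s - t)| <= e * `|s - t|.

Section Slopes.
Variable R : realType.
Implicit Types (I : set R) (h g : R -> R) (t d : R).

Lemma has_slope_sub I J h t d : J `<=` I -> has_slope I h t d -> has_slope J h t d.
Proof.
by move=> JI H e /H[r r0 Hr]; exists r => // s /JI; exact: Hr.
Qed.

Lemma has_slope_local I J h g t d r : 0 < r -> h t = g t ->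
  (forall s, I s -> `|s - t| < r -> J s /\ h s = g s) ->
  has_slope J g t d -> has_slope I h t d.
Proof.
move=> r0 htgt hg H e /H[q q0 Hq]; exists (Num.min r q).
  by rewrite lt_min r0.
move=> s Is; rewrite lt_min => /andP[sr sq].
by have [Js ->] := hg s Is sr; rewrite htgt; exact: Hq.
Qed.

Lemma has_slope_cst I t c : has_slope I (fun=> c) t 0.
Proof.
move=> e e0; exists 1 => // s _ _.
by rewrite subrr mul0r subrr normr0 mulr_ge0 // ltW.
Qed.

Lemma has_slope_id I t : has_slope I id t 1.
Proof.
move=> e e0; exists 1 => // s _ _.
by rewrite mul1r subrr normr0 mulr_ge0 // ltW.
Qed.

Lemma has_slopeD I h g t d d' :
  has_slope I h t d -> has_slope I g t d' ->
  has_slope I (fun s => h s + g s) t (d + d').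
Proof.
move=> H G e e0; have e2 : 0 < e / 2 by rewrite divr_gt0.
have [r r0 Hr] := H _ e2; have [q q0 Gq] := G _ e2.
exists (Num.min r q); first by rewrite lt_min r0.
move=> s Is; rewrite lt_min => /andP[sr sq].
rewrite (_ : _ - _ - _ = (h s - h t - d * (s - t)) + (g s - g t - d' * (s - t)));
  last by ring.
apply: (le_trans (ler_normD _ _)); rewrite (splitr e) mulrDl.
by apply: lerD; [exact: Hr|exact: Gq].
Qed.

Lemma has_slopeZ I h t d c :
  has_slope I h t d -> has_slope I (fun s => c * h s) t (c * d).
Proof.
move=> H e e0.
have k0 : 0 < `|c| + 1 by rewrite ltr_wpDl.
have [|r r0 Hr] := H (e / (`|c| + 1)); first by rewrite divr_gt0.
exists r => // s Is sr.
rewrite (_ : _ - _ - _ = c * (h s - h t - d * (s - t))); last by ring.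
rewrite normrM; apply: (@le_trans _ _ ((`|c| + 1) * (e / (`|c| + 1) * `|s - t|))).
  by apply: ler_pM => //; [rewrite lerDl|exact: Hr].
by rewrite mulrA [X in X * _]mulrC divfK // gt_eqF.
Qed.

Lemma has_slopeB I h g t d d' :
  has_slope I h t d -> has_slope I g t d' ->
  has_slope I (fun s => h s - g s) t (d - d').
Proof.
move=> H /(has_slopeZ (-1)) G; have := has_slopeD H G.
rewrite mulN1r; congr (has_slope _ _ _ _).
by apply/funext => s; rewrite mulN1r.
Qed.

Lemma has_slope_sum I n (h : 'I_n -> R -> R) t (d : 'I_n -> R) :
  (forall i, has_slope I (h i) t (d i)) ->
  has_slope I (fun s => \sum_i h i s) t (\sum_i d i).
Proof.
elim: n h d => [|n IH] h d H.
  rewrite big_ord0 (_ : (fun s => _) = fun=> 0); first exact: has_slope_cst.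
  by apply/funext => s; rewrite big_ord0.
rewrite big_ord_recr /=.
rewrite (_ : (fun s => _) = fun s => \sum_(i < n) h (widen_ord (leqnSn n) i) s
  + h ord_max s).
  by apply: has_slopeD => //; apply: IH.
by apply/funext => s; rewrite big_ord_recr.
Qed.

Lemma has_slope_bound I h t d : has_slope I h t d ->
  exists2 r, 0 < r & forall s, I s -> `|s - t| < r ->
    `|h s - h t| <= (`|d| + 1) * `|s - t|.
Proof.
move=> /(_ 1 ltr01)[r r0 H]; exists r => // s Is sr.
rewrite (_ : h s - h t = d * (s - t) + (h s - h t - d * (s - t))); last by ring.
apply: (le_trans (ler_normD _ _)); rewrite mulrDl normrM.
by apply: lerD => //; exact: H.
Qed.

Lemma has_slope_cont I h t d : has_slope I h t d ->
  forall e, 0 < e -> exists2 r, 0 < r & forall s, I s -> `|s - t| < r ->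
    `|h s - h t| < e.
Proof.
move=> /has_slope_bound[r r0 H] e e0.
have k0 : 0 < `|d| + 1 by rewrite ltr_wpDl.
exists (Num.min r (e / (`|d| + 1))); first by rewrite lt_min r0 divr_gt0.
move=> s Is; rewrite lt_min => /andP[sr se].
by rewrite (le_lt_trans (H _ Is sr)) // mulrC -ltr_pdivlMr.
Qed.

Lemma has_slopeM I h g t d d' :
  has_slope I h t d -> has_slope I g t d' ->
  has_slope I (fun s => h s * g s) t (h t * d' + d * g t).
Proof.
move=> H G e e0.
pose A := `|h t| + 1; pose B := `|g t| + 1; pose C := `|d'| + 1.
have A0 : 0 < A by rewrite ltr_wpDl.
have B0 : 0 < B by rewrite ltr_wpDl.
have C0 : 0 < C by rewrite ltr_wpDl.
have e3 : 0 < e / 3 by rewrite divr_gt0.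
have [r1 r10 H1] := H (e / 3 / B) (divr_gt0 e3 B0).
have [r2 r20 G1] := G (e / 3 / A) (divr_gt0 e3 A0).
have [r3 r30 G2] := has_slope_bound G.
have [r4 r40 H2] := has_slope_cont H (divr_gt0 e3 C0).
exists (Num.min (Num.min r1 r2) (Num.min r3 r4)).
  by rewrite !lt_min r10 r20 r30.
move=> s Is; rewrite !lt_min => /andP[/andP[s1 s2] /andP[s3 s4]].
have {}H1 := H1 _ Is s1; have {}G1 := G1 _ Is s2.
have {}G2 := G2 _ Is s3; have {}H2 := H2 _ Is s4.
rewrite (_ : _ - _ - _ = (h s - h t - d * (s - t)) * g t
  + h t * (g s - g t - d' * (s - t)) + (h s - h t) * (g s - g t)); last by ring.
apply: (le_trans (ler_normD _ _)).
rewrite (_ : e * _ = e / 3 * `|s - t| + e / 3 * `|s - t| + e / 3 * `|s - t|);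
  last by field.
apply: lerD.
  apply: (le_trans (ler_normD _ _)); rewrite !normrM; apply: lerD.
    apply: (@le_trans _ _ (e / 3 / B * `|s - t| * B)).
      by apply: ler_pM => //; rewrite lerDl.
    by rewrite mulrAC divfK // gt_eqF.
  apply: (@le_trans _ _ (A * (e / 3 / A * `|s - t|))).
    by apply: ler_pM => //; rewrite lerDl.
  by rewrite mulrA [A * _]mulrC divfK // gt_eqF.
rewrite normrM; apply: (@le_trans _ _ (e / 3 / C * (C * `|s - t|))).
  by apply: ler_pM => //; exact: ltW.
by rewrite mulrA divfK // gt_eqF.
Qed.

Lemma has_slope_opp I h t d :
  has_slope I h t d -> has_slope [set s | I (- s)] (fun s => h (- s)) (- t) (- d).
Proof.
move=> H e /H[r r0 Hr]; exists r => // s /= Is.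
rewrite opprK => sr.
have E : `|- s - t| = `|s + t| by rewrite -opprD normrN.
have := Hr _ Is; rewrite E => /(_ sr).
by congr (`|_| <= _); ring.
Qed.

Lemma has_slope_shift I h t d c :
  has_slope I h t d ->
  has_slope [set s | I (s - c)] (fun s => h (s - c)) (t + c) d.
Proof.
move=> H e /H[r r0 Hr]; exists r => // s /= Is.
rewrite addrK => sr.
have E : s - c - t = s - (t + c) by ring.
by have := Hr _ Is; rewrite E => /(_ sr).
Qed.

(** One-sided slopes at the end points suffice, because the bound is propagated
    from left to right, with a margin [e] that absorbs the error terms. *)
Lemma mean_value_bound (a b M : R) h (d : R -> R) : a <= b ->
  (forall t, a <= t <= b -> has_slope [set s | a <= s <= b] h t (d t)) ->
  (forall t, a <= t <= b -> `|d t| <= M) ->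
  `|h b - h a| <= M * (b - a).
Proof.
move=> ab H dM.
suff: forall e, 0 < e -> forall t, a <= t <= b -> `|h t - h a| <= (M + e) * (t - a).
  move=> P; apply/ler_addgt0Pr => e e0.
  have k0 : 0 < b - a + 1 by rewrite ltr_wpDl ?subr_ge0.
  have := P (e / (b - a + 1)) (divr_gt0 e0 k0) b; rewrite ab lexx => /(_ isT).
  move=> /le_trans; apply; rewrite mulrDl lerD2l -mulrA ler_piMr ?ltW//.
  by rewrite mulrC ltr_pdivrMr// mul1r ltrDl.
move=> e e0; apply: real_induction.
- by rewrite !subrr normr0 mulr0.
- move=> s /andP[as_ sb] Ps.
  have sab : a <= s <= b by rewrite as_ ltW.
  have [r r0 Hr] := H s sab e e0; exists r => // t /andP[st tr] tb.
  have tab : a <= t <= b by rewrite tb (le_trans as_) // ltW.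
  have := Hr t tab; rewrite gtr0_norm ?subr_gt0//.
  rewrite ltrBlDr addrC => /(_ tr) Ht.
  have := Ps s; rewrite as_ lexx => /(_ isT) Hs.
  rewrite (_ : h t - h a = (h t - h s - d s * (t - s)) + d s * (t - s) + (h s - h a));
    last by ring.
  apply: (le_trans (ler_normD _ _)).
  rewrite (_ : (M + e) * _ = (M + e) * (t - s) + (M + e) * (s - a)); last by ring.
  apply: lerD => //; apply: (le_trans (ler_normD _ _)).
  rewrite [M + e]addrC mulrDl; apply: lerD => //.
  by rewrite normrM (gtr0_norm (_ : 0 < t - s)) ?subr_gt0// ler_pM2r ?subr_gt0// dM.
- move=> s /andP[as_ sb] Ps.
  have sab : a <= s <= b by rewrite sb ltW.
  have M0 : 0 <= M by rewrite (le_trans _ (dM _ sab)).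
  apply/ler_addgt0Pr => e' e'0.
  have [r r0 Hr] := has_slope_cont (H s sab) e'0.
  have [t [a_t ts tr]] := near_left as_ r0.
  have := Hr t; rewrite /= a_t (le_trans (ltW ts) sb) => /(_ isT tr) Ht.
  have := Ps t; rewrite a_t ts => /(_ isT) Pt.
  rewrite (_ : h s - h a = (h t - h a) - (h t - h s)); last by ring.
  apply: (le_trans (ler_normB _ _)); apply: lerD; last exact: ltW.
  apply: (le_trans Pt); rewrite ler_pM2l ?ltr_wpDl// lerD2r; exact: ltW.
Qed.

(** Gronwall's inequality for a function with an upper right Dini bound, such as a
    distance to a set, that need not be differentiable.  A step to the right cannot
    overtake [m * exp ((C + 1) (t - a))], which grows faster than the Dini bound
    allows; the second hypothesis says that [D] does not jump up on arrival from
    the left, which carries the bound over to limits. *)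
Lemma gronwall_dini (a b C : R) (D : R -> R) : 0 <= C ->
  (forall t, a <= t < b -> forall e, 0 < e -> exists2 r, 0 < r &
     forall s, t < s < t + r -> s <= b -> D s <= D t + (s - t) * (C * D t + e)) ->
  (forall t, a < t <= b -> forall e, 0 < e -> exists2 r, 0 < r &
     forall s, a <= s < t -> t - r < s -> D t <= D s + e) ->
  forall m, 0 < m -> D a <= m ->
  forall t, a <= t <= b -> D t <= m * expR ((C + 1) * (t - a)).
Proof.
move=> C0 right left m m0 Dm; apply: real_induction.
- by rewrite subrr mulr0 expR0 mulr1.
- move=> s sab Ps; have /andP[as_ sb] := sab.
  set B := m * expR ((C + 1) * (s - a)).
  have B0 : 0 < B by rewrite mulr_gt0 // expR_gt0.
  have [r r0 Hr] := right s sab B B0; exists r => // t tr tb.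
  apply: (le_trans (Hr t tr tb)); have /andP[st _] := tr.
  have DB : D s <= B by apply: Ps; rewrite as_ lexx.
  rewrite (_ : (C + 1) * (t - a) = (C + 1) * (s - a) + (C + 1) * (t - s)); last by ring.
  rewrite expRD mulrA -/B.
  apply: (@le_trans _ _ (B * (1 + (C + 1) * (t - s)))).
    have CB : C * D s <= C * B by rewrite ler_wpM2l.
    have : (t - s) * (C * D s + B) <= (t - s) * (C * B + B).
      by rewrite ler_pM2l ?subr_gt0// lerD2r.
    lra.
  by rewrite ler_pM2l// expR_ge1Dx.
- move=> s sab Ps; have /andP[as_ sb] := sab.
  apply/ler_addgt0Pr => e e0; have [r r0 Hr] := left s sab e e0.
  have [t [a_t ts tr']] := near_left as_ r0.
  have tr : s - r < t by move: tr'; rewrite ltr_norml => /andP[h _]; lra.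
  have := Hr t; rewrite a_t ts => /(_ isT tr) Ht; apply: (le_trans Ht).
  rewrite lerD2r; have := Ps t; rewrite a_t ts => /(_ isT) /le_trans; apply.
  rewrite ler_pM2l// ler_expR; apply: ler_wpM2l; first by rewrite addr_ge0.
  by rewrite lerD2r ltW.
Qed.

End Slopes.

(** * Functions that are smooth on a part of the line *)

Section SlopeDerivative.
Variable R : realType.
Implicit Types (I : set R) (h g : R -> R) (t d : R).

Lemma has_slope_cvg I h t d :
  has_slope I h t d <->
  (fun s => (h s - h t) / (s - t)) @ within I t^' --> d.
Proof.
split=> [H|/cvgrPdist_le H e e0].
  apply/cvgrPdist_le => e e0; have [r r0 Hr] := H e e0.
  apply/nbhs_ballP; exists r => //= s; rewrite /ball /= distrC => st sNt Is.
  have st0 : s - t != 0 by rewrite subr_eq0.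
  rewrite distrC -(ler_pM2r (_ : 0 < `|s - t|)) ?normr_gt0// -normrM.
  by rewrite mulrBl divfK//; exact: Hr.
have /nbhs_ballP[r /= r0 Hr] := H e e0.
exists r => // s Is st; have [->|sNt] := eqVneq s t.
  by rewrite !subrr mulr0 subrr normr0 mulr0.
have st0 : s - t != 0 by rewrite subr_eq0.
have := Hr s; rewrite /ball /= distrC => /(_ st sNt Is).
rewrite distrC -(ler_pM2r (_ : 0 < `|s - t|)) ?normr_gt0// -normrM.
by rewrite mulrBl divfK.
Qed.

Lemma has_slope_is_derive h t d : has_slope setT h t d <-> is_derive t 1 h d.
Proof.
have E (e r : R) : 0 < e -> 0 < r ->
    (forall s, `|s - t| < r -> `|h s - h t - d * (s - t)| <= e * `|s - t|) <->
    (forall s : R, `|s| < r -> s != 0 ->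
       `|d - s^-1 *: ((h \o shift t) (s *: (1 : R)) - h t)| <= e).
  move=> e0 r0; split=> H s sr.
    move=> s0; have := H (s + t); rewrite addrK => /(_ sr).
    rewrite -(ler_pM2r (_ : 0 < `|s|^-1)) ?invr_gt0 ?normr_gt0//.
    rewrite mulfK ?normr_eq0// -normfV -normrM mulrBl mulfK// distrC.
    by rewrite /= /GRing.scale /= mulr1 [s^-1 * _]mulrC.
  have [->|sNt] := eqVneq s t; first by rewrite !subrr mulr0 subrr normr0 mulr0.
  have st0 : s - t != 0 by rewrite subr_eq0.
  have := H _ sr st0; rewrite /= /GRing.scale /= mulr1 subrK.
  rewrite distrC -(ler_pM2r (_ : 0 < `|s - t|)) ?normr_gt0// -normrM.
  by rewrite mulrBl [_^-1 * _]mulrC divfK.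
have P : has_slope setT h t d <->
    (fun s => s^-1 *: ((h \o shift t) (s *: (1 : R)) - h t)) @ 0^' --> d.
  split=> [H|/cvgrPdist_le H e e0].
    apply/cvgrPdist_le => e e0; have [r r0 Hr] := H e e0.
    apply/nbhs_ballP; exists r => //= s; rewrite /ball /= sub0r normrN => sr s0.
    by apply: (E e r e0 r0).1 => // u ur; exact: Hr.
  have /nbhs_ballP[r /= r0 Hr] := H e e0.
  exists r => // s _; apply: (E e r e0 r0).2 => u ur u0.
  by apply: Hr => //; rewrite /ball /= sub0r normrN.
rewrite P; split=> [H|[]].
  by split; [apply/cvg_ex; exists d|exact: cvg_lim].
by move=> H <-; exact: H.
Qed.

Lemma has_slopeV I h t d : h t != 0 ->
  has_slope setT h t d -> has_slope I (fun s => (h s)^-1) t (- d / h t ^+ 2).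
Proof.
move=> h0 /has_slope_is_derive H; apply: (@has_slope_sub _ setT) => //.
apply/has_slope_is_derive.
have := @is_deriveV R h t d 1 h0 H; congr (is_derive _ _ _ _).
by rewrite /GRing.scale /= mulrC mulrN mulNr.
Qed.

Lemma has_slope_affine I h t d a b :
  has_slope setT h (a * t + b) d -> has_slope I (fun s => h (a * s + b)) t (d * a).
Proof.
move=> H e e0; have k0 : 0 < `|a| + 1 by rewrite ltr_wpDl.
have [r r0 Hr] := H _ (divr_gt0 e0 k0).
exists (r / (`|a| + 1)); first by rewrite divr_gt0.
move=> s _; rewrite ltr_pdivlMr// => st.
have E : a * s + b - (a * t + b) = a * (s - t) by ring.
have L : `|a * (s - t)| <= `|s - t| * (`|a| + 1).
  by rewrite normrM mulrC ler_wpM2l// lerDl.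
have := Hr (a * s + b) Logic.I; rewrite E => /(_ (le_lt_trans L st)).
rewrite mulrA => /le_trans; apply.
apply: (le_trans (ler_wpM2l _ L)); first by rewrite divr_ge0// ltW.
by rewrite mulrCA divfK ?gt_eqF// mulrC.
Qed.

End SlopeDerivative.

(** The derivatives are existentially quantified functions constrained on [U] only,
    rather than iterates of the derivation operator: in this form sums, products and
    inverses are handled by induction on [k]. *)
Fixpoint smooth_upto (R : realType) (k : nat) (U : set R) (h : R -> R) : Prop :=
  if k is j.+1 then
    exists h', (forall t, U t -> has_slope setT h t (h' t)) /\ smooth_upto j U h'
  else True.

Section SmoothUpto.
Variable R : realType.
Implicit Types (U V : set R) (h g : R -> R).

Lemma smooth_upto_sub k U V h : V `<=` U -> smooth_upto k U h -> smooth_upto k V h.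
Proof.
move=> VU; elim: k h => //= k IH h [h' [H /IH S]].
by exists h'; split=> // t /VU; exact: H.
Qed.

Lemma smooth_upto_pred k U h : smooth_upto k.+1 U h -> smooth_upto k U h.
Proof.
elim: k h => // k IH h [h' [H S]]; exists h'; split=> //; exact: IH.
Qed.

Lemma smooth_upto_cst k U c : smooth_upto k U (fun=> c).
Proof.
elim: k c => //= k IH c; exists (fun=> 0); split=> // t _; exact: has_slope_cst.
Qed.

Lemma smooth_uptoD k U h g :
  smooth_upto k U h -> smooth_upto k U g -> smooth_upto k U (fun t => h t + g t).
Proof.
elim: k h g => //= k IH h g [h' [H Sh]] [g' [G Sg]].
exists (fun t => h' t + g' t); split; last exact: IH.
by move=> t Ut; apply: has_slopeD; [exact: H|exact: G].
Qed.

Lemma smooth_uptoM k U h g :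
  smooth_upto k U h -> smooth_upto k U g -> smooth_upto k U (fun t => h t * g t).
Proof.
elim: k h g => // k IH h g Sh Sg.
have [h' [H Sh']] := Sh; have [g' [G Sg']] := Sg.
exists (fun t => h t * g' t + h' t * g t); split.
  by move=> t Ut; apply: has_slopeM; [exact: H|exact: G].
by apply: smooth_uptoD; apply: IH => //; exact: smooth_upto_pred.
Qed.

Lemma smooth_uptoZ k U h c : smooth_upto k U h -> smooth_upto k U (fun t => c * h t).
Proof. by apply: smooth_uptoM; exact: smooth_upto_cst. Qed.

Lemma smooth_uptoV k U h : (forall t, U t -> h t != 0) ->
  smooth_upto k U h -> smooth_upto k U (fun t => (h t)^-1).
Proof.
move=> h0; elim: k => // k IH Sh; have [h' [H Sh']] := Sh.
have SV := IH (smooth_upto_pred Sh).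
exists (fun t => -1 * (h' t * ((h t)^-1 * (h t)^-1))); split.
  move=> t Ut; have := @has_slopeV R setT h t (h' t) (h0 t Ut) (H t Ut).
  by congr (has_slope _ _ _ _); rewrite -invfM mulN1r mulNr expr2.
by apply: smooth_uptoZ; do 2 (apply: smooth_uptoM => //).
Qed.

Lemma smooth_upto_affine k U h a b : smooth_upto k setT h ->
  smooth_upto k U (fun t => h (a * t + b)).
Proof.
elim: k h => // k IH h [h' [H Sh]].
exists (fun t => a * h' (a * t + b)); split; last exact/smooth_uptoZ/IH.
by move=> t _; rewrite mulrC; apply: has_slope_affine; exact: H.
Qed.

(** The iterated derivatives at a point of [U] only depend on the restriction to the
    open set [U]; this passes from witnesses on [U] to actual derivatives. *)
Lemma smooth_upto_derivable k U h g t : open U -> U t ->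
  (forall s, U s -> h s = g s) -> smooth_upto k.+1 U g ->
  derivable (derive1n k h) t 1.
Proof.
move=> oU Ut; elim: k h g => [|k IH] h g hg [g' [G Sg]].
  have /has_slope_is_derive[+ _] := G t Ut.
  apply: near_eq_derivable; apply: filterS (open_nbhs_nbhs (conj oU Ut)) => s Us.
  exact/esym/hg.
rewrite derive1Sn; apply: (IH _ g') => // s Us.
have /has_slope_is_derive[_ <-] := G s Us.
rewrite derive1E; apply: near_eq_derive.
by apply: filterS (open_nbhs_nbhs (conj oU Us)) => u Uu; exact: hg.
Qed.

Lemma Cinf_R_smooth_upto h : Cinf_R h <-> forall k, smooth_upto k setT h.
Proof.
split=> [H k|H k t].
  have : forall m, smooth_upto k setT (derive1n m h).
    elim: k => //= k IH m; exists (derive1n m.+1 h); split=> // t _.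
    apply/has_slope_is_derive; rewrite derive1nS derive1E.
    exact/derivableP/H.
  by move=> /(_ 0).
exact: (@smooth_upto_derivable k setT h h) openT _ _ (H k.+1).
Qed.

Lemma Cinf_R_affine h a b : Cinf_R h -> Cinf_R (fun t : R => h (a * t + b)).
Proof.
by move/Cinf_R_smooth_upto => H; apply/Cinf_R_smooth_upto => k; exact: smooth_upto_affine.
Qed.

End SmoothUpto.

(** * A smooth cutoff function on the line *)

Section Cutoff.
Variable R : realType.

(** The flat functions [t^-m exp(-1/t)], extended by [0] to [t <= 0].  Allowing
    all [m] at once makes the family stable under differentiation. *)
Let flat (m : nat) (t : R) : R := if 0 < t then t^-1 ^+ m * expR (- t^-1) else 0.

Let flat_le m t : 0 <= flat m t <= (m.+2)`!%:R * t ^+ 2.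
Proof.
rewrite /flat; case: ifP => [t0|_]; last by rewrite lexx mulr_ge0// sqr_ge0.
have y0 : 0 < t^-1 by rewrite invr_gt0.
apply/andP; split; first by rewrite mulr_ge0 ?expR_ge0// exprn_ge0// ltW.
have F0 : 0 < (m.+2)`!%:R :> R by rewrite ltr0n fact_gt0.
have E : t^-1 ^+ m.+2 <= (m.+2)`!%:R * expR t^-1.
  rewrite mulrC -ler_pdivrMr//.
  by apply: le_trans (expR_ge1Dxn m.+1 (ltW y0)); rewrite lerDr.
rewrite expRN ler_pdivrMr ?expR_gt0//.
rewrite -(ler_pM2r (_ : 0 < t^-1 ^+ 2)) ?exprn_gt0// -exprD addn2.
have T : t ^+ 2 * t^-1 ^+ 2 = 1 by rewrite -exprMn mulfV ?gt_eqF// expr1n.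
apply: (le_trans E); rewrite [X in _ <= X](_ : _ =
  (m.+2)`!%:R * expR t^-1 * (t ^+ 2 * t^-1 ^+ 2)); last by ring.
by rewrite T mulr1.
Qed.

Let flat_slope m t : has_slope setT (flat m) t (- m%:R * flat m.+1 t + flat m.+2 t).
Proof.
have [t0|t0|t0] := ltgtP t 0.
- rewrite {2 3}/flat !(ltNge 0 t) (ltW t0)/= mulr0 addr0.
  apply: (@has_slope_local _ _ setT _ (fun=> 0) _ _ (- t)); rewrite ?oppr_gt0//.
  + by rewrite /flat ltNge (ltW t0).
  + move=> s _; rewrite ltr_norml opprK => /andP[_ st].
    by split=> //; rewrite /flat ltNge (_ : s <= 0)//; lra.
  + exact: has_slope_cst.
- apply: (@has_slope_local _ _ setT _ (fun s => s^-1 ^+ m * expR (- s^-1)) _ _ t) => //.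
  + by rewrite /flat t0.
  + move=> s _; rewrite ltr_norml => /andP[st _].
    by split=> //; rewrite /flat (_ : 0 < s)//; lra.
  + apply/has_slope_is_derive.
    have D1 := @is_deriveV R id t 1 1 (lt0r_neq0 t0) (is_derive_id _ _).
    have D2 := is_deriveX m D1.
    have D3 := is_deriveN D1.
    have D4 := @is_derive1_comp R expR _ t _ _ (is_derive_expR _) D3.
    have D5 := is_deriveM D2 D4.
    rewrite (_ : (fun s => _) = ((fun y : R => (id y)^-1) ^+ m
      * (expR \o - (fun y : R => (id y)^-1)))); last first.
      by apply/funext => s; rewrite mulrfctE /= exprfctE.
    apply: (is_derive_eq D5).
    rewrite /flat t0 exprfctE /= opprfctE /= /GRing.scale /= mulr1.
    rewrite -exprVn; set y := t^-1; set E := expR _.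
    by case: m {D2 D5} => [|n]; rewrite ?expr0 ?exprS; ring.
- subst t; rewrite {2 3}/flat ltxx mulr0 addr0 => e e0.
  have F0 : 0 < (m.+2)`!%:R :> R by rewrite ltr0n fact_gt0.
  exists (e / (m.+2)`!%:R); first by rewrite divr_gt0.
  move=> s _; rewrite !subr0 mul0r subr0 {2}/flat ltxx subr0 => se.
  have /andP[f0 fs] := flat_le m s; rewrite ger0_norm//.
  apply: (le_trans fs); rewrite -real_normK ?num_real// expr2 mulrA ler_wpM2r//.
  by rewrite mulrC -ler_pdivlMr// ltW.
Qed.

Let flat_smooth k m : smooth_upto k setT (flat m).
Proof.
elim: k m => //= k IH m; eexists; split=> [t _|]; first exact: flat_slope.
by apply: smooth_uptoD => //; exact: smooth_uptoZ.
Qed.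

Let flat_pos t : 0 < t -> 0 < flat 0 t.
Proof. by move=> t0; rewrite /flat t0 expr0 mul1r expR_gt0. Qed.

Let flat_nonpos m t : t <= 0 -> flat m t = 0.
Proof. by move=> t0; rewrite /flat ltNge t0. Qed.

Let step (t : R) : R := flat 0 (- 1 * t + 2) / (flat 0 (- 1 * t + 2) + flat 0 (1 * t + - 1)).

Let step_smooth k : smooth_upto k setT step.
Proof.
apply: smooth_uptoM; first exact: smooth_upto_affine.
apply: smooth_uptoV => [t _|].
  apply: lt0r_neq0; have [t1|t1] := ltP 1 t.
    have /andP[F _] := flat_le 0 (-1 * t + 2).
    by apply: ltr_wpDl => //; apply: flat_pos; lra.
  have /andP[F _] := flat_le 0 (1 * t + - 1).
  by apply: ltr_pwDl => //; apply: flat_pos; lra.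
by apply: smooth_uptoD; exact: smooth_upto_affine.
Qed.

Let step1 t : t <= 1 -> step t = 1.
Proof.
move=> t1; rewrite /step (@flat_nonpos _ (1 * t + - 1)); last by lra.
by rewrite addr0 mulfV// gt_eqF// flat_pos//; lra.
Qed.

Let step0 t : 2 <= t -> step t = 0.
Proof. by move=> t2; rewrite /step flat_nonpos ?mul0r//; lra. Qed.

(** Smoothness of a curve asks for local agreement with functions that are smooth on
    the whole line, whereas a solution of a differential equation is only smooth on
    its domain.  Multiplication by a cutoff function bridges the two. *)
Lemma smooth_extension (h : R -> R) (a r : R) : 0 < r ->
  (forall k, smooth_upto k [set t | `|t - a| < 3 * r] h) ->
  exists2 g, Cinf_R g & forall t, `|t - a| < r -> h t = g t.
Proof.
move=> r0 Sh.
pose c t := step (r^-1 * t + - (a / r)) * step (- r^-1 * t + a / r).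
have Sc k U : smooth_upto k U c by apply: smooth_uptoM; exact: smooth_upto_affine.
have r'0 : r != 0 by rewrite gt_eqF.
have c1 t : `|t - a| < r -> c t = 1.
  rewrite ltr_norml => /andP[ta at_].
  rewrite /c !step1 ?mulr1// -(ler_pM2l r0) ?mulr1.
    rewrite (_ : r * _ = a - t); last by field.
    lra.
  rewrite (_ : r * _ = t - a); last by field.
  lra.
have c0 t : 2 * r <= `|t - a| -> c t = 0.
  rewrite ler_normr => /orP[ta|ta]; rewrite /c.
    rewrite (@step0 (r^-1 * t + _)) ?mul0r// -(ler_pM2l r0).
    rewrite [X in _ <= X](_ : _ = t - a); last by field.
    lra.
  rewrite (@step0 (- r^-1 * t + _)) ?mulr0// -(ler_pM2l r0).
  rewrite [X in _ <= X](_ : _ = a - t); last by field.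
  lra.
have oball (d : R) : open [set t | `|t - a| < d].
  rewrite (_ : [set t | _] = ball a d); first exact: ball_open.
  by apply/seteqP; split=> t; rewrite /ball /= distrC.
pose g t := if `|t - a| < 3 * r then h t * c t else 0.
exists g; last first.
  move=> t ta; rewrite /g c1 ?mulr1// ifT//; lra.
move=> k t; have [ta|ta] := ltP `|t - a| (3 * r).
  apply: (@smooth_upto_derivable _ k [set t | `|t - a| < 3 * r] g (fun t => h t * c t)) => //.
    by move=> s /= sa; rewrite /g sa.
  exact: smooth_uptoM.
have ocl : open [set t | 2 * r < `|t - a|].
  have N : continuous (fun t => `|t - a|).
    move=> s; apply: cvg_norm; apply: cvgB => //; exact: cvg_cst.
  rewrite (_ : [set t | _] = (fun t => `|t - a|) @^-1` [set x | 2 * r < x]) //.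
  by apply: open_comp => [s _|]; [exact: N|exact: open_gt].
apply: (@smooth_upto_derivable _ k [set t | 2 * r < `|t - a|] g (fun=> 0)) => //=.
- lra.
- by move=> s sa; rewrite /g c0 ?mulr0 ?if_same// ltW.
- exact: (smooth_upto_cst k.+1).
Qed.

End Cutoff.

(** * Smooth functions of several variables *)

Section SeveralVariables.
Variables (R : realType) (n : nat).
Implicit Types (F : 'rV[R]_n -> R) (u v a : 'rV[R]_n).

Lemma sum_const_ord (r : R) : \sum_(i < n) r = n%:R * r.
Proof. by rewrite sumr_const card_ord (mulr_natl _ n). Qed.

Definition partial (i : 'I_n) F : 'rV[R]_n -> R :=
  'D_(delta_mx ord0 i : 'rV[R]_n) F.

Lemma Cinf_rV_partial i F : Cinf_rV F -> Cinf_rV (partial i F).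
Proof.
move=> H s; have := H (rcons s i).
by rewrite /iter_partial -cats1 foldr_cat.
Qed.

Lemma Cinf_rV_continuous F : Cinf_rV F -> continuous F.
Proof. by case/(_ [::]). Qed.

Lemma Cinf_rV_coord (j : 'I_n) : Cinf_rV (fun u : 'rV[R]_n => u ord0 j).
Proof.
have D (x v : 'rV[R]_n) : is_derive x v (fun u : 'rV[R]_n => u ord0 j) (v ord0 j).
  have E : (fun h : R => h^-1 *: (((fun u : 'rV[R]_n => u ord0 j) \o shift x) (h *: v)
      - x ord0 j)) @ 0^' --> v ord0 j.
    apply: cvg_near_cst; near=> h; rewrite /= !mxE addrK /GRing.scale /= mulrA.
    by rewrite mulVf ?mul1r//; near: h; exact: nbhs_dnbhs_neq.
  by split; [apply/cvg_ex; exists (v ord0 j)|exact: cvg_lim].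
move=> s; have [[c ->]|->] : (exists c : R, iter_partial (fun u : 'rV[R]_n => u ord0 j) s
    = fun=> c) \/ iter_partial (fun u : 'rV[R]_n => u ord0 j) s = fun u => u ord0 j.
  elim: s => [|i s [[c IH]|IH]] /=; first by right.
    by left; exists 0; rewrite IH; apply/funext => x; exact: derive_cst.
  left; exists ((delta_mx ord0 i : 'rV[R]_n) ord0 j); rewrite IH; apply/funext => x.
  by have [_ ->] := D x (delta_mx ord0 i).
- by split=> [|i x]; [exact: cst_continuous|exact: derivable_cst].
- by split=> [|i x]; [exact: coord_continuous|case: (D x (delta_mx ord0 i))].
Unshelve. all: by end_near. Qed.

Lemma Cinf_rV_slope i F u s : Cinf_rV F ->
  has_slope setT (fun t => F (t *: (delta_mx ord0 i : 'rV[R]_n) + u)) s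
    (partial i F (s *: (delta_mx ord0 i : 'rV[R]_n) + u)).
Proof.
move=> /(_ [::])[_ /(_ i) D]; set e := delta_mx ord0 i : 'rV[R]_n.
set x := s *: e + u; have {}D : is_derive x e F (partial i F x).
  by apply/derivableP/D.
have S0 : has_slope setT (fun t => F (t *: e + x)) 0 (partial i F x).
  apply/has_slope_is_derive; case: D => D1 D2.
  have E : (fun h : R => h^-1 *: (((fun t => F (t *: e + x)) \o shift 0) (h *: (1 : R))
      - F (0 *: e + x))) = (fun h => h^-1 *: ((F \o shift x) (h *: e) - F x)).
    apply/funext => h /=; rewrite addr0 scale0r add0r.
    by rewrite /GRing.scale /= mulr1.
  by split; [rewrite /derivable E|rewrite /derive E].
have := has_slope_shift s S0; rewrite add0r.
apply: (@has_slope_local _ _ _ _ _ _ _ 1) => //.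
  by rewrite subrr scale0r add0r.
by move=> t _ _; split=> //; rewrite /x addrA -scalerDl subrK.
Qed.

Definition between (a b x : R) := (a <= x <= b) || (b <= x <= a).

Lemma mean_value_linear (h d : R -> R) (a b D M : R) :
  (forall t, between a b t -> has_slope setT h t (d t)) ->
  (forall t, between a b t -> `|d t - D| <= M) ->
  `|h b - h a - D * (b - a)| <= M * `|b - a|.
Proof.
move=> H dM.
have G (x y : R) : x <= y ->
    (forall t, x <= t <= y -> has_slope setT h t (d t)) ->
    (forall t, x <= t <= y -> `|d t - D| <= M) ->
    `|(h y - D * y) - (h x - D * x)| <= M * (y - x).
  move=> xy Hxy dxy.
  apply: (mean_value_bound (h := fun t => h t - D * t) (d := fun t => d t - D)) => // t txy.
  apply: (@has_slope_sub _ setT) => //.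
  apply: has_slopeB; first exact: Hxy.
  by rewrite -[X in has_slope _ _ _ X]mulr1; apply: has_slopeZ; exact: has_slope_id.
have E : h b - h a - D * (b - a) = (h b - D * b) - (h a - D * a) by ring.
rewrite E; have [ab|/ltW ba] := leP a b.
  by rewrite (@ger0_norm _ (b - a)) ?subr_ge0//; apply: G => // t tab;
    [apply: H|apply: dM]; rewrite /between tab.
rewrite distrC [`|b - a|]distrC (@ger0_norm _ (a - b)) ?subr_ge0//; apply: G => // t tab;
  by [apply: H; rewrite /between tab orbT|apply: dM; rewrite /between tab orbT].
Qed.

Lemma slope_lipschitz (h d : R -> R) (T B s t : R) :
  (forall v : R, `|v| < T -> has_slope setT h v (d v)) ->
  (forall v : R, `|d v| <= B) -> `|s| < T -> `|t| < T -> `|h t - h s| <= B * `|t - s|.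
Proof.
move=> H dB sT tT; have := @mean_value_linear h d s t 0 B.
rewrite mul0r subr0; apply => v vst; last by rewrite subr0.
apply: H; move: sT tT vst; rewrite !ltr_norml => /andP[a1 a2] /andP[a3 a4].
by move=> /orP[] /andP[a5 a6]; apply/andP; split; lra.
Qed.

(** Moving from [a] to [u] one coordinate at a time only uses partial
    derivatives at points of the box spanned by [a] and [u]. *)
Lemma telescope_bound F (D : 'I_n -> R) (M : R) a u : Cinf_rV F ->
  (forall x : 'rV[R]_n, (forall i, between (a ord0 i) (u ord0 i) (x ord0 i)) ->
     forall k, `|partial k F x - D k| <= M) ->
  `|F u - F a - \sum_k D k * (u ord0 k - a ord0 k)|
    <= M * \sum_k `|u ord0 k - a ord0 k|.
Proof.
move=> SF HM.
pose p m : 'rV[R]_n := \row_i (if (i < m)%N then u ord0 i else a ord0 i).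
have P m : (m <= n)%N -> `|F (p m) - F a - \sum_(k < n | (k < m)%N) D k * (u ord0 k - a ord0 k)|
    <= M * \sum_(k < n | (k < m)%N) `|u ord0 k - a ord0 k|.
  elim: m => [|m IH] mn.
    have -> : p 0 = a by apply/rowP => i; rewrite mxE.
    by rewrite !big_pred0// subrr subr0 normr0 mulr0.
  pose k := Ordinal mn; have {}IH := IH (ltnW mn).
  have S (g : 'I_n -> R) : \sum_(i < n | (i < m.+1)%N) g i = g k + \sum_(i < n | (i < m)%N) g i.
    rewrite (bigD1 k)//=; congr (_ + _); apply: eq_bigl => i.
    by rewrite ltnS ltn_neqAle andbC -val_eqE.
  rewrite !S [X in _ <= X]mulrDr.
  set e := delta_mx ord0 k : 'rV[R]_n.
  have pE : p m.+1 = (u ord0 k - a ord0 k) *: e + p m.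
    apply/rowP => i; rewrite !mxE eqxx /= ltnS leq_eqVlt -(val_eqE i k) /=.
    have [im|im] := eqVneq (val i) m.
      have -> : i = k by exact: val_inj.
      by rewrite /= ?eqxx ltnn mulr1 subrK.
    by rewrite mulr0 add0r.
  have pE0 : p m = 0 *: e + p m by rewrite scale0r add0r.
  have L : `|F (p m.+1) - F (p m) - D k * (u ord0 k - a ord0 k)|
      <= M * `|u ord0 k - a ord0 k|.
    rewrite pE {2}pE0 -{2 3}[u ord0 k - a ord0 k]subr0.
    apply: (mean_value_linear (h := fun t => F (t *: e + p m))
      (d := fun t => partial k F (t *: e + p m))) => t tb.
      exact: Cinf_rV_slope.
    apply: HM => i; rewrite !mxE eqxx /=.
    have [->|ik] := eqVneq i k.
      rewrite ltnn mulr1; move: tb; rewrite /between => /orP[]/andP[h1 h2].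
        by apply/orP; left; apply/andP; split; lra.
      by apply/orP; right; apply/andP; split; lra.
    rewrite mulr0 add0r /between; case: ifP => _.
      by rewrite lexx andbT andTb le_total.
    by rewrite lexx andbT andTb le_total.
  rewrite (_ : _ - _ - _ = (F (p m.+1) - F (p m) - D k * (u ord0 k - a ord0 k))
    + (F (p m) - F a - \sum_(i < n | (i < m)%N) D i * (u ord0 i - a ord0 i))); last by ring.
  by apply: (le_trans (ler_normD _ _)); exact: lerD.
have := P n (leqnn n).
rewrite (_ : p n = u); last by apply/rowP => i; rewrite mxE ltn_ord.
suff E (g : 'I_n -> R) : \sum_(k < n | (k < n)%N) g k = \sum_k g k by rewrite !E.
by apply: eq_bigl => i; rewrite ltn_ord.
Qed.

Definition box a (r : R) : set 'rV[R]_n := [set u | forall i, `|u ord0 i - a ord0 i| < r].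

Lemma nbhs_box a (A : set 'rV[R]_n) : nbhs a A -> exists2 r, 0 < r & box a r `<=` A.
Proof.
move=> /nbhs_ballP[r /= r0 rA]; exists r => // u ur; apply: rA.
by split=> // i j; rewrite ord1 /ball /= distrC; exact: ur.
Qed.

Lemma box_between a r u v (x : 'rV[R]_n) : box a r u -> box a r v ->
  (forall i, between (u ord0 i) (v ord0 i) (x ord0 i)) -> box a r x.
Proof.
move=> ur vr uvx i; move: (ur i) (vr i); rewrite !ltr_norml => /andP[? ?] /andP[? ?].
by move: (uvx i) => /orP[] /andP[? ?]; apply/andP; split; lra.
Qed.

Definition sum_abs (w : 'I_n -> R) := \sum_i `|w i|.
Definition sum_sq (w : 'I_n -> R) := \sum_i w i ^+ 2.

Lemma sum_abs_ge0 w : 0 <= sum_abs w. Proof. exact: sumr_ge0. Qed.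

Lemma sum_sq_ge0 w : 0 <= sum_sq w.
Proof. by apply: sumr_ge0 => i _; exact: sqr_ge0. Qed.

(** Cauchy-Schwarz against a constant vector.  Lipschitz bounds come out in the sum of
    absolute values, but only the sum of squares is smooth and can be differentiated
    along curves; this compares the two. *)
Lemma sum_abs_sq w : sum_abs w ^+ 2 <= n%:R * sum_sq w.
Proof.
rewrite expr2 /sum_abs mulr_suml.
have -> : n%:R * sum_sq w = \sum_(i < n) \sum_(j < n) (w i ^+ 2 + w j ^+ 2) / 2.
  rewrite (eq_bigr (fun i => n%:R * (w i ^+ 2 / 2) + sum_sq w / 2)); last first.
    move=> i _; under eq_bigr do rewrite mulrDl.
    by rewrite big_split /= sumr_const card_ord mulr_natl -mulr_suml.
  rewrite big_split /= -mulr_sumr -mulr_suml sumr_const card_ord -mulr_natl.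
  by rewrite /sum_sq; field.
apply: ler_sum => i _; rewrite mulr_sumr; apply: ler_sum => j _.
rewrite -(real_normK (num_real (w i))) -(real_normK (num_real (w j))).
have := sqr_ge0 (`|w i| - `|w j|); rewrite !expr2; lra.
Qed.

Lemma sum_sq_coord w i : w i ^+ 2 <= sum_sq w.
Proof.
rewrite /sum_sq (bigD1 i)//= lerDl; apply: sumr_ge0 => j _; exact: sqr_ge0.
Qed.

Lemma Cinf_rV_lipschitz F a : Cinf_rV F ->
  exists r L, [/\ 0 < r, 0 <= L & forall u v, box a r u -> box a r v ->
    `|F u - F v| <= L * sum_abs (fun i => u ord0 i - v ord0 i)].
Proof.
move=> SF; pose L := \sum_k (`|partial k F a| + 1).
have : \forall x \near a, forall k, `|partial k F x| <= L.
  apply: (@filter_forall _ _ (fun k x => `|partial k F x| <= L : Prop) _ (nbhs_filter a)) => k.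
  have C := Cinf_rV_continuous (Cinf_rV_partial k SF).
  have /cvgrPdist_lt/(_ 1 ltr01) := C a.
  apply: filterS => x xa; apply: (@le_trans _ _ (`|partial k F a| + 1)).
    rewrite (_ : partial k F x = partial k F a - (partial k F a - partial k F x));
      last by ring.
    by apply: (le_trans (ler_normB _ _)); rewrite lerD2l ltW.
  by rewrite /L (bigD1 k)//= lerDl; apply: sumr_ge0 => i _; rewrite addr_ge0.
move=> /nbhs_box[r r0 rL]; exists r, L; split=> //.
  by apply: sumr_ge0 => i _; rewrite addr_ge0.
move=> u v ur vr.
have := @telescope_bound F (fun=> 0) L v u SF.
rewrite big1 ?subr0; last by move=> i _; rewrite mul0r.
apply=> x xuv k; rewrite subr0; apply: rL.
by apply: box_between xuv.
Qed.

Lemma Cinf_rV_lipschitz_family k (F : 'I_k -> 'rV[R]_n -> R) a :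
  (forall i, Cinf_rV (F i)) ->
  exists r L, [/\ 0 < r, 0 <= L & forall i u v, box a r u -> box a r v ->
    `|F i u - F i v| <= L * sum_abs (fun j => u ord0 j - v ord0 j)].
Proof.
move=> SF.
have /choice[rL HrL] : forall i, exists rL : R * R, [/\ 0 < rL.1, 0 <= rL.2 &
    forall u v, box a rL.1 u -> box a rL.1 v ->
    `|F i u - F i v| <= rL.2 * sum_abs (fun j => u ord0 j - v ord0 j)].
  by move=> i; have [r [L H]] := Cinf_rV_lipschitz a (SF i); exists (r, L).
exists (\big[Num.min/1]_i (rL i).1), (\sum_i (rL i).2); split.
- by elim/big_ind: _ => // [u v u0 v0|i _]; [rewrite lt_min u0|case: (HrL i)].
- by apply: sumr_ge0 => i _; case: (HrL i).
move=> i u v ur vr; have [_ _ HLi] := HrL i.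
have B w : box a (\big[Num.min/1]_i (rL i).1) w -> box a (rL i).1 w.
  by move=> wr j; apply: lt_le_trans (wr j) _; exact: bigmin_le_cond.
apply: (le_trans (HLi u v (B _ ur) (B _ vr))).
apply: ler_wpM2r; first exact: sum_abs_ge0.
by rewrite (bigD1 i)//= lerDl; apply: sumr_ge0 => j _; case: (HrL j).
Qed.

(** The partial derivatives are Lipschitz near [a], so they differ from their values
    at [a] by a first order term on the box spanned by [a] and [u]. *)
Lemma Cinf_rV_taylor F a : Cinf_rV F ->
  exists r C, [/\ 0 < r, 0 <= C & forall u, box a r u ->
    `|F u - F a - \sum_k partial k F a * (u ord0 k - a ord0 k)|
      <= C * sum_sq (fun i => u ord0 i - a ord0 i)].
Proof.
move=> SF; have [r [L [r0 L0 HL]]] :=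
  Cinf_rV_lipschitz_family a (fun k => Cinf_rV_partial k SF).
exists r, (L * n%:R); split=> //; first by rewrite mulr_ge0.
move=> u ur; have aa : box a r a by move=> i; rewrite subrr normr0.
set w := fun i => u ord0 i - a ord0 i.
apply: (@le_trans _ _ (L * sum_abs w * sum_abs w)).
  apply: telescope_bound => // x xau k.
  apply: (le_trans (HL k _ _ (box_between aa ur xau) aa)); rewrite ler_wpM2l//.
  apply: ler_sum => i _; rewrite /w; move: (xau i) => /orP[] /andP[h1 h2].
    by rewrite !ger0_norm ?subr_ge0// ?lerD2r// (le_trans h1).
  by rewrite !ler0_norm ?subr_le0// ?lerN2 ?lerD2r// (le_trans h1).
by rewrite -mulrA -expr2 -mulrA ler_wpM2l// sum_abs_sq.
Qed.

End SeveralVariables.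

(** * Smooth functions on a differential space *)

Section DiffSpace.
Variables (R : realType) (S : diffSpaceType R).
Implicit Types (f g : C^oo(S)) (x y : S).

Definition to_smooth (h : S -> R) (Sh : Cinf S h) : C^oo(S) :=
  SmoothFun (mem_set Sh).

Lemma smooth_funP f : Cinf S f.
Proof. by have := smooth_valP f; rewrite inE. Qed.

Lemma smoothDE f g x : (f + g) x = f x + g x. Proof. by []. Qed.
Lemma smoothNE f x : (- f) x = - f x. Proof. by []. Qed.
Lemma smoothBE f g x : (f - g) x = f x - g x. Proof. by []. Qed.
Lemma smoothME f g x : (f * g) x = f x * g x. Proof. by []. Qed.
Lemma smoothZE (a : R) f x : (a *: f) x = a * f x. Proof. by []. Qed.
Lemma smooth1E x : (1 : C^oo(S)) x = 1. Proof. by []. Qed.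
Lemma smooth0E x : (0 : C^oo(S)) x = 0. Proof. by []. Qed.
Lemma smooth_sumE n (F : 'I_n -> C^oo(S)) x : (\sum_i F i) x = \sum_i F i x.
Proof.
elim: n F => [|n IH] F; first by rewrite !big_ord0.
by rewrite !big_ord_recr smoothDE IH.
Qed.

Definition smoothE := (smoothDE, smoothNE, smoothBE, smoothME, smoothZE, smooth1E,
  smooth0E, smooth_sumE).

Let openS := @Cinf_topology R S.

Lemma smooth_continuous f : continuous f.
Proof.
move=> x; have fS := smooth_funP f.
pose i : {h : S -> R | Cinf S h} := exist _ (f : S -> R) fS.
pose T := sup_topology (fun f : {f : S -> R | Cinf S f} =>
           Topological.class (initial_topology (sval f))).
have xT : nbhs x --> (x : T).
  move=> A; rewrite /= (@nbhsE T) => -[B [oB Bx] BA].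
  by rewrite nbhs_filterE (@nbhsE S); exists B => //; split=> //; rewrite openS.
have xi := (cvg_sup _ _ (nbhs_filter x)).1 xT i.
by move=> A /(@initial_continuous _ _ (f : S -> R)) /xi.
Qed.

Lemma smooth_near n (f : 'I_n -> C^oo(S)) y r : 0 < r ->
  \forall z \near y, forall i, `|f i z - f i y| < r.
Proof.
move=> r0.
apply: (@filter_forall _ _ (fun i z => `|f i z - f i y| < r : Prop) _ (nbhs_filter y)) => i.
have /cvgrPdist_lt/(_ r r0) := @smooth_continuous (f i) y.
by apply: filterS => z; rewrite distrC.
Qed.

(** The topology is the initial one for the smooth functions, so finitely many of
    them detect a neighbourhood; the sum of their squares does it alone. *)
Lemma separating_function x (N : set S) : nbhs x N ->
  exists th : C^oo(S), [/\ th x = 0, forall y, 0 <= th y & forall y, th y < 1 -> N y].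
Proof.
pose G : set_system S := [set N | exists th : C^oo(S),
  [/\ th x = 0, forall y, 0 <= th y & forall y, th y < 1 -> N y]].
have FG : Filter G.
  split.
  - by exists 0; split.
  - move=> A B [u [u0 up uA]] [v [v0 vp vB]]; exists (u + v); split=> [|y|y].
    + by rewrite smoothE u0 v0 addr0.
    + by rewrite smoothE addr_ge0.
    + by rewrite smoothE => uv; split; [apply: uA|apply: vB];
        apply: le_lt_trans uv; rewrite ?lerDl ?lerDr.
  - by move=> A B AB [u [u0 up uA]]; exists u; split=> // y /uA /AB.
pose T := sup_topology (fun f : {f : S -> R | Cinf S f} =>
           Topological.class (initial_topology (sval f))).
have cvgG : G --> (x : T).
  apply/cvg_sup => -[f Sf] A /=.
  rewrite (@nbhsE (initial_topology f)) => -[B [[Q oQ QB] Bx] BA]; subst B.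
  have : nbhs (f x) Q by apply: open_nbhs_nbhs; split.
  move=> /nbhs_ballP[r /= r0 rQ].
  pose v : C^oo(S) := r^-1 *: (to_smooth Sf - f x *: (1 : C^oo(S))); exists (v * v).
  have vE y : v y = r^-1 * (f y - f x) by rewrite /v !smoothE mulr1.
  split=> [|y|y]; rewrite smoothE !vE.
  - by rewrite subrr !mulr0.
  - by rewrite -expr2 sqr_ge0.
  rewrite -expr2 -real_normK ?num_real// expr_lt1// normrM normfV (gtr0_norm r0).
  rewrite ltr_pdivrMl// mulr1 => yr; apply: BA; apply: rQ.
  by rewrite /ball /= distrC.
rewrite (@nbhsE S) => -[B [oB Bx] BN].
suff [u [u0 up uB]] : G B by exists u; split=> // y /uB/BN.
apply: cvgG; rewrite (@nbhsE T); exists B => //; split=> //.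
by move: oB; rewrite openS.
Qed.

Lemma smooth_separated x y : hausdorff_space S -> x <> y ->
  exists f : C^oo(S), f x <> f y.
Proof.
rewrite open_hausdorff => hS /eqP xy.
have [[A B] /= [Ax By] [oA oB AB]] := hS x y xy.
have [th [t0 _ tA]] := @separating_function x A
  (open_nbhs_nbhs (conj oA (set_mem Ax))).
exists th; rewrite t0 => t0y; have Ay : A y by apply: tA; rewrite -t0y.
have : (A `&` B) y by split=> //; exact: set_mem.
by rewrite (eqP AB).
Qed.

Lemma Cinf_sub_setT (h : S -> R) : sub_Cinf (Cinf S) setT h <-> Cinf S h.
Proof.
split=> [H|H y _]; last by exists setT, h; split=> //; split=> //; exact: openT.
apply: Cinf_local => y; have [U [g [Uy Sg UE]]] := H y Logic.I.
by exists U, g; split=> // z Uz; exact: UE.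
Qed.

Definition locally_smooth (I : set R) (h : R -> R) := forall t, I t ->
  exists2 g, Cinf_R g & exists2 r, 0 < r &
    forall s, I s -> `|s - t| < r -> h s = g s.

Lemma sub_Cinf_R (I : set R) (h : R -> R) :
  sub_Cinf (@Cinf_R R) I h <-> locally_smooth I h.
Proof.
split=> H t It.
  have [U [g [[oU Ut] Sg E]]] := H t It; exists g => //.
  have /nbhs_ballP[r /= r0 rU] : nbhs t U by exact: open_nbhs_nbhs.
  exists r => // s Is st; apply: E => //; apply: rU.
  by rewrite /ball /= distrC.
have [g Sg [r r0 E]] := H t It; exists (ball t r), g; split=> //.
  by split; [exact: ball_open|exact: ballxx].
by move=> s; rewrite /ball /= distrC => st Is; exact: E.
Qed.

(** The embedding of a chart is given near each of its points by global smooth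
    functions, and these determine every smooth function locally. *)
Definition chart n (f : 'I_n -> C^oo(S)) (U : set S) :=
  [/\ open U, forall y z, U y -> U z -> (forall i, f i y = f i z) -> y = z &
    forall (g : C^oo(S)) y, U y -> exists2 G, @Cinf_rV R n G &
      \forall z \near y, g z = G (\row_i f i z)].

(** The coordinates of an embedding are smooth on an open subset only; by definition
    of the subspace structure they agree near [x] with global smooth functions. *)
Lemma subcartesian_chart : subcartesian S -> forall x,
  exists n (f : 'I_n -> C^oo(S)) U, U x /\ chart f U.
Proof.
move=> [_ _ _ charts] x.
have [U [n [Y [[oU Ux] [phi [psi [[phiY Sphi] [psiU Spsi] psiK phiK]]]]]]] := charts x.
have ext (i : 'I_n) : exists V (f : C^oo(S)), open_nbhs x V /\
    forall z, V z -> U z -> phi z ord0 i = f z.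
  have SY : sub_Cinf (@Cinf_rV R n) Y (fun u : 'rV[R]_n => u ord0 i).
    move=> y _; exists setT, (fun u : 'rV[R]_n => u ord0 i); split=> //.
      by split=> //; exact: openT.
    exact: Cinf_rV_coord.
  have [V [f [Vx Sf E]]] := Sphi _ SY x Ux.
  by exists V, (to_smooth Sf).
have [V /choice[f Vf]] := choice ext.
pose W := U `&` \bigcap_(i in [set: 'I_n]) V i.
have oW : open W.
  apply: openI => //; rewrite openE => z Vz.
  have : \forall w \near z, forall i, V i w.
    apply: (@filter_forall _ _ V _ (nbhs_filter z)) => i.
    by have [[oV _] _] := Vf i; apply: open_nbhs_nbhs; split=> //; exact: Vz.
  by apply: filterS => w Vw i _; exact: Vw.
have phiE z : W z -> phi z = \row_i f i z.
  move=> [Uz Vz]; apply/rowP => i; rewrite mxE.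
  by have [_ ->//] := Vf i; exact: Vz.
exists n, f, W; split; first by split=> // i _; have [[]] := Vf i.
split=> // [y z Wy Wz fyz|g y Wy].
  rewrite -(psiK y Wy.1) -(psiK z Wz.1) !phiE//; congr psi.
  by apply/rowP => i; rewrite !mxE.
have Sg : sub_Cinf (Cinf S) U g.
  move=> z _; exists setT, (g : S -> R); split=> //; last exact: smooth_funP.
  by split=> //; exact: openT.
have [Q [G [[oQ Qy] SG E]]] := Spsi _ Sg (phi y) (phiY _ Wy.1).
exists G => //.
have C : continuous (fun z => \row_i f i z : 'rV[R]_n).
  move=> z; apply/cvgrPdist_lt => e e0.
  apply: filterS (smooth_near f z e0) => w Hw; rewrite [X in X < _]mx_normrE.
  apply/bigmax_ltP; split=> // -[i j] _ /=; rewrite !mxE distrC; exact: Hw.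
have QN : nbhs y (fun z => Q (\row_i f i z)).
  by apply: C; apply: open_nbhs_nbhs; split=> //; rewrite -phiE.
have WN : nbhs y W by exact: open_nbhs_nbhs.
apply: filterS2 QN WN => z Qz Wz.
have Ez := phiE z Wz.
have := E (phi z); rewrite Ez => /(_ Qz); rewrite -Ez => /(_ (phiY _ Wz.1)).
by rewrite /= psiK//; exact: Wz.1.
Qed.

End DiffSpace.

(** * Uniqueness of integral curves *)

Lemma gronwall_slope (R : realType) (a b C : R) (D dD : R -> R) : 0 <= C ->
  (forall t, a <= t <= b -> has_slope [set s | a <= s <= b] D t (dD t)) ->
  (forall t, a <= t <= b -> dD t <= C * D t) ->
  forall m, 0 < m -> D a <= m ->
  forall t, a <= t <= b -> D t <= m * expR ((C + 1) * (t - a)).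
Proof.
move=> C0 H dDC; apply: gronwall_dini => // t /andP[a_t tb] e e0.
  have tab : a <= t <= b by rewrite a_t ltW.
  have [r r0 Hr] := H t tab e e0; exists r => // s /andP[ts sr] sb.
  have sab : a <= s <= b by rewrite sb (le_trans a_t) // ltW.
  have st0 : 0 < s - t by rewrite subr_gt0.
  have := Hr s sab; rewrite (gtr0_norm st0) ltrBlDl => /(_ sr).
  move=> /(le_trans (ler_norm _)).
  have := dDC t tab; rewrite -(ler_pM2r st0); lra.
have tab : a <= t <= b by rewrite tb ltW.
have [r r0 Hr] := has_slope_cont (H t tab) e0; exists r => // s /andP[as_ st] sr.
have sab : a <= s <= b by rewrite as_ (le_trans (ltW st)).
have := Hr s sab; rewrite distrC (@gtr0_norm _ (t - s)) ?subr_gt0//.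
by rewrite ltr_norml ltrBlDl -ltrBlDr => /(_ sr) /andP[+ _]; lra.
Qed.

Section Curves.
Variables (R : realType) (S : diffSpaceType R).
Implicit Types (X : C^oo(S) -> C^oo(S)) (I : set R) (c d : R -> S).

Definition along X I c := forall (f : C^oo(S)) t, I t ->
  has_slope I (fun s => f (c s)) t (X f (c t)).

Lemma along_sub X I J c : J `<=` I -> along X I c -> along X J c.
Proof. by move=> JI H f t Jt; apply: (has_slope_sub JI); apply: H; exact: JI. Qed.

Lemma along_continuous X I c t (N : set S) : along X I c -> I t -> nbhs (c t) N ->
  exists2 r, 0 < r & forall s, I s -> `|s - t| < r -> N (c s).
Proof.
move=> H It /separating_function[th [th0 _ thN]].
have [r r0 Hr] := has_slope_cont (H th t It) ltr01; exists r => // s Is st.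
apply: thN; have := Hr s Is st; rewrite th0 subr0.
by apply: le_lt_trans; exact: ler_norm.
Qed.

Lemma along_opp X I c : along X I c ->
  along (fun f => - X f) [set t | I (- t)] (fun t => c (- t)).
Proof.
move=> H f t /= It; rewrite -[X in has_slope _ _ X _]opprK.
exact: (has_slope_opp (H f _ It)).
Qed.

Lemma along_shift X I c a : along X I c ->
  along X [set t | I (t - a)] (fun t => c (t - a)).
Proof.
move=> H f t /= It; rewrite -[X in has_slope _ _ X _](subrK a).
exact: (has_slope_shift a (H f _ It)).
Qed.

(** In a chart the smooth functions are smooth functions of the coordinates, and
    those are locally Lipschitz. *)
Lemma chart_lipschitz n (f : 'I_n -> C^oo(S)) U (k : nat) (g : 'I_k -> C^oo(S)) y :
  chart f U -> U y ->
  exists L N, [/\ 0 <= L, nbhs y N & forall z w, N z -> N w -> forall i,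
     `|g i z - g i w| <= L * sum_abs (fun j => f j z - f j w)].
Proof.
move=> [oU _ chU] Uy.
have /choice[G HG] : forall i, exists G, @Cinf_rV R n G /\
    \forall z \near y, g i z = G (\row_j f j z).
  by move=> i; have [G SG E] := chU (g i) y Uy; exists G.
have [r [L [r0 L0 HL]]] := Cinf_rV_lipschitz_family (\row_j f j y) (fun i => (HG i).1).
have E : \forall z \near y, forall i, g i z = G i (\row_j f j z).
  by apply: (@filter_forall _ _ (fun i z => g i z = G i (\row_j f j z)) _ (nbhs_filter y))
    => i; case: (HG i).
exists L, [set z | (forall i, g i z = G i (\row_j f j z)) /\
                   forall j, `|f j z - f j y| < r].
split=> //; first by apply: filterS2 E (smooth_near f y r0).
move=> z w [Ez zr] [Ew wr] i; rewrite Ez Ew.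
have := HL i (\row_j f j z) (\row_j f j w).
rewrite (_ : sum_abs _ = sum_abs (fun j => f j z - f j w)).
  by apply=> j; rewrite !mxE.
by congr sum_abs; apply/funext => j; rewrite !mxE.
Qed.

(** Where the functions [X (f i)] are Lipschitz in the coordinates [f], integral
    curves solve a Lipschitz differential equation, and Gronwall's inequality for the
    squared distance of their coordinates applies. *)
Lemma gronwall_along X n (f : 'I_n -> C^oo(S)) L a b c d : 0 <= L ->
  along X [set t | a <= t <= b] c -> along X [set t | a <= t <= b] d ->
  (forall t, a <= t <= b -> forall i, `|X (f i) (c t) - X (f i) (d t)|
     <= L * sum_abs (fun j => f j (c t) - f j (d t))) ->
  forall m, 0 < m -> sum_sq (fun j => f j (c a) - f j (d a)) <= m ->
  forall t, a <= t <= b -> sum_sq (fun j => f j (c t) - f j (d t))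
     <= m * expR ((2 * L * n%:R + 1) * (t - a)).
Proof.
move=> L0 Hc Hd HL m m0 Da.
pose w t j := f j (c t) - f j (d t).
pose dD t := \sum_j (w t j * (X (f j) (c t) - X (f j) (d t))
                     + (X (f j) (c t) - X (f j) (d t)) * w t j).
apply: (@gronwall_slope R a b _ (fun t => sum_sq (w t)) dD) => //.
- by rewrite !mulr_ge0.
- move=> t tab; apply: (has_slope_sum (h := fun j s => w s j ^+ 2)) => j.
  by apply: has_slopeM; apply: has_slopeB; [exact: Hc|exact: Hd|exact: Hc|exact: Hd].
move=> t tab.
apply: (@le_trans _ _ (2 * L * sum_abs (w t) ^+ 2)); last first.
  by rewrite -[X in _ <= X]mulrA ler_wpM2l ?mulr_ge0// sum_abs_sq.
rewrite expr2 mulrA mulr_sumr; apply: ler_sum => j _.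
have H := HL t tab j; rewrite -/(sum_abs _) in H.
set e := X (f j) (c t) - _ in H *.
have : w t j * e <= `|w t j| * (L * sum_abs (w t)).
  by apply: (le_trans (ler_norm _)); rewrite normrM ler_wpM2l.
rewrite [e * _]mulrC; move: `|w t j| => v; lra.
Qed.

Section Unique.
Hypothesis hS : subcartesian S.

Let along_unique_right X a b c d :
  along X [set t | a <= t <= b] c -> along X [set t | a <= t <= b] d ->
  c a = d a -> forall t, a <= t <= b -> c t = d t.
Proof.
move=> Hc Hd cda; apply: real_induction => // s.
- move=> /andP[as_ sb] cds.
  have sab : a <= s <= b by rewrite as_ ltW.
  have {cds}cds : c s = d s by apply: cds; rewrite as_ lexx.
  have [n [f [U [Uy ch]]]] := subcartesian_chart hS (c s).
  have [L [N [L0 Ny HL]]] := chart_lipschitz (fun i => X (f i)) ch Uy.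
  have [oU inj _] := ch.
  have Uy' : nbhs (c s) U by exact: open_nbhs_nbhs.
  have [r1 r10 H1] := along_continuous Hc sab (filterI Uy' Ny).
  have Ny2 : nbhs (d s) (U `&` N) by rewrite -cds; exact: filterI.
  have [r2 r20 H2] := along_continuous Hd sab Ny2.
  exists (Num.min r1 r2); first by rewrite lt_min r10.
  move=> t /andP[st tr] tb.
  have sub : [set u | s <= u <= t] `<=` [set u | a <= u <= b].
    by move=> u /= /andP[su ut]; rewrite (le_trans as_ su) (le_trans ut tb).
  have near u : s <= u <= t -> (U `&` N) (c u) /\ (U `&` N) (d u).
    move=> sut; have uab := sub u sut; have /andP[su ut] := sut.
    have ur : `|u - s| < Num.min r1 r2.
      by rewrite ger0_norm ?subr_ge0// ltrBlDl (le_lt_trans ut).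
    move: ur; rewrite lt_min => /andP[u1 u2].
    by split; [exact: H1|exact: H2].
  have stt : s <= t <= t by rewrite lexx ltW.
  have [[Uc _] [Ud _]] := near t stt.
  apply: inj => // i; apply/eqP; rewrite -subr_eq0 -sqrf_eq0 -[_ == 0]andbT.
  have := sqr_ge0 (f i (c t) - f i (d t)) => w0; rewrite andbT eq_le w0 andbT.
  apply: (le_trans (sum_sq_coord (fun i => f i (c t) - f i (d t)) i)).
  apply/ler_addgt0Pr => e e0; rewrite add0r.
  set E := expR ((2 * L * n%:R + 1) * (t - s)).
  have E0 : 0 < E by exact: expR_gt0.
  have := @gronwall_along X n f L s t c d L0 (along_sub sub Hc) (along_sub sub Hd).
  move=> /(_ _ (e / E) (divr_gt0 e0 E0) _ t stt); rewrite -/E divfK ?gt_eqF//.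
  apply.
    move=> u sut i'; have [[_ Nc] [_ Nd]] := near u sut.
    exact: HL.
  rewrite cds /sum_sq big1 ?divr_ge0// ?ltW// => j _.
  by rewrite subrr expr0n.
- move=> /andP[as_ sb] cds; apply: contrapT => ne.
  have [_ _ hauss _] := hS.
  have [f fne] := smooth_separated hauss ne; apply: fne.
  have sab : a <= s <= b by rewrite ltW.
  apply/eqP; rewrite -subr_eq0 -normr_le0; apply/ler_addgt0Pr => e e0.
  have S1 := has_slopeB (Hc f s sab) (Hd f s sab).
  have [r r0 Hr] := has_slope_cont S1 e0.
  have [t [a_t ts tr]] := near_left as_ r0.
  have := Hr t; rewrite /= a_t (le_trans (ltW ts) sb) => /(_ isT tr).
  by rewrite cds ?a_t// subrr sub0r normrN add0r => /ltW.
Qed.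

(** Forward in time, Gronwall's inequality in a chart at the last common point shows
    that the curves cannot part; backward in time, reflect and replace [X] by [- X]. *)
Lemma along_unique X I c d t0 : is_interval I -> along X I c -> along X I d ->
  I t0 -> c t0 = d t0 -> forall t, I t -> c t = d t.
Proof.
move=> iI Hc Hd It0 cd0 t It; have [t0t|tt0] := leP t0 t.
  have sub : [set u | t0 <= u <= t] `<=` I by move=> u /= ut; exact: iI ut.
  apply: (@along_unique_right X t0 t) => //; try exact: (along_sub sub).
  by rewrite t0t lexx.
have sub : [set u | - t0 <= u <= - t] `<=` [set u | I (- u)].
  by move=> u /= /andP[h1 h2]; apply: (iI t t0) => //; rewrite lerNr h2 lerNl h1.
have := @along_unique_right _ (- t0) (- t) _ _ (along_sub sub (along_opp Hc))
  (along_sub sub (along_opp Hd)).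
rewrite /= !opprK => /(_ cd0 (- t)); rewrite !opprK; apply.
by rewrite lexx andbT lerN2 ltW.
Qed.

End Unique.
End Curves.

(** * Maximal integral curves *)

Section MaximalCurves.
Variables (R : realType) (S : diffSpaceType R).
Implicit Types (X : C^oo(S) -> C^oo(S)) (I : set R) (c d : R -> S) (x : S).

(** Integral curves freed from the initial point and from the shape of the domain, so
    that they can be shifted and glued. *)
Definition flows X I c :=
  (forall f : C^oo(S), locally_smooth I (fun t => f (c t))) /\ along X I c.

Lemma integral_curveP X x I c :
  integral_curve X x I c <-> [/\ is_interval I, I 0, c 0 = x & flows X I c].
Proof.
have A : (forall (f : C^oo(S)) (t : R), I t ->
    (fun s => (f (c s) - f (c t)) / (s - t)) @ within I t^' --> X f (c t)) <->
    along X I c.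
  by split=> H f t It; apply/(has_slope_cvg I (fun s => f (c s))); exact: H.
split=> [[cI I0 [_ Sc] c0 /A H]|[iI I0 c0 [Sc /A H]]].
  split=> //; first exact/connected_intervalP.
  split=> // f; apply/sub_Cinf_R; apply: (Sc f).
  exact/Cinf_sub_setT/smooth_funP.
split=> //; first exact/connected_intervalP.
split=> // g /Cinf_sub_setT Sg; apply/sub_Cinf_R.
exact: (Sc (to_smooth Sg)).
Qed.

Lemma flows_local X I c :
  (forall t, I t -> exists J d, flows X J d /\ exists2 r, 0 < r &
     forall s, I s -> `|s - t| < r -> J s /\ c s = d s) ->
  flows X I c.
Proof.
move=> H; split=> [f t It|f t It]; have [J [d [[Sd Hd] [r r0 Jr]]]] := H t It;
  have [|Jt ct] := Jr t It; rewrite ?subrr ?normr0//.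
  have [g Sg [q q0 E]] := Sd f t Jt; exists g => //.
  exists (Num.min r q); first by rewrite lt_min r0.
  by move=> s Is; rewrite lt_min => /andP[/(Jr s Is)[Js ->] sq]; exact: E.
rewrite ct; apply: (@has_slope_local _ I J _ (fun s => f (d s)) _ _ r) => //.
- by rewrite ct.
- by move=> s Is /(Jr s Is)[Js ->].
- exact: Hd.
Qed.

Lemma flows_shift X I c a : flows X I c ->
  flows X [set t | I (t - a)] (fun t => c (t - a)).
Proof.
move=> [Sc Hc]; split; last exact: along_shift.
move=> f t /= It; have [g Sg [r r0 E]] := Sc f _ It.
exists (fun s => g (1 * s + - a)); first exact: Cinf_R_affine.
exists r => // s Is st; rewrite mul1r; apply: E => //.
by rewrite (_ : s - a - (t - a) = s - t)//; ring.
Qed.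

Lemma integral_curve_point X x : integral_curve X x [set 0] (fun=> x).
Proof.
apply/integral_curveP; split=> //.
  by move=> s t /= -> -> u /andP[u0 u1]; apply/eqP; rewrite eq_le u0 u1.
split=> [f t _|f t /= ->].
  exists (fun=> f x); last by exists 1.
  by apply/Cinf_R_smooth_upto => k; exact: smooth_upto_cst.
move=> e e0; exists 1 => // s /= -> _.
by rewrite !subrr mulr0 subrr normr0 mulr0.
Qed.

Hypothesis hS : subcartesian S.

Lemma integral_curve_unique X x I c J d : integral_curve X x I c ->
  integral_curve X x J d -> forall t, I t -> J t -> c t = d t.
Proof.
move=> /integral_curveP[iI I0 c0 [_ Hc]] /integral_curveP[iJ J0 d0 [_ Hd]] t It Jt.
apply: (@along_unique _ _ hS X (I `&` J) c d 0) => //.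
- move=> s u [Is Js] [Iu Ju] v suv; split; [exact: iI suv|exact: iJ suv].
- exact: along_sub Hc.
- exact: along_sub Hd.
- by rewrite c0 d0.
Qed.

(** Directedness makes the union agree near each of its points with a single member of
    the family, so smoothness is inherited; for two curves that only share the end
    point [0] of their domains, smoothness of the union at [0] would be in doubt. *)
Lemma integral_curve_union X x (U : set R) : U 0 ->
  (forall s t, U s -> U t -> exists B e,
     [/\ integral_curve X x B e, B `<=` U, B s & B t]) ->
  exists c, integral_curve X x U c.
Proof.
move=> U0 dir.
have /choice[c Hc] : forall t, exists v : S, U t -> exists B e,
    [/\ integral_curve X x B e, B t & v = e t].
  move=> t; have [Ut|nUt] := pselect (U t); last by exists x.
  have [B [e [He BU Bt _]]] := dir t t Ut Ut.
  by exists (e t) => _; exists B, e.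
have cE B e t : integral_curve X x B e -> U t -> B t -> c t = e t.
  move=> He Ut Bt; have [B' [e' [He' B't ->]]] := Hc t Ut.
  exact: (integral_curve_unique He' He).
exists c; apply/integral_curveP; split=> //.
- move=> s t Us Ut u sut; have [B [e [He BU Bs Bt]]] := dir s t Us Ut.
  by apply: BU; move/integral_curveP: He => [iB _ _ _]; exact: iB sut.
- have [B [e [He BU B0 _]]] := dir 0 0 U0 U0.
  by rewrite (cE B e)//; move/integral_curveP: He => [].
apply: flows_local => t Ut.
(* Times [a <= t <= b] of [U] such that no point of [U] near [t] lies outside [a, b]. *)
have [b [tb Ub qb]] : exists b, [/\ t <= b, U b &
    exists2 q, 0 < q & forall s, U s -> t <= s -> s < t + q -> s <= b].
  have [[b Ub tb]|nb] := pselect (exists2 b, U b & t < b).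
    exists b; split=> //; first exact: ltW.
    exists (b - t); first by rewrite subr_gt0.
    by move=> s _ _; rewrite addrC subrK => /ltW.
  exists t; split=> //; exists 1 => // s Us ts _.
  by rewrite leNgt; apply/negP => st; apply: nb; exists s.
have [a [at_ Ua qa]] : exists a, [/\ a <= t, U a &
    exists2 q, 0 < q & forall s, U s -> s <= t -> t - q < s -> a <= s].
  have [[a Ua at_]|na] := pselect (exists2 a, U a & a < t).
    exists a; split=> //; first exact: ltW.
    exists (t - a); first by rewrite subr_gt0.
    by move=> s _ _; rewrite opprB addrC subrK => /ltW.
  exists t; split=> //; exists 1 => // s Us ts _.
  by rewrite leNgt; apply/negP => st; apply: na; exists s.
have [B [e [He BU Ba Bb]]] := dir a b Ua Ub.
exists B, e; split; first by move/integral_curveP: He => [].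
have [q q0 Hq] := qb; have [p p0 Hp] := qa.
exists (Num.min p q); first by rewrite lt_min p0.
move=> s Us; rewrite lt_min => /andP[].
rewrite !ltr_norml => /andP[s1 s2] /andP[s3 s4].
have Bs : B s.
  move/integral_curveP: He => [iB _ _ _]; apply: (iB a b) => //.
  have [ts|st] := leP t s.
    by rewrite (le_trans at_ ts)/= Hq//; lra.
  by rewrite (le_trans (ltW st) tb) andbT Hp//; lra.
by split=> //; exact: (cE B e s He Us Bs).
Qed.

(** Zorn's lemma, applied to the sets of times that can be added to [J]: adding [J]
    to every member makes the union of the empty chain admissible. *)
Lemma maximal_extension X x J d : integral_curve X x J d ->
  exists I c, maximal_integral_curve X x I c /\ J `<=` I.
Proof.
move=> Hd; pose P A := exists c, integral_curve X x (J `|` A) c.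
have J0 : J 0 by move/integral_curveP: Hd => [].
have [F FP tot|A [[c Hc] maxA]] := @Zorn_bigcup _ P; last first.
  exists (J `|` A), c; split; last by move=> t; left.
  split=> // B e He JAB; apply/seteqP; split=> // t Bt.
  apply: contrapT => nt; apply: (maxA B).
    split=> [s As|/(_ t Bt) At]; first by apply: JAB; right.
    by apply: nt; right.
  exists e; rewrite (_ : _ `|` _ = B)//; apply/seteqP; split=> [s [Js|//]|s]; last by right.
  by apply: JAB; left.
rewrite /P; set V := J `|` _; have [s t Vs Vt|c Hc] := @integral_curve_union X x V (or_introl J0);
  last by exists c.
have mem A : F A -> exists e, [/\ integral_curve X x (J `|` A) e & J `|` A `<=` V].
  move=> FA; have [e He] := FP A FA; exists e; split=> // u [Ju|Au]; first by left.
  by right; exists A.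
have JV : J `<=` V by move=> u; left.
case: Vs Vt => [Js|[A FA As]] [Jt|[B FB Bt]].
- by exists J, d.
- by have [e [He HV]] := mem B FB; exists (J `|` B), e; split=> //; [left|right].
- by have [e [He HV]] := mem A FA; exists (J `|` A), e; split=> //; [right|left].
have [AB|BA] := tot A B FA FB.
  have [e [He HV]] := mem B FB; exists (J `|` B), e; split=> //; last by right.
  by right; exact: AB.
have [e [He HV]] := mem A FA; exists (J `|` A), e; split=> //; first by right.
by right; exact: BA.
Qed.

Lemma flow_domainP X t x :
  flow_domain X (t, x) <-> exists I c, integral_curve X x I c /\ I t.
Proof.
split=> [[I [c [[Hc _] It]]]|[J [d [Hd Jt]]]]; first by exists I, c.
have [I [c [Mc JI]]] := maximal_extension Hd.
by exists I, c; split=> //; exact: JI.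
Qed.

End MaximalCurves.

(** * Ordinary differential equations with Lipschitz right-hand side *)

Section Picard.
Variable R : realType.
Local Notation mu := (@lebesgue_measure R).

Lemma geometric_limit (x : nat -> R) (M : R) :
  (forall k, `|x k.+1 - x k| <= M * 2^-1 ^+ k) ->
  exists l, forall k, `|l - x k| <= 2 * M * 2^-1 ^+ k.
Proof.
move=> H; pose b k := 2 * M * 2^-1 ^+ k.
have bS k : b k = b k.+1 + M * 2^-1 ^+ k by rewrite /b exprS; field.
have b0 k : 0 <= b k.
  by rewrite /b -mulrA mulr_ge0// (le_trans _ (H k)).
have yS k : x k - b k <= x k.+1 - b k.+1.
  by have := H k; rewrite ler_norml (bS k) => /andP[+ _]; lra.
have zS k : x k.+1 + b k.+1 <= x k + b k.
  by have := H k; rewrite ler_norml (bS k) => /andP[_ +]; lra.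
have ym : {homo (fun k => x k - b k) : i j / (i <= j)%N >-> i <= j}.
  by apply: homo_leq => //; exact: le_trans.
have zm : {homo (fun k => x k + b k) : i j / (i <= j)%N >-> j <= i}.
  by apply: homo_leq => // y1 y2 y3 h1 h2; exact: le_trans h1.
have yz i j : x i - b i <= x j + b j.
  have := ym i (maxn i j) (leq_maxl _ _); have := zm j (maxn i j) (leq_maxr _ _).
  have := b0 (maxn i j); lra.
pose E := range (fun k => x k - b k).
have supE : has_sup E.
  by split; [exists (x 0 - b 0); exists 0|exists (x 0 + b 0) => _ [k _ <-]].
exists (sup E) => k; rewrite ler_norml.
have h1 : x k - b k <= sup E by apply: ub_le_sup; [case: supE|exists k].
have h2 : sup E <= x k + b k by apply: ge_sup; [case: supE|move=> _ [j _ <-]].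
by move: h1 h2; rewrite /b => h1 h2; apply/andP; split; lra.
Qed.

(** Clipping the argument of the integral to [-T, T] gives a function that is
    continuous on the whole line, so that the construction can be iterated. *)
Lemma antiderivative (T : R) (h : R -> R) : 0 < T -> continuous h ->
  exists P : R -> R, [/\ continuous P, P 0 = 0 &
    forall t, `|t| < T -> has_slope setT P t (h t)].
Proof.
move=> T0 ch; pose a := - (2 * T); pose b := 2 * T.
pose F x := (\int[mu]_(t in [set` `[a, x]]) (h t))%R.
have dF t : - (2 * T) < t < 2 * T -> has_slope setT F t (h t).
  move=> /andP[at_ tb]; apply/has_slope_is_derive.
  have int : mu.-integrable `[a, b] (EFin \o h).
    apply: continuous_compact_integrable; first exact: segment_compact.
    exact: continuous_subspaceT.
  have [d1 d2] := continuous_FTC1_closed tb int at_ (ch t).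
  by split; [exact: d1|rewrite -derive1E d2].
pose clip (t : R) := Num.max (- T) (Num.min t T).
have cclip : continuous clip.
  move=> t; apply: (@continuous_max _ _ (fun=> - T) (fun t => Num.min t T)).
    exact: cst_continuous.
  apply: (@continuous_min _ _ (fun t => t) (fun=> T)) => //.
  exact: cst_continuous.
have clipT t : - (2 * T) < clip t < 2 * T.
  rewrite /clip lt_max gt_max gt_min.
  by apply/andP; split; [|apply/andP; split]; lra.
exists (fun t => F (clip t) - F 0); split.
- move=> t; apply: cvgB; last exact: cvg_cst.
  apply: (continuous_comp (cclip t)).
  have /has_slope_is_derive[D _] := dF _ (clipT t).
  exact/differentiable_continuous/derivable1_diffP.
- by rewrite /clip min_l ?max_r ?subrr// ltW// oppr_lt0.
move=> t tT; pose r := T - `|t|.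
have r0 : 0 < r by rewrite subr_gt0.
have clipE s : `|s| < T -> clip s = s.
  by rewrite ltr_norml => /andP[s1 s2]; rewrite /clip min_l ?max_r// ltW.
apply: (@has_slope_local _ _ setT _ (fun s => F s - F 0) _ _ r) => //.
- by rewrite clipE.
- by move=> s _ st; rewrite clipE//; exact: norm_lt_near st.
rewrite -[h t]subr0; apply: has_slopeB; last exact: has_slope_cst.
by apply: dF; move: tT; rewrite ltr_norml => /andP[t1 t2]; apply/andP; split; lra.
Qed.

(** The Picard iterates start from the constant [a], and their distance halves at each
    step because [T * L * n <= 1/2].  The limit is shown to solve the equation by
    bounding the increments of the iterates, with the mean value inequality. *)
Theorem picard n (H : ('I_n -> R) -> 'I_n -> R) (L T : R) (a : 'I_n -> R) :
  0 <= L -> 0 < T -> T * (L * n%:R) <= 2^-1 ->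
  (forall u v i, `|H u i - H v i| <= L * sum_abs (fun j => u j - v j)) ->
  exists u : R -> 'I_n -> R, u 0 = a /\ forall t, `|t| < T -> forall i,
    has_slope setT (fun s => u s i) t (H (u t) i).
Proof.
move=> L0 T0 TL HL.
have sum_le (w : 'I_n -> R) m : (forall j, `|w j| <= m) -> sum_abs w <= n%:R * m.
  move=> wm; rewrite -sum_const_ord; exact: ler_sum.
have contH (u : 'I_n -> R -> R) i : (forall j, continuous (u j)) ->
    continuous (fun s => H (fun j => u j s) i).
  move=> cu t; apply/cvgrPdist_le => e e0.
  have k0 : 0 < L * n%:R + 1 by rewrite ltr_wpDl// mulr_ge0.
  have : \forall s \near t, forall j, `|u j t - u j s| <= e / (L * n%:R + 1).
    apply: (@filter_forall _ _ (fun j s => `|u j t - u j s| <= e / (L * n%:R + 1) : Prop)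
      _ (nbhs_filter t)) => j.
    by have /cvgrPdist_le := cu j t; apply; rewrite divr_gt0.
  apply: filterS => s us; apply: (le_trans (HL _ _ _)).
  apply: (@le_trans _ _ (L * (n%:R * (e / (L * n%:R + 1))))).
    by rewrite ler_wpM2l// sum_le.
  rewrite !mulrA ler_pdivrMr// mulrC ler_wpM2l ?lerDl//; exact: ltW.
have /choice[anti Hanti] : forall h : R -> R, exists P : R -> R, continuous h ->
    [/\ continuous P, P 0 = 0 & forall t, `|t| < T -> has_slope setT P t (h t)].
  move=> h; have [ch|nch] := pselect (continuous h); last by exists h.
  by have [P HP] := antiderivative T0 ch; exists P.
pose U := fix U k : 'I_n -> R -> R := fun i t => if k is j.+1 then
  a i + anti (fun s => H (fun l => U j l s) i) t else a i.
have cU k i : continuous (U k i).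
  elim: k i => [|k IH] i; first exact: cst_continuous.
  have [cP _ _] := Hanti _ (contH (U k) i IH).
  by move=> t; apply: continuousD; [exact: cst_continuous|exact: cP].
have U0 k i : U k i 0 = a i.
  case: k => //= k; have [_ -> _] := Hanti _ (contH (U k) i (cU k)).
  exact: addr0.
have dU k i t : `|t| < T -> has_slope setT (U k.+1 i) t (H (fun l => U k l t) i).
  move=> tT; have [_ _ /(_ t tT) dP] := Hanti _ (contH (U k) i (cU k)).
  by rewrite -[H _ i]add0r; apply: has_slopeD => //; exact: has_slope_cst.
pose M := T * \sum_i `|H a i|.
have M0 : 0 <= M by apply: mulr_ge0; [exact: ltW|exact: sumr_ge0].
have Mk0 k : 0 <= M * 2^-1 ^+ k by apply: mulr_ge0 => //; rewrite exprn_ge0.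
have betw t s : `|t| < T -> between 0 t s -> `|s| < T.
  rewrite !ltr_norml => /andP[t1 t2] /orP[]/andP[s1 s2]; apply/andP; split; lra.
have HU k i t : `|t| < T -> `|U k.+1 i t - U k i t| <= M * 2^-1 ^+ k.
  elim: k i t => [|k IH] i t tT.
    have := @mean_value_linear _ (U 1 i) (fun s => H (fun l => U 0 l s) i) 0 t 0 (\sum_i `|H a i|).
    rewrite U0 !mul0r subr0 expr0 mulr1 subr0 => P.
    apply: (le_trans (P _ _)) => [s /(betw t s tT)|s _|].
    - exact: dU.
    - rewrite subr0 (_ : (fun l => U 0 l s) = a)//.
      by rewrite (bigD1 i)//= lerDl; apply: sumr_ge0.
    - by rewrite mulrC ler_wpM2r ?(ltW tT)//; apply: sumr_ge0.
  have := @mean_value_linear _ (fun s => U k.+2 i s - U k.+1 i s)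
    (fun s => H (fun l => U k.+1 l s) i - H (fun l => U k l s) i) 0 t 0
    (L * (n%:R * (M * 2^-1 ^+ k))).
  rewrite !U0 subrr !mul0r !subr0 => P.
  apply: (le_trans (P _ _)) => [s st|s st|].
  - by apply: has_slopeB; apply: dU; exact: betw st.
  - rewrite subr0; apply: (le_trans (HL _ _ _)); rewrite ler_wpM2l//.
    by apply: sum_le => j; apply: IH; exact: betw st.
  apply: (@le_trans _ _ (L * (n%:R * (M * 2^-1 ^+ k)) * T)).
    apply: ler_wpM2l; last exact: ltW.
    by apply: mulr_ge0 => //; apply: mulr_ge0.
  rewrite exprS (_ : _ * T = (T * (L * n%:R)) * (M * 2^-1 ^+ k)); last by ring.
  by rewrite [X in _ <= X]mulrCA ler_wpM2r.
have /choice[u Hu] : forall t, exists v : 'I_n -> R, `|t| < T ->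
    forall k i, `|v i - U k i t| <= 2 * M * 2^-1 ^+ k.
  move=> t; have [tT|] := ltP `|t| T; last by exists a.
  have /choice[v Hv] : forall i, exists l, forall k, `|l - U k i t| <= 2 * M * 2^-1 ^+ k.
    by move=> i; apply: geometric_limit => k; exact: HU.
  by exists v.
have small e : 0 < e -> exists k, 2 * M * 2^-1 ^+ k < e.
  move=> e0; have : (fun k => 2 * M * 2^-1 ^+ k) @ \oo --> 2 * M * 0.
    apply: cvgMr; apply: cvg_expr; rewrite ger0_norm ?invr_ge0//.
    by rewrite invf_lt1// ltr1n.
  rewrite mulr0 => /cvgrPdist_lt/(_ e e0)[k _ Hk]; exists k.
  have := Hk k (leqnn k); rewrite /= sub0r normrN; apply: le_lt_trans.
  exact: ler_norm.
have T00 : `|0 : R| < T by rewrite normr0.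
exists u; split.
  apply/funext => i; apply/eqP; rewrite -subr_eq0 -normr_le0.
  apply/ler_addgt0Pr => e /small[k /ltW ke]; rewrite add0r.
  by rewrite -(U0 k i) (le_trans (Hu _ T00 k i)).
have cu t i e : `|t| < T -> 0 < e ->
    exists2 r, 0 < r & forall s, `|s - t| < r -> `|s| < T /\ `|u s i - u t i| <= e.
  move=> tT e0; have e3 : 0 < e / 3 by rewrite divr_gt0.
  have [k /ltW ke] := small _ e3.
  have /cvgrPdist_lt/(_ _ e3)/nbhs_ballP[r /= r0 Hr] := cU k i t.
  exists (Num.min r (T - `|t|)); first by rewrite lt_min r0 subr_gt0.
  move=> s; rewrite lt_min => /andP[sr sT].
  have {}sT := norm_lt_near sT.
  split=> //; have := Hr s; rewrite /ball /= distrC => /(_ sr)/ltW U3.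
  have U1 := le_trans (Hu s sT k i) ke; have U2 := le_trans (Hu t tT k i) ke.
  rewrite (_ : u s i - u t i = (u s i - U k i s) - (U k i t - U k i s) - (u t i - U k i t));
    last by ring.
  apply: (le_trans (ler_normB _ _)); rewrite (_ : e = e / 3 + e / 3 + e / 3); last by field.
  by apply: lerD => //; apply: (le_trans (ler_normB _ _)); exact: lerD.
move=> t tT i e e0.
pose e1 := e / (2 * (L * n%:R + 1)).
have k0 : 0 < 2 * (L * n%:R + 1) by rewrite mulr_gt0// ltr_wpDl// mulr_ge0.
have e10 : 0 < e1 by rewrite divr_gt0.
have /choice[r Hr] : forall j, exists r, 0 < r /\
    forall s, `|s - t| < r -> `|s| < T /\ `|u s j - u t j| <= e1.
  by move=> j; have [r r0 Hr] := cu t j e1 tT e10; exists r.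
pose q := \big[Num.min/(T - `|t|)]_j r j.
have q0 : 0 < q.
  rewrite /q; elim/big_ind: _ => [|x y x0 y0|j _]; first by rewrite subr_gt0.
    by rewrite lt_min x0.
  by case: (Hr j).
exists q => // s _ sq.
have near v : between t s v -> `|v| < T /\ forall j, `|u v j - u t j| <= e1.
  move=> tsv; have vq : `|v - t| < q.
    move: sq; rewrite !ltr_norml => /andP[h1 h2].
    by move: tsv => /orP[]/andP[h3 h4]; apply/andP; split; lra.
  split=> [|j]; last first.
    have [_ /(_ v)[]//] := Hr j.
    by apply: (lt_le_trans vq); exact: bigmin_le_cond.
  by apply: (@norm_lt_near _ v t); apply: (lt_le_trans vq); exact: bigmin_le_id.
have tst : between t s t by rewrite /between lexx andbT andTb; exact: le_total.
have tss : between t s s by rewrite /between lexx andbT andTb; exact: le_total.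
have [sT _] := near s tss.
apply/ler_addgt0Pr => e' e'0.
pose e2 := Num.min e1 (e' / 2).
have [k /ltW ke] : exists k, 2 * M * 2^-1 ^+ k < e2.
  by apply: small; rewrite lt_min e10 divr_gt0.
have ke1 : 2 * M * 2^-1 ^+ k <= e1 by apply: (le_trans ke); rewrite ge_min lexx.
have ke' : 2 * M * 2^-1 ^+ k.+1 <= e' / 2.
  apply: (@le_trans _ _ (2 * M * 2^-1 ^+ k)).
    apply: ler_wpM2l; first exact: mulr_ge0.
    by rewrite exprS ler_piMl// ?exprn_ge0// invf_le1// ler1n.
  by apply: (le_trans ke); rewrite ge_min lexx orbT.
have := @mean_value_linear _ (U k.+1 i) (fun v => H (fun l => U k l v) i) t s (H (u t) i) e.
move=> P; have {}P : `|U k.+1 i s - U k.+1 i t - H (u t) i * (s - t)| <= e * `|s - t|.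
  apply: P => v tsv; have [vT uv] := near v tsv; first exact: dU.
  apply: (le_trans (HL _ _ _)).
  apply: (@le_trans _ _ (L * (n%:R * (e1 + e1)))).
    rewrite ler_wpM2l//; apply: sum_le => j.
    rewrite (_ : _ - _ = (u v j - u t j) - (u v j - U k j v)); last by ring.
    apply: (le_trans (ler_normB _ _)); apply: lerD => //.
    exact: le_trans (Hu _ vT k j) ke1.
  have eE : e = e1 * (2 * (L * n%:R + 1)) by rewrite /e1 divfK// gt_eqF.
  rewrite [X in _ <= X]eE [X in X <= _](_ : _ = e1 * (2 * (L * n%:R))); last by ring.
  by rewrite ler_wpM2l ?(ltW e10)// ler_wpM2l// lerDl.
have U1 := le_trans (Hu s sT k.+1 i) ke'; have U2 := le_trans (Hu t tT k.+1 i) ke'.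
rewrite (_ : u s i - u t i - _ = (U k.+1 i s - U k.+1 i t - H (u t) i * (s - t))
   + ((u s i - U k.+1 i s) - (u t i - U k.+1 i t))); last by ring.
apply: (le_trans (ler_normD _ _)); apply: lerD => //.
by apply: (le_trans (ler_normB _ _)); rewrite [e']splitr lerD.
Qed.

End Picard.

(** * Derivations that vanish at minima *)

Section Derivations.
Variables (R : realType) (S : diffSpaceType R).
Implicit Types (f g : C^oo(S)) (x y : S).

(** For a closed subset [F] of a Euclidean space this is the condition of Bony and
    Brezis: if [k] is a point of [F] nearest to [u], the squared distance to [u]
    has a minimum at [k] on [F], and its derivative along [Z] is twice the inner
    product of [k - u] with [Z]. *)
Definition annihilates_minima (Z : C^oo(S) -> C^oo(S)) :=
  forall (rho : C^oo(S)) k, (\forall y \near k, rho k <= rho y) -> Z rho k = 0.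

Section DerivationTheory.
Variable Z : C^oo(S) -> C^oo(S).
Hypothesis dZ : derivation Z.

Lemma derivationD f g : Z (f + g) = Z f + Z g.
Proof. by have := dZ.1 1 f g; rewrite !scale1r. Qed.

Lemma derivation0 : Z 0 = 0.
Proof. by apply: (addrI (Z 0)); rewrite -derivationD !addr0. Qed.

Lemma derivationZ (a : R) f : Z (a *: f) = a *: Z f.
Proof. by have := dZ.1 a f 0; rewrite addr0 derivation0 addr0. Qed.

Lemma derivationB f g : Z (f - g) = Z f - Z g.
Proof. by rewrite derivationD -[- g]scaleN1r derivationZ scaleN1r. Qed.

Lemma derivationM f g : Z (f * g) = f * Z g + g * Z f.
Proof. exact: dZ.2. Qed.

Lemma derivation1 : Z 1 = 0.
Proof. by apply: (addrI (Z 1)); rewrite addr0 -{3}[1]mulr1 derivationM mul1r. Qed.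

Lemma derivation_sum n (F : 'I_n -> C^oo(S)) : Z (\sum_i F i) = \sum_i Z (F i).
Proof.
elim: n F => [|n IH] F; first by rewrite !big_ord0 derivation0.
by rewrite !big_ord_recr derivationD IH.
Qed.

Definition square_dist n (f : 'I_n -> C^oo(S)) (a : 'I_n -> R) : C^oo(S) :=
  \sum_i (f i - a i *: (1 : C^oo(S))) * (f i - a i *: (1 : C^oo(S))).

Lemma square_distE n (f : 'I_n -> C^oo(S)) a y :
  square_dist f a y = sum_sq (fun i => f i y - a i).
Proof.
rewrite smooth_sumE; apply: eq_bigr => i _; by rewrite !smoothE mulr1 expr2.
Qed.

Lemma derivation_square_dist n (f : 'I_n -> C^oo(S)) a y :
  Z (square_dist f a) y = 2 * \sum_i (f i y - a i) * Z (f i) y.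
Proof.
rewrite derivation_sum smooth_sumE mulr_sumr; apply: eq_bigr => i _.
rewrite derivationM derivationB derivationZ derivation1 scaler0 subr0.
by rewrite !smoothE mulr1; ring.
Qed.

(** The chain rule is read off from a minimum: after adding a large multiple of
    the squared distance, the Taylor remainder of [g] has a local minimum. *)
Lemma annihilates_minima_chain n (f : 'I_n -> C^oo(S)) U g k :
  annihilates_minima Z -> chart f U -> U k ->
  exists A C, [/\ 0 <= C, Z g k = \sum_i A i * Z (f i) k &
    \forall y \near k, `|g y - g k - \sum_i A i * (f i y - f i k)|
       <= C * sum_sq (fun i => f i y - f i k)].
Proof.
move=> MZ [oU _ chU] Uk; have [G SG E] := chU g k Uk.
have [r [C [r0 C0 HG]]] := Cinf_rV_taylor (\row_i f i k) SG.
pose A i := partial i G (\row_i f i k).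
have T : \forall y \near k, `|g y - g k - \sum_i A i * (f i y - f i k)|
       <= C * sum_sq (fun i => f i y - f i k).
  have Ek := nbhs_singleton E.
  apply: filterS2 E (smooth_near f k r0) => y Ey By; rewrite Ey Ek.
  have := HG (\row_i f i y).
  rewrite (_ : sum_sq _ = sum_sq (fun j => f j y - f j k)); last first.
    by congr sum_sq; apply/funext => j; rewrite !mxE.
  rewrite (eq_bigr (fun i => A i * (f i y - f i k))); last by move=> i _; rewrite !mxE.
  by apply=> j; rewrite !mxE.
exists A, C; split=> //.
pose rho := g - \sum_i A i *: f i + C *: square_dist f (fun i => f i k).
have : Z rho k = 0.
  apply: MZ; apply: filterS T => y.
  have rhoE z : rho z = g z - \sum_i A i * f i z + C * sum_sq (fun i => f i z - f i k).
    by rewrite /rho smoothDE smoothBE smoothZE square_distE smooth_sumE.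
  rewrite !rhoE ler_norml => /andP[+ _].
  rewrite (_ : sum_sq (fun i => f i k - f i k) = 0); last first.
    by rewrite /sum_sq big1// => i _; rewrite subrr expr0n.
  under eq_bigr do rewrite mulrBr.
  rewrite sumrB; lra.
rewrite /rho derivationD derivationB derivation_sum derivationZ.
rewrite smoothDE smoothBE smoothZE smooth_sumE derivation_square_dist [X in 2 * X]big1; last first.
  by move=> i _; rewrite subrr mul0r.
rewrite !mulr0 addr0 => /eqP; rewrite subr_eq0 => /eqP ->.
by apply: eq_bigr => i _; rewrite derivationZ smoothE.
Qed.

End DerivationTheory.

(** The derivative of [f] along the curve is [X f] along the curve, which is again
    differentiable, and so on to all orders. *)
Lemma flows_of_along X (I : set R) (c : R -> S) : open I -> along X I c -> flows X I c.
Proof.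
move=> oI Hc; split=> // f t It.
have ball_sub s : I s -> exists2 r, 0 < r & forall u, `|u - s| < r -> I u.
  move=> Is; have /nbhs_ballP[r /= r0 rI] : nbhs s I by exact: open_nbhs_nbhs.
  by exists r => // u us; apply: rI; rewrite /ball /= distrC.
have full (h : C^oo(S)) s : I s -> has_slope setT (fun s => h (c s)) s (X h (c s)).
  move=> Is; have [r r0 rI] := ball_sub s Is.
  apply: (@has_slope_local _ _ I _ (fun s => h (c s)) _ _ r) => //; last exact: Hc.
  by move=> u _ /rI.
have ladder k : forall h : C^oo(S), smooth_upto k I (fun s => h (c s)).
  elim: k => //= k IH h; exists (fun s => X h (c s)); split=> // s; exact: full.
have [r r0 rI] := ball_sub t It.
have r30 : 0 < r / 3 by rewrite divr_gt0.
have ST k : smooth_upto k [set s | `|s - t| < 3 * (r / 3)] (fun s => f (c s)).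
  apply: smooth_upto_sub (ladder k f) => s /=.
  rewrite mulrC divfK ?pnatr_eq0//; exact: rI.
have [g Sg gE] := smooth_extension r30 ST.
by exists g => //; exists (r / 3) => // s _; exact: gE.
Qed.

End Derivations.

(** * Existence of integral curves *)

Section Viability.
Variables (R : realType) (S : diffSpaceType R).

(** The argument of Bony and Brezis.  At a time [t] compare the positions of [u] at
    neighbouring times with the single point of [f K] nearest to [u t]: since [H] is
    orthogonal there to the difference and is Lipschitz, the squared distance from [u]
    to [f K] changes at a rate bounded by a multiple of itself, so it stays zero. *)
Lemma viability n (f : 'I_n -> C^oo(S)) (K : set S) (H : ('I_n -> R) -> 'I_n -> R)
    (L B P T : R) (u : R -> 'I_n -> R) (y : S) :
  compact K -> 0 <= L -> 0 < B -> 0 <= P ->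
  (forall v w i, `|H v i - H w i| <= L * sum_abs (fun j => v j - w j)) ->
  (forall v i, `|H v i| <= B) ->
  (forall t, `|t| < T -> forall i, has_slope setT (fun s => u s i) t (H (u t) i)) ->
  K y -> u 0 = (fun i => f i y) ->
  (forall t k, `|t| < T -> K k ->
     (forall k', K k' -> sum_sq (fun i => u t i - f i k) <= sum_sq (fun i => u t i - f i k')) ->
     (forall i, `|u t i - f i k| <= P) /\
     \sum_i (u t i - f i k) * H (fun i => f i k) i = 0) ->
  forall t, `|t| < T -> exists2 k, K k & forall i, u t i = f i k.
Proof.
move=> cK L0 B0 P0 HL HB du Ky u0 tan.
have cont t : continuous (fun z => sum_sq (fun i => u t i - f i z)).
  move=> z.
  have -> : (fun z => sum_sq (fun i => u t i - f i z)) = smooth_val (square_dist f (u t)).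
    apply/funext => w; rewrite square_distE; apply: eq_bigr => i _.
    by rewrite -sqrrN opprB.
  exact: smooth_continuous.
have /choice[k Hk] : forall t, exists k, K k /\
    forall k', K k' -> sum_sq (fun i => u t i - f i k) <= sum_sq (fun i => u t i - f i k').
  move=> t; have K0 : K !=set0 by exists y.
  have [k kK kmin] := compact_EVT_min K0 cK (continuous_subspaceT (cont t)).
  by exists k; split=> [|k' Kk']; [exact: set_mem|apply: kmin; exact: mem_set].
pose q t := sum_sq (fun i => u t i - f i (k t)).
have lipu s t i : `|s| < T -> `|t| < T -> `|u t i - u s i| <= B * `|t - s|.
  exact: (slope_lipschitz (d := fun v => H (u v) i) (fun v vT => du v vT i)
    (fun v => HB (u v) i)).
pose C := 2 * L * n%:R.
have C0 : 0 <= C by rewrite !mulr_ge0.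
have right t e : `|t| < T -> 0 < e -> exists2 r, 0 < r & forall s, `|s - t| < r ->
    q s <= q t + `|s - t| * (C * q t + e).
  move=> tT e0; have [Kk kmin] := Hk t; have [_ orth] := tan t _ tT Kk kmin.
  pose w s i := u s i - f i (k t).
  pose dQ := \sum_i (w t i * (H (u t) i - 0) + (H (u t) i - 0) * w t i).
  have SQ : has_slope setT (fun s => sum_sq (w s)) t dQ.
    apply: (has_slope_sum (h := fun i s => w s i ^+ 2)) => i.
    have Sw : has_slope setT (fun s => w s i) t (H (u t) i - 0).
      by apply: has_slopeB; [exact: du|exact: has_slope_cst].
    exact: (has_slopeM Sw Sw).
  have dQb : `|dQ| <= C * q t.
    have -> : dQ = \sum_i 2 * (w t i * (H (u t) i - H (fun i => f i (k t)) i)).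
      rewrite -mulr_sumr; under [in RHS]eq_bigr do rewrite mulrBr.
      rewrite sumrB orth subr0 mulr_sumr; apply: eq_bigr => i _; ring.
    apply: (@le_trans _ _ (2 * L * sum_abs (w t) ^+ 2)); last first.
      by rewrite /C -[X in _ <= X]mulrA ler_wpM2l ?mulr_ge0// sum_abs_sq.
    apply: (le_trans (ler_norm_sum _ _ _)).
    rewrite expr2 mulrA mulr_sumr; apply: ler_sum => i _.
    have := HL (u t) (fun i => f i (k t)) i; rewrite -/(sum_abs (w t)) => HLi.
    rewrite !normrM (ger0_norm (_ : 0 <= 2))//.
    have := ler_wpM2l (normr_ge0 (w t i)) HLi; lra.
  have [r r0 Hr] := SQ e e0; exists r => // s st.
  have [_ kmins] := Hk s; apply: (le_trans (kmins _ Kk)).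
  have := Hr s Logic.I st; rewrite ler_norml => /andP[_].
  have : dQ * (s - t) <= C * q t * `|s - t|.
    by apply: (le_trans (ler_norm _)); rewrite normrM ler_wpM2r.
  rewrite -/(sum_sq (w s)) /q -/(sum_sq (w t)); lra.
have left t e : `|t| < T -> 0 < e -> exists2 r, 0 < r & forall s, `|s| < T ->
    `|s - t| < r -> q t <= q s + e.
  move=> tT e0; pose D := n%:R * (2 * P + 1) + 1.
  have D0 : 0 < D by rewrite ltr_wpDl// mulr_ge0// addr_ge0// mulr_ge0.
  pose eta := Num.min 1 (e / D).
  have eta0 : 0 < eta by rewrite lt_min ltr01 divr_gt0.
  exists (eta / B); first by rewrite divr_gt0.
  move=> s sT st; have [Kks kmins] := Hk s; have [_ kmin] := Hk t.
  apply: (le_trans (kmin _ Kks)); have [bnd _] := tan s _ sT Kks kmins.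
  apply: (@le_trans _ _ (q s + \sum_(i < n) eta * (2 * P + 1))); last first.
    rewrite sum_const_ord lerD2l.
    apply: (@le_trans _ _ (e / D * D)); last by rewrite divfK// gt_eqF.
    rewrite mulrCA; apply: ler_pM; rewrite ?(ltW eta0)//.
    - by rewrite mulr_ge0// addr_ge0// mulr_ge0.
    - by rewrite ge_min lexx orbT.
    - by rewrite lerDl.
  rewrite /q /sum_sq -big_split/=; apply: ler_sum => i _.
  have lu : `|u t i - u s i| <= eta.
    apply: (le_trans (lipu s t i sT tT)).
    by rewrite distrC mulrC -ler_pdivlMr// ltW.
  have eta1 : eta <= 1 by rewrite ge_min lexx.
  set w := u s i - f i (k s); set d := u t i - u s i in lu *.
  have -> : (u t i - f i (k s)) ^+ 2 = w ^+ 2 + d * (2 * w + d).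
    by rewrite /w /d; ring.
  rewrite lerD2l; apply: (le_trans (ler_norm _)); rewrite normrM.
  apply: ler_pM => //; apply: (le_trans (ler_normD _ _)).
  apply: lerD; last exact: le_trans eta1.
  by rewrite normrM ger0_norm// ler_wpM2l// bnd.
have q0 : q 0 <= 0.
  have [_ kmin] := Hk 0; apply: (le_trans (kmin y Ky)).
  by rewrite /sum_sq big1// => i _; rewrite u0 subrr expr0n.
have zero t : `|t| < T -> q t <= 0.
  move=> tT.
  have main (sg : R) (D : R -> R) : (sg = 1 \/ sg = -1) -> D = (fun s => q (sg * s)) ->
      D `|t| <= 0.
    move=> sgE DE; apply/ler_addgt0Pr => e e0; rewrite add0r.
    have sgn v : `|sg * v| = `|v|.
      by case: sgE => ->; rewrite ?mul1r// mulN1r normrN.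
    set E := expR ((C + 1) * (`|t| - 0)).
    have E0 : 0 < E by exact: expR_gt0.
    rewrite -[e](@divfK _ E) ?gt_eqF//.
    have inT s : 0 <= s <= `|t| -> `|sg * s| < T.
      by move=> /andP[s0 st]; rewrite sgn ger0_norm// (le_lt_trans st).
    apply: (@gronwall_dini R 0 `|t| C D C0) => //; rewrite ?DE.
    - move=> s /andP[s0 st] e1 e10.
      have sT : `|sg * s| < T by apply: inT; rewrite s0 ltW.
      have [r r0 Hr] := right (sg * s) e1 sT e10; exists r => // v /andP[sv vr] vt.
      have E1 : `|sg * v - sg * s| = v - s by rewrite -mulrBr sgn ger0_norm// subr_ge0 ltW.
      by have := Hr (sg * v); rewrite E1 ltrBlDl; exact.
    - move=> s /andP[s0 st] e1 e10.
      have sT : `|sg * s| < T by apply: inT; rewrite st ltW.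
      have [r r0 Hr] := left (sg * s) e1 sT e10; exists r => // v /andP[v0 vs] vr.
      apply: Hr; first by apply: inT; rewrite v0 ltW// (lt_le_trans vs).
      by rewrite -mulrBr sgn distrC ger0_norm ?subr_ge0 1?ltW// ltrBlDl -ltrBlDr.
    - by rewrite divr_gt0.
    - by rewrite mulr0 (le_trans q0)// divr_ge0// ltW.
    - by rewrite normr_ge0 lexx.
  have [t0|t0] := leP 0 t.
    by have := main 1 _ (or_introl erefl) erefl; rewrite mul1r ger0_norm.
  by have := main (-1) _ (or_intror erefl) erefl; rewrite mulN1r ltr0_norm// opprK.
move=> t tT; exists (k t); first by case: (Hk t).
move=> i; apply/eqP; rewrite -subr_eq0 -sqrf_eq0 eq_le sqr_ge0 andbT.
apply: le_trans (zero t tT); exact: (sum_sq_coord (fun i => u t i - f i (k t)) i).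
Qed.

End Viability.

Section LocalExistence.
Variables (R : realType) (S : diffSpaceType R).

Lemma compact_neighbourhood (x : S) N : locally_compact [set: S] -> nbhs x N ->
  exists K, [/\ compact K, K `<=` N & nbhs x K].
Proof.
move=> lc xN; have [K0 xK0 [cK0 _]] := lc x Logic.I.
have {}xK0 : nbhs x K0 by apply: filterS (xK0 : nbhs x [set y | setT y -> K0 y]) => y; apply.
have [th [th0 _ thN]] := separating_function xN.
have cth := @smooth_continuous _ _ th.
exists (K0 `&` [set y | th y <= 2^-1]); split.
- apply: compact_closedI => //.
  rewrite (_ : [set y | _] = th @^-1` [set z | z <= 2^-1])//.
  by apply: closed_comp => [y _|]; [exact: cth|exact: closed_le].
- by move=> y [_ /= ty]; apply: thN; apply: (le_lt_trans ty); rewrite invf_lt1// ltr1n.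
- apply: filterI => //.
  have h20 : 0 < 2^-1 :> R by rewrite invr_gt0.
  have /cvgrPdist_lt/(_ _ h20) := cth x; rewrite th0; apply: filterS.
  by move=> y; rewrite sub0r normrN => /ltW; exact: le_trans (ler_norm _).
Qed.

(** A continuous injection of a compact set is an embedding: the squared distance to
    [f k] has a positive minimum on the points of [K] outside [N]. *)
Lemma chart_separation n (f : 'I_n -> C^oo(S)) K k N :
  compact K -> (forall z, K z -> (forall i, f i z = f i k) -> z = k) -> nbhs k N ->
  exists2 r, 0 < r & forall z, K z -> sum_sq (fun i => f i z - f i k) < r -> N z.
Proof.
move=> cK inj kN.
have cD : continuous (square_dist f (fun i => f i k)) by exact: smooth_continuous.
have cK' : compact (K `&` ~` N°).
  by apply: compact_closedI => //; apply: open_closedC; exact: open_interior.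
have [K'0|/set0P/negP/negPn/eqP K'0] := pselect (K `&` ~` N° !=set0); last first.
  exists 1 => // z Kz _; apply: interior_subset; apply: contrapT => nNz.
  by have : (K `&` ~` N°) z by []; rewrite K'0.
have [z0 /set_mem[Kz0 nN0] zmin] := compact_EVT_min K'0 cK' (continuous_subspaceT cD).
exists (square_dist f (fun i => f i k) z0).
  rewrite square_distE lt_neqAle sum_sq_ge0 andbT eq_sym; apply/eqP => Z.
  apply: nN0; rewrite (_ : z0 = k) //; apply: inj => // i.
  apply/eqP; rewrite -subr_eq0 -sqrf_eq0 eq_le sqr_ge0 andbT -Z.
  exact: (sum_sq_coord (fun i => f i z0 - f i k)).
move=> z Kz; rewrite -square_distE => zlt; apply: interior_subset; apply: contrapT => nNz.
have := zmin z; rewrite leNgt zlt => H; suff : false by [].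
by apply: H; rewrite inE.
Qed.

Lemma has_slope_quadratic (I : set R) (h : R -> R) t M r : 0 <= M -> 0 < r ->
  (forall s, I s -> `|s - t| < r -> `|h s - h t| <= M * `|s - t| ^+ 2) ->
  has_slope I h t 0.
Proof.
move=> M0 r0 H e e0; have k0 : 0 < M + 1 by rewrite ltr_wpDl.
exists (Num.min r (e / (M + 1))); first by rewrite lt_min r0 divr_gt0.
move=> s Is; rewrite lt_min => /andP[sr]; rewrite ltr_pdivlMr// => se.
rewrite mul0r subr0; apply: (le_trans (H s Is sr)); rewrite expr2 mulrA ler_wpM2r//.
apply: le_trans (ltW se); rewrite mulrC ler_wpM2l// lerDl//.
Qed.

(** In a chart [Z] becomes a differential equation on a Euclidean space, solved by
    [picard].  Its solutions stay in the image of a compact neighbourhood [K] of [x]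
    by [viability]: a point [k] of [K] nearest to [u t] is interior to [K] if [u t] is
    close to [f x], so it is a local minimum on [S] of the squared distance to [u t].
    The solution is then lifted to [S], and the chain rule for [Z] makes the lift an
    integral curve. *)
Theorem local_flow (Z : C^oo(S) -> C^oo(S)) :
  subcartesian S -> locally_compact [set: S] -> derivation Z ->
  annihilates_minima Z -> forall x : S, exists N T, [/\ nbhs x N, 0 < T &
    forall y, N y -> exists2 c, c 0 = y & flows Z [set t | `|t| < T] c].
Proof.
move=> hS hlc dZ MZ x.
have [n [f [U [Ux ch]]]] := subcartesian_chart hS x.
have [oU inj chU] := ch.
have /choice[G HG] : forall i, exists G, @Cinf_rV R n G /\
    \forall z \near x, Z (f i) z = G (\row_j f j z).
  by move=> i; have [G SG E] := chU (Z (f i)) x Ux; exists G.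
have GE : \forall z \near x, forall i, Z (f i) z = G i (\row_j f j z).
  apply: (@filter_forall _ _ (fun i z => Z (f i) z = G i (\row_j f j z)) _ (nbhs_filter x)).
  by move=> i; case: (HG i).
pose a0 : 'rV[R]_n := \row_j f j x.
have [r1 [L [r10 L0 GL]]] := Cinf_rV_lipschitz_family a0 (fun i => (HG i).1).
have [K [cK KU xK]] := compact_neighbourhood hlc (filterI (open_nbhs_nbhs (conj oU Ux)) GE).
have injK k : K k -> forall z, K z -> (forall i, f i z = f i k) -> z = k.
  by move=> Kk z Kz; apply: inj; [exact: (KU z Kz).1|exact: (KU k Kk).1].
have xKi : nbhs x K° by apply: open_nbhs_nbhs; split; [exact: open_interior|].
have [r2 r20 Hr2] := chart_separation cK (injK x (nbhs_singleton xK)) xKi.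
have [r [r0 rr1 Hr]] : exists r, [/\ 0 < r, r < r1 &
    forall z, K z -> (forall i, `|f i z - f i x| <= r) -> K° z].
  have D0 : 0 < n%:R + 1 :> R by rewrite ltr_wpDl.
  pose r := Num.min (r1 / 2) (Num.min 1 (r2 / (n%:R + 1))).
  have r0 : 0 < r by rewrite !lt_min ltr01 !divr_gt0.
  have r_1 : r <= 1 by rewrite !ge_min lexx orbT.
  have r_2 : r <= r2 / (n%:R + 1) by rewrite !ge_min lexx !orbT.
  exists r; split=> //.
    rewrite /r (@le_lt_trans _ _ (r1 / 2))//; first by rewrite ge_min lexx.
    by rewrite ltr_pdivrMr// ltr_pMr// ltr1n.
  move=> z Kz zr; apply: Hr2 => //.
  apply: (@le_lt_trans _ _ (n%:R * r)).
    rewrite -sum_const_ord; apply: ler_sum => i _; rewrite -real_normK ?num_real// expr2.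
    apply: (@le_trans _ _ (r * 1)); last by rewrite mulr1.
    by apply: ler_pM => //; exact: le_trans (zr i) r_1.
  apply: (@le_lt_trans _ _ (n%:R * (r2 / (n%:R + 1)))); first by rewrite ler_wpM2l.
  by rewrite mulrA ltr_pdivrMr// mulrC ltr_pM2l// ltrDl.
(* Cutting the coordinates off at distance [r] makes [G] globally Lipschitz and
   bounded without changing it near [a0]. *)
pose clip i v := Num.max (a0 ord0 i - r) (Num.min (a0 ord0 i + r) v).
have clip_box i v : a0 ord0 i - r <= clip i v <= a0 ord0 i + r.
  rewrite le_max lexx /= /clip ge_max ge_min lexx andbT; lra.
have clip_id i v : `|v - a0 ord0 i| <= r -> clip i v = v.
  by rewrite ler_norml /clip => /andP[v1 v2]; rewrite min_r ?max_r//; lra.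
have clip_lip i v w : `|clip i v - clip i w| <= `|v - w|.
  wlog vw : v w / v <= w => [P|].
    by have [/P//|/ltW/P] := leP v w; rewrite distrC [X in _ <= X]distrC.
  rewrite distrC [X in _ <= X]distrC (ger0_norm (_ : 0 <= w - v)) ?subr_ge0//.
  rewrite /clip ger0_norm; last first.
    rewrite subr_ge0 ge_max le_max lexx /= le_max; apply/orP; right.
    by rewrite le_min !ge_min lexx vw orbT.
  rewrite lerBlDr ge_max; apply/andP; split.
    by apply: ler_wpDl; [rewrite subr_ge0|rewrite le_max lexx].
  have [h|h] := leP (a0 ord0 i + r) v.
    have -> : Num.min (a0 ord0 i + r) w = a0 ord0 i + r by rewrite min_l// (le_trans h).
    by apply: ler_wpDl; [rewrite subr_ge0|rewrite le_max lexx orbT].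
  apply: (@le_trans _ _ w); first by rewrite ge_min lexx orbT.
  by rewrite -lerBlDl opprB addrC subrK le_max lexx orbT.
pose H (v : 'I_n -> R) i := G i (\row_j clip j (v j)).
have clipB (v : 'I_n -> R) : box a0 r1 (\row_j clip j (v j)).
  move=> j; rewrite mxE; apply: (@le_lt_trans _ _ r) => //.
  by rewrite ler_norml; have /andP[] := clip_box j (v j); lra.
have HL v w i : `|H v i - H w i| <= L * sum_abs (fun j => v j - w j).
  apply: (le_trans (GL i _ _ (clipB v) (clipB w))).
  by rewrite ler_wpM2l//; apply: ler_sum => j _; rewrite !mxE.
have aB : box a0 r1 a0 by move=> j; rewrite subrr normr0.
pose B := \sum_i `|G i a0| + L * (n%:R * r) + 1.
have B0 : 0 < B.
  by rewrite /B ltr_wpDl// addr_ge0 ?sumr_ge0// mulr_ge0// mulr_ge0// ltW.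
have HB v i : `|H v i| <= B.
  rewrite (_ : H v i = G i a0 + (H v i - G i a0)); last by ring.
  apply: (le_trans (ler_normD _ _)); rewrite /B -addrA; apply: lerD.
    by rewrite (bigD1 i)//= lerDl sumr_ge0.
  apply: (le_trans (GL i _ _ (clipB v) aB)).
  apply: (@le_trans _ _ (L * (n%:R * r))); last by rewrite lerDl.
  rewrite ler_wpM2l// -sum_const_ord; apply: ler_sum => j _; rewrite mxE ler_norml.
  by have /andP[] := clip_box j (v j); lra.
have D1 : 0 < 2 * (L * n%:R + 1) by rewrite mulr_gt0// ltr_wpDl// mulr_ge0.
have D2 : 0 < 4 * (n%:R + 1) * B by rewrite !mulr_gt0// ltr_wpDl.
(* The first bound on [T] is what [picard] asks for; by the second one, the coordinates
   of [u] and of the points of [f K] nearest to it stay within [r / 4] of the initial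
   ones. *)
pose T := Num.min (1 / (2 * (L * n%:R + 1))) (r / (4 * (n%:R + 1) * B)).
have T0 : 0 < T by rewrite lt_min !divr_gt0.
have TL : T * (L * n%:R) <= 2^-1.
  apply: (@le_trans _ _ (1 / (2 * (L * n%:R + 1)) * (L * n%:R + 1))).
    apply: ler_pM; rewrite ?(ltW T0) ?mulr_ge0//; first by rewrite ge_min lexx.
    by rewrite lerDl.
  have k0 : L * n%:R + 1 != 0 by rewrite gt_eqF// ltr_wpDl// mulr_ge0.
  by rewrite invfM mul1r divfK.
have TB : (n%:R + 1) * (B * T) <= r / 4.
  have TT : T <= r / (4 * (n%:R + 1) * B) by rewrite ge_min lexx orbT.
  move: TT; rewrite ler_pdivlMr//; lra.
pose N := K `&` [set y | forall i, `|f i y - f i x| <= r / 4].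
exists N, T; split=> //.
  apply: filterI => //; have r40 : 0 < r / 4 by rewrite divr_gt0.
  by apply: filterS (smooth_near f x r40) => y yr i; exact: ltW.
move=> y [Ky yr].
have [u [u0 du]] := picard (fun i => f i y) L0 T0 TL HL.
have lipu s t i : `|s| < T -> `|t| < T -> `|u t i - u s i| <= B * `|t - s|.
  exact: (slope_lipschitz (d := fun v => H (u v) i) (fun v vT => du v vT i)
    (fun v => HB (u v) i)).
have T00 : `|0 : R| < T by rewrite normr0.
have uy t i : `|t| < T -> `|u t i - f i y| <= B * T.
  move=> tT; have := lipu 0 t i T00 tT; rewrite u0 subr0 => /le_trans; apply.
  by rewrite ler_wpM2l// ltW.
have BT0 : 0 <= B * T by rewrite mulr_ge0// ltW.
(* The factor [n] pays for passing from the sum of squares to single coordinates. *)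
have nearest t k : `|t| < T -> K k ->
    (forall k', K k' -> sum_sq (fun i => u t i - f i k) <= sum_sq (fun i => u t i - f i k')) ->
    forall i, `|u t i - f i k| <= n%:R * (B * T).
  move=> tT Kk kmin i.
  have n1 : 1 <= n%:R :> R by rewrite ler1n; apply: leq_ltn_trans (ltn_ord i).
  have nBT : 0 <= n%:R * (B * T) by rewrite mulr_ge0.
  rewrite -(ler_pXn2r (_ : (0 < 2)%N)) ?nnegrE// real_normK ?num_real//.
  apply: (le_trans (sum_sq_coord (fun i => u t i - f i k) i)).
  apply: (le_trans (kmin y Ky)).
  apply: (@le_trans _ _ (n%:R * (B * T) ^+ 2)).
    rewrite -sum_const_ord; apply: ler_sum => j _; rewrite -real_normK ?num_real//.
    by rewrite ler_pXn2r ?nnegrE// uy.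
  by rewrite [X in _ <= X]exprMn ler_wpM2r ?sqr_ge0// expr2 ler_peMr.
have TB' : n%:R * (B * T) + B * T <= r / 4 by move: TB; lra.
have nBT0 : 0 <= n%:R * (B * T) by rewrite mulr_ge0.
have centered t k : `|t| < T -> (forall i, `|u t i - f i k| <= n%:R * (B * T)) ->
    forall i, `|f i k - f i x| <= r.
  move=> tT uk i.
  rewrite (_ : f i k - f i x = (f i y - f i x) + (u t i - f i y) - (u t i - f i k)); last by ring.
  apply: (le_trans (ler_normB _ _)).
  have := ler_normD (f i y - f i x) (u t i - f i y).
  have := uk i; have := uy t i tT; have := yr i; lra.
have HZ k : K k -> (forall i, `|f i k - f i x| <= r) ->
    forall i, H (fun j => f j k) i = Z (f i) k.
  move=> Kk kr i; have [_ ->] := KU k Kk; congr (G i _).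
  by apply/rowP => j; rewrite !mxE clip_id// mxE.
have orth t k : `|t| < T -> K k ->
    (forall k', K k' -> sum_sq (fun i => u t i - f i k) <= sum_sq (fun i => u t i - f i k')) ->
    (forall i, `|u t i - f i k| <= n%:R * (B * T)) /\
    \sum_i (u t i - f i k) * H (fun i => f i k) i = 0.
  move=> tT Kk kmin; have uk := nearest t k tT Kk kmin; split=> //.
  have kr := centered t k tT uk.
  have sqE z : square_dist f (u t) z = sum_sq (fun i => u t i - f i z).
    by rewrite square_distE; apply: eq_bigr => i _; rewrite -sqrrN opprB.
  have : Z (square_dist f (u t)) k = 0.
    apply: MZ; apply: filterS (Hr k Kk kr) => z Kz.
    by rewrite !sqE; exact: kmin.
  rewrite derivation_square_dist// => /eqP; rewrite mulf_eq0 pnatr_eq0 /= => /eqP E.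
  apply/eqP; rewrite -oppr_eq0 -sumrN; apply/eqP; rewrite -[RHS]E.
  by apply: eq_bigr => i _; rewrite HZ//; ring.
have /choice[c Hc] : forall t, exists k, `|t| < T -> K k /\ forall i, u t i = f i k.
  move=> t; have [tT|] := ltP `|t| T; last by exists x.
  have [k Kk uk] := viability cK L0 B0 nBT0 HL HB du Ky u0 orth tT.
  by exists k.
exists c.
  have [Kc uc] := Hc 0 T00; apply: injK => // i.
  by rewrite -uc u0.
have oT : open [set t : R | `|t| < T].
  rewrite (_ : [set t | _] = ball 0 T); first exact: ball_open.
  by apply/seteqP; split=> t; rewrite /ball /= sub0r normrN.
apply: flows_of_along => // g t /= tT; have [Kk uk] := Hc t tT; set k := c t in Kk uk *.
have kr : forall i, `|f i k - f i x| <= r.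
  by apply: (centered t) => // i; rewrite uk subrr normr0.
have Uk : U k by exact: (KU k Kk).1.
have [A [C [C0 -> tay]]] := annihilates_minima_chain dZ g MZ ch Uk.
have [rho rho0 Hrho] := chart_separation cK (injK k Kk) tay.
have sq_le s : `|s| < T -> sum_sq (fun i => f i (c s) - f i k) <= n%:R * B ^+ 2 * `|s - t| ^+ 2.
  move=> sT; have [_ us] := Hc s sT.
  rewrite -mulrA -sum_const_ord; apply: ler_sum => i _; rewrite -exprMn -us -uk -real_normK ?num_real//.
  by rewrite ler_pXn2r ?nnegrE ?mulr_ge0 ?(ltW B0)//; exact: lipu.
(* Near [t], [g] along the curve is a linear combination of the coordinates of [u]
   up to a remainder of second order. *)
pose rem s := g (c s) - \sum_i A i * u s i.
have Srem : has_slope [set t | `|t| < T] rem t 0.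
  pose D := n%:R * B ^+ 2 + 1.
  have D0 : 0 < D by rewrite ltr_wpDl// mulr_ge0// sqr_ge0.
  pose q := Num.min 1 (rho / D).
  apply: (@has_slope_quadratic _ _ _ (C * (n%:R * B ^+ 2)) q).
  - by rewrite mulr_ge0// mulr_ge0// sqr_ge0.
  - by rewrite lt_min ltr01 divr_gt0.
  move=> s /= sT; rewrite lt_min => /andP[s1 sq]; have [Ks us] := Hc s sT.
  have lt_rho : sum_sq (fun i => f i (c s) - f i k) < rho.
    apply: (le_lt_trans (sq_le s sT)).
    apply: (@le_lt_trans _ _ (D * `|s - t|)); last by rewrite mulrC -ltr_pdivlMr.
    apply: ler_pM; [by rewrite mulr_ge0// sqr_ge0|exact: sqr_ge0|by rewrite lerDl|].
    by rewrite expr2 ler_piMl// ltW.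
  have := Hrho (c s) Ks lt_rho; rewrite /rem -/k.
  rewrite (_ : g (c s) - _ - (g k - _) = g (c s) - g k - \sum_i A i * (f i (c s) - f i k)).
    by move=> /le_trans; apply; rewrite -mulrA ler_wpM2l// sq_le.
  under [in RHS]eq_bigr do rewrite mulrBr.
  rewrite sumrB.
  under eq_bigr do rewrite us.
  under [X in _ - (g k - X) = _]eq_bigr do rewrite uk.
  ring.
have SA : has_slope [set t | `|t| < T] (fun s => \sum_i A i * u s i) t (\sum_i A i * Z (f i) k).
  apply: (has_slope_sum (h := fun i s => A i * u s i)) => i; apply: has_slopeZ.
  rewrite -HZ// (_ : (fun j => f j k) = u t); last by apply/funext => j; rewrite uk.
  by apply: (@has_slope_sub _ setT) => //; exact: du.
have := has_slopeD Srem SA; rewrite add0r.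
by congr (has_slope _ _ _ _); apply/funext => s; rewrite /rem subrK.
Qed.

End LocalExistence.

(** * Openness of the flow domain *)

Lemma is_interval_norm_lt (R : realType) (T : R) : is_interval [set t : R | `|t| < T].
Proof.
move=> u v; rewrite /= !ltr_norml => /andP[u1 u2] /andP[v1 v2] w /andP[uw wv].
by rewrite /= ltr_norml (lt_le_trans u1)//= (le_lt_trans wv).
Qed.

Section FlowDomain.
Variables (R : realType) (S : diffSpaceType R).
Implicit Types (X Z : C^oo(S) -> C^oo(S)) (I J : set R) (c d : R -> S) (x y : S).

(** Take a function [th] that vanishes at [x] and is at least [1] outside a compact
    neighbourhood [K].  Along a curve inside [K] it grows at a bounded rate, so within
    a uniform time it cannot grow from [1/2] to [1]. *)
Lemma flow_stays X x N : locally_compact [set: S] -> nbhs x N ->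
  exists W T, [/\ nbhs x W, 0 < T, W `<=` N &
    forall I c, is_interval I -> I 0 -> along X I c -> W (c 0) ->
      forall t, I t -> `|t| < T -> N (c t)].
Proof.
move=> hlc xN; have [K [cK KN xK]] := compact_neighbourhood hlc xN.
have [th [th0 _ thK]] := separating_function xK.
have [M [M0 HM]] : exists M : R, 0 <= M /\ forall y, K y -> `|X th y| <= M.
  have cX : continuous (fun y => - `|X th y|).
    by move=> y; apply: cvgN; apply: cvg_norm; exact: smooth_continuous.
  have K0 : K !=set0 by exists x; exact: nbhs_singleton.
  have [z _ zmin] := compact_EVT_min K0 cK (continuous_subspaceT cX).
  exists `|X th z|; split=> // y Ky; rewrite -lerN2; apply: zmin; exact: mem_set.
have k0 : 0 < 2 * (M + 1) by rewrite mulr_gt0// ltr_wpDl.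
have xW : nbhs x [set y | th y < 2^-1].
  have h20 : 0 < 2^-1 :> R by rewrite invr_gt0.
  have /cvgrPdist_lt/(_ _ h20) := @smooth_continuous _ _ th x; rewrite th0; apply: filterS.
  by move=> y; rewrite sub0r normrN; apply: le_lt_trans; exact: ler_norm.
exists [set y | th y < 2^-1], (2 * (M + 1))^-1; split=> //.
- by rewrite invr_gt0.
- by move=> y /= ty; apply: KN; apply: thK; apply: (lt_trans ty); rewrite invf_lt1// ltr1n.
(* As long as [th] stays below [1] the curve is in [K], where [th] grows slowly. *)
have right (Y : C^oo(S) -> C^oo(S)) I c : (forall y, K y -> `|Y th y| <= M) ->
    is_interval I -> I 0 -> along Y I c -> th (c 0) < 2^-1 ->
    forall t, I t -> 0 <= t < (2 * (M + 1))^-1 -> N (c t).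
  move=> HY iI I0 Hc W0 t It /andP[t0 tT].
  have below s : s <= t -> 2^-1 + (M + 1) * s < 1.
    move=> st; have : s < (2 * (M + 1))^-1 by exact: le_lt_trans tT.
    rewrite -[X in _ < X]mul1r ltr_pdivlMr//; lra.
  have sub s : 0 <= s <= t -> I s by move=> st; apply: (iI 0 t).
  suff P : th (c t) <= 2^-1 + (M + 1) * t.
    by apply: KN; apply: thK; apply: (le_lt_trans P); exact: below.
  have tt : 0 <= t <= t by rewrite t0 lexx.
  move: tt; apply: (@real_induction R (fun s => th (c s) <= 2^-1 + (M + 1) * s) 0 t).
  - by rewrite mulr0 addr0 ltW.
  - move=> s /andP[s0 st] Ps; have Is : I s by apply: sub; rewrite s0 ltW.
    have {Ps}Ps : th (c s) <= 2^-1 + (M + 1) * s by apply: Ps; rewrite s0 lexx.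
    have Ks : K (c s) by apply: thK; apply: (le_lt_trans Ps); apply: below; exact: ltW.
    have [r r0 Hr] := Hc th s Is 1 ltr01; exists r => // v /andP[sv vr] vt.
    have Iv : I v by apply: sub; rewrite vt andbT (le_trans s0)// ltW.
    have v0 : 0 < v - s by rewrite subr_gt0.
    have := Hr v Iv; rewrite (gtr0_norm v0) ltrBlDl => /(_ vr); rewrite ler_norml => /andP[_].
    have := HY _ Ks; rewrite ler_norml => /andP[_]; rewrite -(ler_pM2r v0); lra.
  - move=> s /andP[s0 st] Ps; have Is : I s by apply: sub; rewrite ltW.
    apply/ler_addgt0Pr => e e0; have [r r0 Hr] := has_slope_cont (Hc th s Is) e0.
    have [v [v0 vs vr]] := near_left s0 r0.
    have Iv : I v by apply: sub; rewrite v0 (le_trans (ltW vs)).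
    have := Hr v Iv vr; rewrite ltr_norml => /andP[h _].
    have := Ps v; rewrite v0 vs => /(_ isT).
    have : (M + 1) * v <= (M + 1) * s by rewrite ler_wpM2l ?(ltW vs)// addr_ge0.
    move: h; lra.
move=> I c iI I0 Hc W0 t It tT; have [t0|t0] := leP 0 t.
  by apply: (right X I) => //; rewrite t0 -[t]ger0_norm.
rewrite -[t]opprK.
apply: (right (fun f => - X f) [set s | I (- s)] (fun s => c (- s))) => //=.
- by move=> y Ky; rewrite -[X in `|X|]/(- X th y) normrN; exact: HM.
- move=> u v Iu Iv w /andP[uw wv]; apply: (iI _ _ Iv Iu).
  by rewrite !lerN2 uw wv.
- by rewrite oppr0.
- exact: along_opp.
- by rewrite oppr0.
- by rewrite opprK.
- by rewrite oppr_ge0 ltW//= -ltr0_norm.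
Qed.

Section Openness.
Hypothesis hS : subcartesian S.
Hypothesis hlc : locally_compact [set: S].

(** Continuous dependence on the initial point, by Gronwall's inequality in a chart at
    [x].  The curves start near [x] and are short, so [flow_stays] keeps both of them in
    the chart. *)
Lemma flow_continuous X x : exists W T, [/\ nbhs x W, 0 < T &
  forall y, W y -> forall I c, is_interval I -> I 0 -> along X I c -> c 0 = y ->
  forall s, I s -> `|s| < T -> forall V, nbhs (c s) V ->
  exists2 A, nbhs y A & forall z, A z -> forall J d, is_interval J -> J 0 -> J s ->
    along X J d -> d 0 = z -> V (d s)].
Proof.
have [n [f [U [Ux ch]]]] := subcartesian_chart hS x.
have [oU inj _] := ch.
have [L [NL [L0 xNL HL]]] := chart_lipschitz (fun i => X (f i)) ch Ux.
have [K [cK KU xK]] := compact_neighbourhood hlc (filterI (open_nbhs_nbhs (conj oU Ux)) xNL).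
have [W [T [xW T0 WK stay]]] := flow_stays X hlc xK.
exists W°, T; split=> //; first by apply: open_nbhs_nbhs; split; [exact: open_interior|].
move=> y Wy I c iI I0 Hc c0 s Is sT V sV.
have Wy' := interior_subset Wy.
have Ws : K (c s) by apply: (stay I) => //; rewrite c0.
have [r r0 Hr] := chart_separation cK (fun z Kz => inj z (c s) (KU z Kz).1 (KU _ Ws).1) sV.
pose E := expR ((2 * L * n%:R + 1) * `|s|).
have E0 : 0 < E by exact: expR_gt0.
have m0 : 0 < r / 2 / E by rewrite !divr_gt0.
exists (W `&` [set z | sum_sq (fun i => f i z - f i y) < r / 2 / E]).
  apply: filterI => //.
  have := @smooth_continuous _ _ (square_dist f (fun i => f i y)) y.
  move=> /cvgrPdist_lt/(_ _ m0); apply: filterS => z.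
  rewrite !square_distE (_ : sum_sq (fun i => f i y - f i y) = 0); last first.
    by rewrite /sum_sq big1// => i _; rewrite subrr expr0n.
  by rewrite sub0r normrN; apply: le_lt_trans; exact: ler_norm.
move=> z [Wz zm] J d iJ J0 Js Hd d0.
have Kd v : J v -> `|v| < T -> K (d v) by move=> Jv vT; apply: (stay J) => //; rewrite d0.
have Kc v : I v -> `|v| < T -> K (c v) by move=> Iv vT; apply: (stay I) => //; rewrite c0.
apply: Hr; first exact: Kd.
apply: (@le_lt_trans _ _ (r / 2)); last by rewrite ltr_pdivrMr// ltr_pMr// ltr1n.
rewrite -[X in _ <= X](@divfK _ E) ?gt_eqF//.
have [s0|s0] := leP 0 s.
  have sub A : is_interval A -> A 0 -> A s -> [set u | 0 <= u <= s] `<=` A.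
    by move=> iA A0 As u us; exact: (iA 0 s).
  have := @gronwall_along _ _ X n f L 0 s d c L0 (along_sub (sub _ iJ J0 Js) Hd) (along_sub (sub _ iI I0 Is) Hc).
  rewrite d0 c0 => P.
  have := P _ _ m0 (ltW zm) s; rewrite /E ger0_norm// subr0; apply; last by rewrite s0 lexx.
  move=> u us i; have uT : `|u| < T.
    by move: us => /andP[u0 us]; rewrite ger0_norm// (le_lt_trans us)// -[s]ger0_norm.
  apply: HL; first exact: (KU _ (Kd u (sub _ iJ J0 Js u us) uT)).2.
  exact: (KU _ (Kc u (sub _ iI I0 Is u us) uT)).2.
have sub A : is_interval A -> A 0 -> A s -> [set u | 0 <= u <= - s] `<=` [set u | A (- u)].
  move=> iA A0 As u /= /andP[u0 us]; apply: (iA s 0) => //.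
  by rewrite lerNr us oppr_le0.
have := @gronwall_along _ _ (fun f => - X f) n f L 0 (- s) (fun u => d (- u)) (fun u => c (- u))
  L0 (along_sub (sub _ iJ J0 Js) (along_opp Hd)) (along_sub (sub _ iI I0 Is) (along_opp Hc)).
rewrite /= !oppr0 d0 c0 => P.
have := P _ _ m0 (ltW zm) (- s); rewrite /E ltr0_norm// addr0 opprK; apply; last first.
  by rewrite oppr_ge0 ltW//=.
move=> u us i; have uT : `|- u| < T.
  move: us => /andP[u0 us]; rewrite normrN ger0_norm// (le_lt_trans us)//.
  by rewrite -ltr0_norm.
rewrite -[X in `|X|]/(- X (f i) (d (- u)) - - X (f i) (c (- u))) -opprD normrN; apply: HL.
  exact: (KU _ (Kd (- u) (sub _ iJ J0 Js u us) uT)).2.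
exact: (KU _ (Kc (- u) (sub _ iI I0 Is u us) uT)).2.
Qed.

(** The domain of [e] is a neighbourhood of the time [s] at which the two curves are
    joined, so the concatenation is smooth there. *)
Lemma flow_domain_concat X T e s t : `|s| < T -> flows X [set t | `|t| < T] e ->
  flow_domain X (t, e s) -> flow_domain X (t + s, e 0).
Proof.
move=> sT He /(flow_domainP hS)[J [d [Hd Jt]]]; apply/(flow_domainP hS).
have /integral_curveP[iJ J0 d0 Fd] := Hd.
pose A : set R := [set t | `|t| < T]; pose B := [set t | J (t - s)].
have iA : is_interval A by exact: is_interval_norm_lt.
have iB : is_interval B.
  move=> u v /= Bu Bv w /andP[uw wv]; apply: (iJ _ _ Bu Bv).
  by rewrite !lerD2r uw.
have As : A s by [].
have Bs : B s by rewrite /B /= subrr.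
have FB := flows_shift s Fd.
pose c r := if `|r| < T then e r else d (r - s).
have agree r : A r -> B r -> e r = d (r - s).
  move=> Ar Br; apply: (@along_unique _ _ hS X (A `&` B) e (fun r => d (r - s)) s) => //.
  - by move=> u v [Au Bu] [Av Bv] w uwv; split; [exact: (iA u v)|exact: (iB u v)].
  - by apply: along_sub He.2 => u [].
  - by apply: along_sub FB.2 => u [].
  - by rewrite subrr d0.
have cB r : B r -> c r = d (r - s).
  by move=> Br; rewrite /c; case: ifP => // rT; exact: agree.
have T0 : 0 < T by exact: le_lt_trans sT.
exists (A `|` B), c; split; last by right; rewrite /B /= addrK.
apply/integral_curveP; split.
- move=> u v Au Av w uwv.
  have join (P Q : set R) a b : is_interval P -> is_interval Q -> P s -> Q s -> P a -> Q b ->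
      a <= w <= b -> (P `|` Q) w.
    move=> iP iQ Ps Qs Pa Qb /andP[aw wb]; have [ws|sw] := leP w s.
      by left; apply: (iP a s) => //; rewrite aw.
    by right; apply: (iQ s b) => //; rewrite wb ltW.
  case: Au Av => [Au|Bu] [Av|Bv].
  + by left; exact: (iA u v).
  + exact: (join A B u v).
  + by rewrite setUC; exact: (join B A u v).
  + by right; exact: (iB u v).
- by left; rewrite /A /= normr0.
- by rewrite /c normr0 T0.
apply: flows_local => r Ur; have [rT|rT] := ltP `|r| T.
  exists A, e; split=> //; exists (T - `|r|); first by rewrite subr_gt0.
  move=> v _ vr; have vT := norm_lt_near vr.
  by split=> //; rewrite /c vT.
have Br : B r by case: Ur => //; rewrite /A /= ltNge rT.
exists B, (fun r => d (r - s)); split=> //; exists `|s - r|.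
  rewrite normr_gt0 subr_eq0; apply/eqP => sr.
  by move: sT; rewrite sr ltNge rT.
(* The points of [A] near [r] lie between [s] and [r]. *)
move=> v Uv vr; have Bv : B v.
  case: Uv => // Av; move: vr sT rT Av; rewrite /A /= => vr sT rT vT.
  have [sr|rs] := leP s r.
    have := @ger0_norm _ (r - s); rewrite subr_ge0 distrC => /(_ sr) E.
    apply: (iB s r) => //; apply/andP; split.
      by move: vr; rewrite E ltr_norml => /andP[h _]; lra.
    rewrite leNgt; apply/negP => rv; have : `|r| < T; last by rewrite ltNge rT.
    move: sT vT; rewrite !ltr_norml => /andP[h1 h2] /andP[h3 h4].
    by apply/andP; split; lra.
  have E : `|s - r| = s - r by rewrite gtr0_norm// subr_gt0.
  apply: (iB r s) => //; apply/andP; split; last first.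
    by move: vr; rewrite E ltr_norml => /andP[_ h]; lra.
  rewrite leNgt; apply/negP => rv; have : `|r| < T; last by rewrite ltNge rT.
  move: sT vT; rewrite !ltr_norml => /andP[h1 h2] /andP[h3 h4].
  by apply/andP; split; lra.
by split=> //; exact: cB.
Qed.

(** Follow an integral curve back from a time [t0] to time [0].  Curves from points near
    its end last for a uniform time by assumption.  By continuous dependence, the points
    near an earlier position are carried near a slightly later one, so their curves last
    correspondingly longer. *)
Theorem flow_domain_open Z :
  (forall x : S, exists N T, [/\ nbhs x N, 0 < T &
    forall y, N y -> exists2 c, c 0 = y & flows Z [set t | `|t| < T] c]) ->
  open (flow_domain Z).
Proof.
move=> loc; rewrite openE => -[t0 x0] /(flow_domainP hS)[I [c [Hc It0]]].
have /integral_curveP[iI I0 c0 [_ Fc]] := Hc.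
pose Q tau := exists A del, [/\ nbhs (c tau) A, 0 < del &
  forall z t, A z -> `|t - (t0 - tau)| < del -> flow_domain Z (t, z)].
(* [Q tau]: curves from points near [c tau] last about as long as that of [c tau]. *)
have Qt0 : Q t0.
  have [N [T [xN T0 HN]]] := loc (c t0); exists N, T; split=> // z t Nz.
  rewrite subrr subr0 => tT; have [e e0 Fe] := HN z Nz.
  apply/(flow_domainP hS); exists [set t | `|t| < T], e; split=> //.
  by apply/integral_curveP; split=> //=; [exact: is_interval_norm_lt|rewrite normr0].
have step tau0 : I tau0 -> exists2 eta, 0 < eta & forall tau1 tau2, I tau1 -> I tau2 ->
    `|tau1 - tau0| < eta -> `|tau2 - tau0| < eta -> Q tau2 -> Q tau1.
  move=> Itau0.
  have [N [T [xN T0 HN]]] := loc (c tau0).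
  have [W [T' [xW T'0 HW]]] := flow_continuous Z (c tau0).
  have NW : nbhs (c tau0) (N° `&` W).
    by apply: filterI => //; apply: open_nbhs_nbhs; split; [exact: open_interior|].
  have [r r0 Hr] := along_continuous Fc Itau0 NW.
  exists (Num.min r (Num.min (T / 2) (T' / 2))).
    by rewrite !lt_min r0 !divr_gt0.
  move=> tau1 tau2 I1 I2; rewrite !lt_min => /and3P[r1 T1 T'1] /and3P[r2 T2 T'2].
  move=> [A [del [cA del0 HA]]].
  have [Ny Wy] := Hr tau1 I1 r1.
  set s := tau2 - tau1.
  have sE : s = (tau2 - tau0) - (tau1 - tau0) by rewrite /s; ring.
  have sT : `|s| < T.
    by rewrite sE (le_lt_trans (ler_normB _ _))// [T]splitr ltrD.
  have sT' : `|s| < T'.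
    by rewrite sE (le_lt_trans (ler_normB _ _))// [T']splitr ltrD.
  pose I' := [set t | I (t - - tau1)].
  have iI' : is_interval I'.
    move=> u v /= Iu Iv w /andP[uw wv]; apply: (iI _ _ Iu Iv).
    by rewrite !lerD2r uw.
  have I'0 : I' 0 by rewrite /I' /= sub0r opprK.
  have I's : I' s by rewrite /I' /= opprK subrK.
  have cA' : nbhs (c (s - - tau1)) A by rewrite opprK subrK.
  have [A' yA' HA'] := HW _ Wy I' (fun t => c (t - - tau1)) iI' I'0 (@along_shift _ _ Z I c (- tau1) Fc)
    (congr1 c (etrans (sub0r _) (opprK _))) s I's sT' A cA'.
  exists (N `&` A'), del; split=> // [|z t [Nz Az] tdel]; first exact: filterI.
  have [e e0 Fe] := HN z Nz.
  rewrite -(subrK s t) -e0; apply: (flow_domain_concat sT Fe).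
  apply: HA; last by rewrite (_ : t - s - (t0 - tau2) = t - (t0 - tau1))// /s; ring.
  apply: (HA' z Az [set t | `|t| < T] e) => //=.
  - exact: is_interval_norm_lt.
  - by rewrite normr0.
  - exact: Fe.2.
have tauI s : 0 <= s <= 1 -> I (t0 - t0 * s).
  move=> /andP[s0 s1]; have [t00|t00] := leP 0 t0.
    apply: (iI 0 t0) => //; apply/andP; split.
      by rewrite subr_ge0 ler_piMr.
    by rewrite lerBlDr lerDl mulr_ge0.
  apply: (iI t0 0) => //; apply/andP; split.
    by rewrite lerBrDr gerDl mulr_le0_ge0// ltW.
  by rewrite subr_le0 -[X in X <= _]mulr1 ler_wnM2l// ltW.
have k0 : 0 < `|t0| + 1 by rewrite ltr_wpDl.
have dist s v eta : `|v - s| < eta / (`|t0| + 1) ->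
    `|t0 - t0 * v - (t0 - t0 * s)| < eta.
  rewrite ltr_pdivlMr// => h; rewrite (_ : _ - _ = t0 * (s - v)); last by ring.
  rewrite normrM distrC; apply: le_lt_trans h; rewrite mulrC ler_wpM2l//; lra.
have Q0 : Q 0.
  have : forall s, 0 <= s <= 1 -> Q (t0 - t0 * s).
    apply: real_induction.
    - by rewrite mulr0 subr0.
    - move=> s /andP[s0 s1] Ps; have s01 : 0 <= s <= 1 by rewrite s0 ltW.
      have [eta eta0 He] := step _ (tauI s s01).
      exists (eta / (`|t0| + 1)); first by rewrite divr_gt0.
      move=> v /andP[sv vr] v1; apply: (He _ (t0 - t0 * s)).
      + by apply: tauI; rewrite v1 andbT (le_trans s0)// ltW.
      + exact: tauI.
      + by apply: dist; rewrite gtr0_norm ?subr_gt0// ltrBlDl.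
      + by rewrite subrr normr0.
      + by apply: Ps; rewrite s0 lexx.
    - move=> s /andP[s0 s1] Ps; have s01 : 0 <= s <= 1 by rewrite s1 ltW.
      have [eta eta0 He] := step _ (tauI s s01).
      have r0 : 0 < eta / (`|t0| + 1) by rewrite divr_gt0.
      have [v [v0 vs vr]] := near_left s0 r0.
      apply: (He _ (t0 - t0 * v)).
      + exact: tauI.
      + by apply: tauI; rewrite v0 (le_trans (ltW vs)).
      + by rewrite subrr normr0.
      + exact: dist.
      + by apply: Ps; rewrite v0.
  by move=> /(_ 1); rewrite ler01 lexx mulr1 subrr; exact.
have [A [del [xA del0 HA]]] := Q0; rewrite c0 subr0 in xA HA.
exists (ball t0 del, A); first by split=> //=; exact: nbhsx_ballx.
move=> [t z] [/= tt Az]; apply: HA => //.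
by rewrite distrC.
Qed.

End Openness.
End FlowDomain.

(** * Vector fields are the derivations that vanish at minima *)

Section VectorFields.
Variables (R : realType) (S : diffSpaceType R).
Implicit Types (X Y Z : C^oo(S) -> C^oo(S)) (I : set R) (c : R -> S).
Hypothesis hS : subcartesian S.

(** Openness of the flow domain at [(0, k)] provides integral curves from [k] that last
    for some positive time, and others that last for some negative time.  As [rho] is
    minimal at [k], the former show [0 <= X rho k] and the latter [X rho k <= 0]. *)
Lemma Vect_annihilates_minima X : Vect X -> annihilates_minima X.
Proof.
move=> [dX oD] rho k kmin.
have D0 : flow_domain X (0, k).
  by apply/(flow_domainP hS); exists [set 0], (fun=> k); split=> //; exact: integral_curve_point.
have [[A B] /= [A0 Bk] AB] := open_nbhs_nbhs (conj oD D0).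
have /nbhs_ballP[e /= e0 eA] := A0.
have sign t : `|t| < e -> 0 <= X rho k * t.
  move=> te; have Dt : flow_domain X (t, k).
    apply: AB; split=> /=; last exact: nbhs_singleton.
    by apply: eA; rewrite /ball /= sub0r normrN.
  have [I [c [/integral_curveP[iI I0 c0 [_ Hc]] It]]] := (flow_domainP hS X t k).1 Dt.
  apply/ler_addgt0Pr => d d0.
  have k0 : 0 < `|t| + 1 by rewrite ltr_wpDl.
  have ckmin : nbhs (c 0) [set y | rho k <= rho y] by rewrite c0.
  have [r r0 Hr] := along_continuous Hc I0 ckmin.
  have [q q0 Hq] := Hc rho 0 I0 _ (divr_gt0 d0 k0).
  pose l := Num.min 1 (Num.min r q / 2 / (`|t| + 1)).
  have m0 : 0 < Num.min r q by rewrite lt_min r0.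
  have l0 : 0 < l by rewrite lt_min ltr01 !divr_gt0.
  have lt : `|l * t| < Num.min r q.
    rewrite normrM gtr0_norm//.
    apply: (@le_lt_trans _ _ (Num.min r q / 2)); last by rewrite ltr_pdivrMr// ltr_pMr// ltr1n.
    apply: (@le_trans _ _ (Num.min r q / 2 / (`|t| + 1) * (`|t| + 1))).
      by apply: ler_pM; rewrite ?(ltW l0)// ?lerDl// /l ge_min lexx orbT.
    by rewrite divfK// gt_eqF.
  have l1 : l <= 1 by rewrite ge_min lexx.
  have Il : I (l * t).
    have [t0|t0] := leP 0 t.
      by apply: (iI 0 t) => //; rewrite mulr_ge0 ?(ltW l0)//= ler_piMl.
    apply: (iI t 0) => //; apply/andP; split; last by rewrite mulr_ge0_le0// ltW.
    by rewrite -[X in X <= _]mul1r ler_wnM2r// ltW.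
  move: lt; rewrite lt_min -[l * t]subr0 => /andP[lr lq].
  have := Hr _ Il lr; have := Hq _ Il lq; rewrite c0 subr0 /= => h1 h2.
  have {}h1 : 0 <= X rho k * (l * t) + d / (`|t| + 1) * `|l * t|.
    by move: h1; rewrite ler_norml => /andP[_]; lra.
  have h3 : d / (`|t| + 1) * `|t| <= d.
    by rewrite mulrAC ler_pdivrMr// ler_pM2l// lerDl.
  move: h1; rewrite normrM (gtr0_norm l0).
  rewrite (_ : _ + _ = l * (X rho k * t + d / (`|t| + 1) * `|t|)); last by ring.
  by rewrite pmulr_rge0//; lra.
have e20 : 0 < e / 2 by rewrite divr_gt0.
have e2 : e / 2 < e by rewrite ltr_pdivrMr// ltr_pMr// ltr1n.
have h1 : 0 <= X rho k * (e / 2) by apply: sign; rewrite gtr0_norm.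
have h2 : 0 <= X rho k * - (e / 2) by apply: sign; rewrite normrN gtr0_norm.
apply/eqP; rewrite eq_le -(pmulr_lge0 _ e20) h1 andbT.
by rewrite -oppr_ge0 -(pmulr_lge0 _ e20) mulNr -mulrN.
Qed.

Hypothesis hlc : locally_compact [set: S].

Theorem VectP X : Vect X <-> derivation X /\ annihilates_minima X.
Proof.
split=> [VX|[dX MX]]; first by split; [case: VX|exact: Vect_annihilates_minima].
split=> //; apply: (flow_domain_open hS hlc); exact: (local_flow hS hlc dX MX).
Qed.

Lemma mean_value_from0 (h d : R -> R) (t M : R) :
  (forall s, between 0 t s -> has_slope [set s | between 0 t s] h s (d s)) ->
  (forall s, between 0 t s -> `|d s| <= M) -> `|h t - h 0| <= M * `|t|.
Proof.
move=> H dM; have [t0|t0] := leP 0 t.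
  have sub s : 0 <= s <= t -> between 0 t s by rewrite /between => ->.
  have := @mean_value_bound R 0 t M h d t0; rewrite subr0 (ger0_norm t0); apply.
    by move=> s /sub st; apply: has_slope_sub (H s st) => u; exact: sub.
  by move=> s /sub; exact: dM.
have sub s : t <= s <= 0 -> between 0 t s by rewrite /between orbC => ->.
have := @mean_value_bound R t 0 M h d (ltW t0); rewrite sub0r distrC (ltr0_norm t0); apply.
  by move=> s /sub st; apply: has_slope_sub (H s st) => u; exact: sub.
by move=> s /sub; exact: dM.
Qed.

Lemma between_norm (t s : R) : between 0 t s -> `|s| <= `|t|.
Proof.
by rewrite ler_norml => /orP[] /andP[h1 h2]; have := ler_norm t;
  have := ler_norm (- t); rewrite normrN => h3 h4; apply/andP; split; lra.
Qed.

Section Taylor.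
Variables (X : C^oo(S) -> C^oo(S)) (t C : R) (c : R -> S).
Hypothesis Hc : along X [set s | between 0 t s] c.

Let between_sub s : between 0 t s -> [set u | between 0 s u] `<=` [set u | between 0 t u].
Proof.
move=> h u; rewrite /between /= => h'; move: h h' => /orP[] /andP[h1 h2] /orP[] /andP[h3 h4];
  apply/orP; by [left; apply/andP; split; lra|right; apply/andP; split; lra].
Qed.

Lemma along_taylor0 (g : C^oo(S)) s : between 0 t s ->
  (forall u, between 0 t u -> `|X g (c u)| <= C) ->
  `|g (c s) - g (c 0)| <= C * `|s|.
Proof.
move=> st HC; apply: (mean_value_from0 (h := fun u => g (c u)) (d := fun u => X g (c u))) => u us.
  by apply: has_slope_sub (between_sub st) _; apply: Hc; exact: between_sub us.
by apply: HC; exact: between_sub us.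
Qed.

Lemma along_taylor1 (g : C^oo(S)) s : between 0 t s ->
  (forall u, between 0 t u -> `|X (X g) (c u)| <= C) ->
  `|g (c s) - g (c 0) - s * X g (c 0)| <= C * `|s| * `|s|.
Proof.
move=> st HC.
have := @mean_value_from0 (fun u => g (c u) - X g (c 0) * u)
  (fun u => X g (c u) - X g (c 0) * 1) s (C * `|s|).
rewrite mulr0 subr0 (_ : g (c s) - X g (c 0) * s - g (c 0) = g (c s) - g (c 0) - s * X g (c 0));
  last by ring.
have C0 : 0 <= C by rewrite (le_trans _ (HC s st)).
apply=> u us; have ut := between_sub st us.
  apply: has_slopeB; last by apply: has_slopeZ; exact: has_slope_id.
  by apply: has_slope_sub (between_sub st) _; exact: Hc.
rewrite mulr1; apply: (le_trans (along_taylor0 ut HC)); rewrite ler_wpM2l//.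
exact: between_norm.
Qed.

Lemma along_taylor2 (g : C^oo(S)) : (forall u, between 0 t u -> `|X (X (X g)) (c u)| <= C) ->
  `|g (c t) - g (c 0) - t * X g (c 0) - t ^+ 2 / 2 * X (X g) (c 0)| <= C * `|t| * `|t| * `|t|.
Proof.
move=> HC.
have := @mean_value_from0 (fun u => g (c u) - X g (c 0) * u - X (X g) (c 0) / 2 * (u * u))
  (fun u => X g (c u) - X g (c 0) * 1 - X (X g) (c 0) / 2 * (u * 1 + 1 * u)) t (C * `|t| * `|t|).
rewrite !mulr0 !subr0 (_ : g (c t) - _ - _ - _ =
  g (c t) - g (c 0) - t * X g (c 0) - t ^+ 2 / 2 * X (X g) (c 0)); last by ring.
have tt : between 0 t t by rewrite /between lexx andbT andTb; exact: le_total.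
have C0 : 0 <= C by rewrite (le_trans _ (HC t tt)).
apply=> u ut.
  apply: has_slopeB; first apply: has_slopeB.
  - exact: Hc.
  - by apply: has_slopeZ; exact: has_slope_id.
  - by apply: has_slopeZ; apply: has_slopeM; exact: has_slope_id.
rewrite (_ : X g (c u) - _ - _ = X g (c u) - X g (c 0) - u * X (X g) (c 0)); last by field.
apply: (le_trans (along_taylor1 ut HC)).
have un := between_norm ut.
apply: ler_pM => //; first by rewrite mulr_ge0.
by rewrite ler_wpM2l.
Qed.

End Taylor.

(** The second order expansion of [rho] along the flow of [X] for time [-s], of [Y]
    for time [tau] and of [X] for time [s], at a point where [X rho] and [Y rho]
    vanish.  The values of a function at the four successive points carry the
    indices [0] to [3]. *)
Lemma conjugated_flow_expansion (s tau C R0 R1 R2 R3 X1 X2 XX0 XX1 XX2 Y1 XY0 YY0 YY1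
    YX0 YX1 : R) : 0 <= s -> `|tau| <= s -> 0 <= C ->
  `|R3 - R2 - s * X2 - s ^+ 2 / 2 * XX2| <= C * s * s * s ->
  `|R2 - R1 - tau * Y1 - tau ^+ 2 / 2 * YY1| <= C * `|tau| * `|tau| * `|tau| ->
  `|X2 - X1 - tau * YX1| <= C * `|tau| * `|tau| ->
  `|XX2 - XX1| <= C * `|tau| ->
  `|R1 - R0 - s ^+ 2 / 2 * XX0| <= C * s * s * s ->
  `|Y1 + s * XY0| <= C * s * s ->
  `|YY1 - YY0| <= C * s ->
  `|X1 + s * XX0| <= C * s * s ->
  `|YX1 - YX0| <= C * s ->
  `|XX1 - XX0| <= C * s ->
  R3 - R0 <= tau ^+ 2 / 2 * YY0 + tau * s * (YX0 - XY0) + 10 * (C * s * s * s).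
Proof.
move=> s0 ts C0 e3 e2a e2b e2c e1a e1b e1c e1d e1e e1f.
have Cs : C * `|tau| <= C * s by rewrite ler_wpM2l.
have Cs0 : 0 <= C * s by rewrite mulr_ge0.
have Css : C * `|tau| * `|tau| <= C * s * s by apply: ler_pM => //; exact: mulr_ge0.
have Csss : C * `|tau| * `|tau| * `|tau| <= C * s * s * s.
  by apply: ler_pM => //; rewrite !mulr_ge0.
have {}e2a := le_trans e2a Csss; have {}e2b := le_trans e2b Css.
have {}e2c := le_trans e2c Cs.
have bnd (a p e q : R) : `|a| <= p -> `|e| <= q -> a * e <= p * q.
  by move=> ap eq; apply: (le_trans (ler_norm _)); rewrite normrM ler_pM.
have ss : `|s| <= s by rewrite ger0_norm.
have s2 : `|s ^+ 2 / 2| <= s * s.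
  rewrite ger0_norm ?divr_ge0 ?sqr_ge0// expr2.
  have := mulr_ge0 s0 s0; lra.
have t2 : `|tau ^+ 2 / 2| <= s * s.
  rewrite ger0_norm ?divr_ge0 ?sqr_ge0// -real_normK ?num_real// expr2.
  have : `|tau| * `|tau| <= s * s by apply: ler_pM.
  have := mulr_ge0 (normr_ge0 tau) (normr_ge0 tau); lra.
have st : `|s * tau| <= s * s by rewrite normrM; apply: ler_pM.
have b1 := bnd _ _ _ _ ss e2b.
have b2 := bnd _ _ _ _ s2 e2c.
have b3 := bnd _ _ _ _ ts e1b.
have b4 := bnd _ _ _ _ t2 e1c.
have b5 := bnd _ _ _ _ ss e1d.
have b6 := bnd _ _ _ _ st e1e.
have b7 := bnd _ _ _ _ s2 e1f.
have b8 := le_trans (ler_norm _) e3.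
have b9 := le_trans (ler_norm _) e2a.
have b10 := le_trans (ler_norm _) e1a.
rewrite (_ : R3 - R0 = tau ^+ 2 / 2 * YY0 + tau * s * (YX0 - XY0)
  + ((R3 - R2 - s * X2 - s ^+ 2 / 2 * XX2) + (R2 - R1 - tau * Y1 - tau ^+ 2 / 2 * YY1)
   + s * (X2 - X1 - tau * YX1) + s ^+ 2 / 2 * (XX2 - XX1)
   + (R1 - R0 - s ^+ 2 / 2 * XX0) + tau * (Y1 + s * XY0) + tau ^+ 2 / 2 * (YY1 - YY0)
   + s * (X1 + s * XX0) + s * tau * (YX1 - YX0) + s ^+ 2 / 2 * (XX1 - XX0))); last by field.
rewrite lerD2l.
rewrite (_ : 10 * (C * s * s * s) = C * s * s * s + C * s * s * s + s * (C * s * s)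
  + s * s * (C * s) + C * s * s * s + s * (C * s * s) + s * s * (C * s)
  + s * (C * s * s) + s * s * (C * s) + s * s * (C * s)); last by ring.
by do 9 (apply: lerD => //).
Qed.

(** Let [k] be a minimum of [rho] and move [k] along the flows of [X], [Y], [X] for
    the times [-s], [l * s], [s].  To second order in [s] the change of [rho] is
    [s^2] times [l^2 / 2 * Y (Y rho) k - l * [X, Y] rho k], which is therefore
    nonnegative for all small [l] of both signs; so the bracket term vanishes. *)
Lemma annihilates_minima_commutator X Y : derivation X -> derivation Y ->
  annihilates_minima X -> annihilates_minima Y -> annihilates_minima (commutator X Y).
Proof.
move=> dX dY MX MY rho k kmin.
have [NX [TX [kNX TX0 HX]]] := local_flow hS hlc dX MX k.
have [NY [TY [kNY TY0 HY]]] := local_flow hS hlc dY MY k.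
pose gs := [:: X (X (X rho)); Y (Y (Y rho)); Y (Y (X rho)); Y (X (X rho));
               X (X (Y rho)); X (Y (Y rho)); X (Y (X rho))].
pose C := \sum_(g <- gs) (`|g k| + 1).
have C0 : 0 <= C by apply: sumr_ge0 => g _; rewrite addr_ge0.
have kC : \forall y \near k, forall g, g \in gs -> `|g y| <= C.
  have : \forall y \near k, forall i : 'I_(size gs), `|gs`_i y| <= C.
    apply: (@filter_forall _ _ (fun (i : 'I_(size gs)) y => `|gs`_i y| <= C : Prop)
      _ (nbhs_filter k)) => i.
    have /cvgrPdist_lt/(_ 1 ltr01) := @smooth_continuous _ _ (gs`_i) k.
    apply: filterS => y yk; apply: (@le_trans _ _ (`|gs`_i k| + 1)).
      rewrite (_ : gs`_i y = gs`_i k - (gs`_i k - gs`_i y)); last by ring.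
      by apply: (le_trans (ler_normB _ _)); rewrite lerD2l ltW.
    rewrite /C (big_nth 0) big_mkord (bigD1 i)//= lerDl; apply: sumr_ge0 => j _.
    by rewrite addr_ge0.
  apply: filterS => y yC g /(nthP 0)[i isz <-]; exact: (yC (Ordinal isz)).
pose N := [set y | rho k <= rho y] `&` (NX `&` (NY `&` [set y | forall g, g \in gs -> `|g y| <= C])).
have kN : nbhs k N by apply: filterI => //; apply: filterI => //; exact: filterI.
have [W2 [T2 [kW2 T20 W2N stay2]]] := flow_stays X hlc kN.
have [W1 [T1 [kW1 T10 W1W2 stay1]]] := flow_stays Y hlc kW2.
have [W0 [T0 [kW0 T00 W0W1 stay0]]] := flow_stays X hlc kW1.
pose T := Num.min (Num.min TX TY) (Num.min T2 (Num.min T1 T0)).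
have Tpos : 0 < T by rewrite !lt_min TX0 TY0 T20 T10.
pose A := Y (X rho) k - X (Y rho) k.
pose b := Y (Y rho) k.
have X0 : X rho k = 0 by exact: MX.
have Y0 : Y rho k = 0 by exact: MY.
have key s l : 0 < s < T -> `|l| <= 1 ->
    0 <= (l * s) ^+ 2 / 2 * b + l * s * s * A + 10 * (C * s * s * s).
  move=> /andP[s0 sT] l1; set tau := l * s.
  have ts : `|tau| <= s by rewrite normrM (gtr0_norm s0) ler_piMl// ltW.
  have sT' : `|s| < T by rewrite gtr0_norm.
  have msT : `|- s| < T by rewrite normrN.
  have tT : `|tau| < T by exact: le_lt_trans sT.
  have lts (r : R) : `|r| < T -> [/\ `|r| < TX, `|r| < TY, `|r| < T2, `|r| < T1 & `|r| < T0].
    by rewrite !lt_min => /andP[/andP[-> ->] /and3P[-> -> ->]].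
  have curve Z TZ W N' Tw c r : (forall I c, is_interval I -> I 0 -> along Z I c -> W (c 0) ->
        forall t, I t -> `|t| < Tw -> N' (c t)) -> flows Z [set t | `|t| < TZ] c ->
      `|r| < TZ -> `|r| < Tw -> W (c 0) ->
      along Z [set u | between 0 r u] c /\ forall u, between 0 r u -> N' (c u).
    move=> st Fc rZ rw Wc0.
    have bet u : between 0 r u -> `|u| < TZ /\ `|u| < Tw.
      by move=> /between_norm ur; split; apply: le_lt_trans ur _.
    split=> [|u /bet[uZ uw]]; first by apply: along_sub Fc.2 => u /bet[].
    apply: (st [set t | `|t| < TZ]) => //=; [exact: is_interval_norm_lt| |exact: Fc.2].
    by rewrite normr0 (le_lt_trans _ rZ).
  have b_end (r : R) : between 0 r r by rewrite /between lexx andbT andTb; exact: le_total.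
  have bound (g : C^oo(S)) y : g \in gs -> N y -> `|g y| <= C.
    by move=> gg [_ [_ [_ H]]]; exact: H.
  have W0N : W0 `<=` N by move=> y /W0W1/W1W2/W2N.
  have W1N : W1 `<=` N by move=> y /W1W2/W2N.
  have kW0' := nbhs_singleton kW0.
  have [c1 c10 F1] := HX k (W0N _ kW0').2.1.
  have [msX _ _ _ msT0] := lts _ msT.
  have [A1 B1] := curve X TX W0 W1 T0 c1 (- s) stay0 F1 msX msT0
    (eq_ind_r W0 kW0' c10).
  have y1 := B1 _ (b_end _); set y1' := c1 (- s) in y1.
  have [c2 c20 F2] := HY y1' (W1N _ y1).2.2.1.
  have [_ tY _ tT1 _] := lts _ tT.
  have [A2 B2] := curve Y TY W1 W2 T1 c2 tau stay1 F2 tY tT1 (eq_ind_r W1 y1 c20).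
  have y2 := B2 _ (b_end _); set y2' := c2 tau in y2.
  have [c3 c30 F3] := HX y2' (W2N _ y2).2.1.
  have [sX _ sT2 _ _] := lts _ sT'.
  have [A3 B3] := curve X TX W2 N T2 c3 s stay2 F3 sX sT2 (eq_ind_r W2 y2 c30).
  have y3 := B3 _ (b_end _).
  have {}B1 u : between 0 (- s) u -> N (c1 u) by move=> /B1/W1N.
  have {}B2 u : between 0 tau u -> N (c2 u) by move=> /B2/W2N.
  have ns : `|- s| = s by rewrite normrN gtr0_norm.
  have e3 := along_taylor2 A3 (g := rho) (C := C).
  have e2a := along_taylor2 A2 (g := rho) (C := C).
  have e2b := along_taylor1 A2 (g := X rho) (C := C) (b_end tau).
  have e2c := along_taylor0 A2 (g := X (X rho)) (C := C) (b_end tau).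
  have e1a := along_taylor2 A1 (g := rho) (C := C).
  have e1b := along_taylor1 A1 (g := Y rho) (C := C) (b_end (- s)).
  have e1c := along_taylor0 A1 (g := Y (Y rho)) (C := C) (b_end (- s)).
  have e1d := along_taylor1 A1 (g := X rho) (C := C) (b_end (- s)).
  have e1e := along_taylor0 A1 (g := Y (X rho)) (C := C) (b_end (- s)).
  have e1f := along_taylor0 A1 (g := X (X rho)) (C := C) (b_end (- s)).
  rewrite c30 (gtr0_norm s0) in e3.
  rewrite c20 in e2a e2b e2c.
  rewrite c10 ns X0 ?sqrrN ?mulr0 ?subr0 in e1a.
  rewrite c10 ns Y0 subr0 mulNr opprK in e1b.
  rewrite c10 ns in e1c.
  rewrite c10 ns X0 subr0 mulNr opprK in e1d.
  rewrite c10 ns in e1e.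
  rewrite c10 ns in e1f.
  have kmin3 : rho k <= rho (c3 s) by case: y3.
  rewrite -subr_ge0 in kmin3; apply: (le_trans kmin3).
  apply: (@conjugated_flow_expansion s tau C (rho k) (rho y1') (rho y2') (rho (c3 s))
    (X rho y1') (X rho y2') (X (X rho) k) (X (X rho) y1') (X (X rho) y2') (Y rho y1')
    (X (Y rho) k) (Y (Y rho) k) (Y (Y rho) y1') (Y (X rho) k) (Y (X rho) y1')) => //;
    first exact: ltW.
  - by apply: e3 => u /B3; apply: bound; rewrite !inE eqxx ?orbT.
  - by apply: e2a => u /B2; apply: bound; rewrite !inE eqxx ?orbT.
  - by apply: e2b => u /B2; apply: bound; rewrite !inE eqxx ?orbT.
  - by apply: e2c => u /B2; apply: bound; rewrite !inE eqxx ?orbT.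
  - by apply: e1a => u /B1; apply: bound; rewrite !inE eqxx ?orbT.
  - by apply: e1b => u /B1; apply: bound; rewrite !inE eqxx ?orbT.
  - by apply: e1c => u /B1; apply: bound; rewrite !inE eqxx ?orbT.
  - by apply: e1d => u /B1; apply: bound; rewrite !inE eqxx ?orbT.
  - by apply: e1e => u /B1; apply: bound; rewrite !inE eqxx ?orbT.
  - by apply: e1f => u /B1; apply: bound; rewrite !inE eqxx ?orbT.
have quad l : `|l| <= 1 -> 0 <= l ^+ 2 / 2 * b + l * A.
  move=> l1; apply/ler_addgt0Pr => e e0.
  have k0 : 0 < 10 * C + 1 by rewrite ltr_wpDl// mulr_ge0.
  pose s := Num.min (T / 2) (e / (10 * C + 1)).
  have s0 : 0 < s by rewrite lt_min !divr_gt0.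
  have sT : s < T.
    rewrite (@le_lt_trans _ _ (T / 2))//; first by rewrite /s ge_min lexx.
    by rewrite ltr_pdivrMr// ltr_pMr// ltr1n.
  have sC : 10 * C * s <= e.
    have : s <= e / (10 * C + 1) by rewrite /s ge_min lexx orbT.
    by rewrite ler_pdivlMr//; lra.
  have sT0 : 0 < s < T by rewrite s0.
  have := key s l sT0 l1.
  rewrite (_ : _ + _ + _ = s ^+ 2 * (l ^+ 2 / 2 * b + l * A + 10 * C * s)); last by ring.
  by rewrite pmulr_rge0 ?exprn_gt0//; lra.
have A_small l : 0 < l <= 1 -> `|A| <= l / 2 * b.
  move=> /andP[l0 l1].
  have h1 := quad l; rewrite (gtr0_norm l0) in h1; have {}h1 := h1 l1.
  have h2 := quad (- l); rewrite normrN (gtr0_norm l0) in h2; have {}h2 := h2 l1.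
  rewrite -(ler_pM2l l0) -{1}(gtr0_norm l0) -normrM ler_norml.
  by rewrite sqrrN mulNr in h2; rewrite expr2 in h1 h2; apply/andP; split; lra.
have A0 : A = 0.
  apply/eqP; rewrite -normr_le0; apply/ler_addgt0Pr => e e0; rewrite add0r.
  have k0 : 0 < `|b| + 1 by rewrite ltr_wpDl.
  pose l := Num.min 1 (e / (`|b| + 1)).
  have l0 : 0 < l by rewrite lt_min ltr01 divr_gt0.
  have l1 : 0 < l <= 1 by rewrite l0 ge_min lexx.
  apply: (le_trans (A_small l l1)).
  have h1 : l * b <= l * `|b| by rewrite ler_pM2l// ler_norm.
  have h2 : l * (`|b| + 1) <= e by rewrite -ler_pdivlMr// ge_min lexx orbT.
  have h3 : 0 <= l * `|b| by rewrite mulr_ge0// ltW.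
  lra.
rewrite /commutator smoothBE; apply/eqP; rewrite subr_eq0 eq_sym -subr_eq0; exact/eqP.
Qed.

End VectorFields.

Theorem corollary4p71 (R : realType) (S : diffSpaceType R)
    (hS : subcartesian S) (hlc : locally_compact [set: S]) :
  lie_subalgebra (@Vect R S) (@derivation R S) /\
  Cinf_submodule (@Vect R S).
Proof.
have V X := VectP hS hlc X.
have [_ subR bracket] := @derivation_lie_subalgebra R S.
have subC := @derivation_Cinf_submodule R S.
have M0 : annihilates_minima (0 : C^oo(S) -> C^oo(S)) by move=> rho k _.
split; first split.
- by move=> X /V[].
- case: subR => d0 dlin; split=> [|a X Y]; rewrite !inE.
    by apply/V; split=> //; move: d0; rewrite inE.
  move=> /V[dX MX] /V[dY MY]; apply/V; split.
    by have := dlin a X Y; rewrite !inE; apply.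
  move=> rho k kmin.
  by rewrite (_ : (a *: X + Y) rho = a *: X rho + Y rho)// smoothDE smoothZE MX// MY// mulr0 addr0.
- move=> X Y /V[dX MX] /V[dY MY]; apply/V; split; first exact: bracket.
  exact: annihilates_minima_commutator.
- case: subC => d0 dlin; split=> [|h X Y]; rewrite !inE.
    by apply/V; split=> //; move: d0; rewrite inE.
  move=> /V[dX MX] /V[dY MY]; apply/V; split.
    by have := dlin h X Y; rewrite !inE; apply.
  move=> rho k kmin.
  by rewrite (_ : (_ + Y) rho = h * X rho + Y rho)// smoothDE smoothME MX// MY// mulr0 addr0.
Qed.
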